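(* Let $S=\{s_1,\ldots,s_{n-1}\}$ be the set of adjacent transpositions generating $\mathfrak S_n$. (i) If $\alpha$ is a composition of $n$, then $\mathbf P_\alpha\cong\mathcal P_I^S$ as $\mathcal H_n(0)$-modules, where $I=\{s_i:i\in D(\alpha)\}$. (ii) Let $\alpha=\alpha^1\oplus\cdots\oplus\alpha^k$ be a generalized ribbon of size $n$ with connected components $\alpha^i\models n_i$ for $i=1,\ldots,k$. Let $$I=\{s_i:i\in D(\alpha^1\rhd\cdots\rhd\alpha^k)\}\quad\text{and}\quad J=\{s_j:j\in D(1^{n_1}\rhd\cdots\rhd1^{n_k})\}.$$ Then $\mathbf P_\alpha$, with the action of $\overline\pi_1,\ldots,\overline\pi_{n-1}$ on standard tableaux given in the context, is a well-defined $\mathcal H_n(0)$-module and is isomorphic to $\mathcal P_{I,J}^S$. Consequently, $$\mathbf P_\alpha\ \cong\ \left(\mathbf P_{\alpha^1}\otimes\cdots\otimes\mathbf P_{\alpha^k}\right)\uparrow_{\mathcal H_{n_1,\ldots,n_k}(0)}^{\mathcal H_n(0)}\ \cong\ \bigoplus_{\beta\in[\alpha]}\mathbf P_\beta .$$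
   Context: $\mathbb F$ is an arbitrary field. $\mathcal H_n(0)$ is the $\mathbb F$-algebra generated by $\pi_1,\ldots,\pi_{n-1}$ with relations $\pi_i^2=\pi_i$ and the braid relations of $\mathfrak S_n$ (with $s_i=(i,i+1)$); $\overline\pi_i:=\pi_i-1$, so $\overline\pi_i^2=-\overline\pi_i$, with the same braid relations. For $w\in\mathfrak S_n$ with reduced expression $w=s_{i_1}\cdots s_{i_r}$, $\pi_w=\pi_{i_1}\cdots\pi_{i_r}$ and $\overline\pi_w=\overline\pi_{i_1}\cdots\overline\pi_{i_r}$. For $I\subseteq S$, $w_0(I)$ is the longest element of the subgroup generated by $I$. Define left ideals $\mathcal P_I^S:=\mathcal H_n(0)\overline\pi_{w_0(I)}\pi_{w_0(S\setminus I)}$ and $\mathcal P_{I,J}^S:=\mathcal H_n(0)\overline\pi_{w_0(I)}\pi_{w_0(J\setminus I)}$ for $I,J\subseteq S$. A composition $\alpha=(\alpha_1,\ldots,\alpha_\ell)$ of $n$ ($\alpha\models n$) is a sequence of positive integers with sum $n$; $D(\alpha)=\{\alpha_1,\alpha_1+\alpha_2,\ldots,\alpha_1+\cdots+\alpha_{\ell-1}\}$; $1^m=(1,\ldots,1)\models m$. $\alpha$ is identified with its ribbon diagram: rows of lengths $\alpha_1,\ldots,\alpha_\ell$ from bottom to top, the last box of each row lying directly below the first box of the next row up. For compositions $\alpha=(\alpha_1,\ldots,\alpha_\ell)$, $\beta=(\beta_1,\ldots,\beta_k)$: $\alpha\cdot\beta=(\alpha_1,\ldots,\alpha_\ell,\beta_1,\ldots,\beta_k)$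 and $\alpha\rhd\beta=(\alpha_1,\ldots,\alpha_{\ell-1},\alpha_\ell+\beta_1,\beta_2,\ldots,\beta_k)$. A generalized ribbon $\alpha=\alpha^1\oplus\cdots\oplus\alpha^k$ is a skew diagram whose connected components are ribbons $\alpha^1,\ldots,\alpha^k$, with $\alpha^{i+1}$ strictly to the northeast of $\alpha^i$; its size is the total number of boxes. Define $[\alpha^1]=\{\alpha^1\}$ and $[\alpha]=\{\beta\cdot\alpha^k,\ \beta\rhd\alpha^k:\beta\in[\alpha^1\oplus\cdots\oplus\alpha^{k-1}]\}$. A standard tableau of shape $\alpha$ (of size $n$) is a filling of the boxes with $1,\ldots,n$, each used once, rows increasing left to right and columns increasing top to bottom. $\mathbf P_\alpha$ is the $\mathbb F$-vector space with basis the standard tableaux of shape $\alpha$, and for $1\le i\le n-1$ and such $\tau$, $$\overline\pi_i(\tau)=\begin{cases} -\tau, & i\text{ is in a higher row of }\tau\text{ than }i+1, \\ 0, & i\text{ is in the same row of }\tau\text{ as }i+1, \\ s_i(\tau), & i\text{ is in a lower row of }\tau\text{ than }i+1, \end{cases}$$ where $s_i(\tau)$ swaps the entries $i$ and $i+1$. $\mathcal H_{n_1,\ldots,n_k}(0)\cong\mathcal H_{n_1}(0)\otimes\cdots\otimes\mathcal H_{n_k}(0)$ is the subalgebra of $\mathcal H_n(0)$ generated by the $\pi_i$ with $i\notin\{n_1,n_1+n_2,\ldots,n_1+\cdots+n_{k-1}\}$. $N\uparrow_B^A:=A\otimes_BN$. *)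

(* Defs.v *)
From HB Require Import structures.
From mathcomp Require Import all_boot all_fingroup all_algebra.
From mathcomp Require Import generic_quotient boolp.
From mathcomp Require Import finmap monalg.

Set Implicit Arguments.
Unset Strict Implicit.
Unset Printing Implicit Defensive.

Import GRing.Theory.
Import ring_quotient.Quotient.
Local Open Scope ring_scope.
Local Open Scope quotient_scope.

Definition lmod_iso (R : pzRingType) (U V : lmodType R) : Prop :=
  exists f : {linear U -> V}, bijective f.

Section SubmodQuotient.
Variables (R : pzRingType) (V : lmodType R) (G : V -> Prop).

Definition submod_gen : {pred V} := fun v => `[<
  forall S : {pred V}, GRing.submod_closed S ->
    (forall g, G g -> g \in S) -> v \in S >].

Fact submod_gen_closed : GRing.submod_closed submod_gen.
Proof.
split; first by apply/asboolP => S [S0 _] _.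
move=> a u v /asboolP Hu /asboolP Hv; apply/asboolP => S cS GS.
by case: (cS) => _; apply; [apply: Hu | apply: Hv].
Qed.

HB.instance Definition _ :=
  GRing.isSubmodClosed.Build R V submod_gen submod_gen_closed.

Definition submod_quot : Type := quot submod_gen.
HB.instance Definition _ := GRing.Zmodule.on submod_quot.

Definition submod_pi (v : V) : submod_quot := \pi_(quot submod_gen) v.

Fact submod_piE u v : (submod_pi u = submod_pi v) <-> (u - v \in submod_gen).
Proof. by rewrite idealrBE; split => /eqP. Qed.

Definition submod_scale (a : R) (x : submod_quot) : submod_quot :=
  submod_pi (a *: repr (x : quot submod_gen)).

Fact submod_scale_pi a v : submod_scale a (submod_pi v) = submod_pi (a *: v).
Proof.
apply/submod_piE; rewrite -scalerBr; apply: rpredZ.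
by apply/submod_piE; rewrite /submod_pi reprK.
Qed.

Fact submod_piD u v : submod_pi (u + v) = submod_pi u + submod_pi v.
Proof. exact: raddfD. Qed.

Fact submod_piP (x : submod_quot) : exists v, x = submod_pi v.
Proof. by exists (repr (x : quot submod_gen)); rewrite /submod_pi reprK. Qed.

Fact submod_scaleA a b x :
  submod_scale a (submod_scale b x) = submod_scale (a * b) x.
Proof. by case: (submod_piP x) => v ->; rewrite !submod_scale_pi scalerA. Qed.
Fact submod_scale1 : left_id 1 submod_scale.
Proof. by move=> x; case: (submod_piP x) => v ->; rewrite submod_scale_pi scale1r. Qed.
Fact submod_scaleDr : right_distributive submod_scale +%R.
Proof.
move=> a x y; case: (submod_piP x) (submod_piP y) => u -> [v ->].
by rewrite -submod_piD !submod_scale_pi scalerDr submod_piD.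
Qed.
Fact submod_scaleDl x : {morph submod_scale^~ x : a b / a + b}.
Proof.
move=> a b; case: (submod_piP x) => u ->.
by rewrite !submod_scale_pi scalerDl submod_piD.
Qed.
HB.instance Definition _ := GRing.Zmodule_isLmodule.Build R submod_quot
  submod_scaleA submod_scale1 submod_scaleDr submod_scaleDl.
End SubmodQuotient.

Section DirectSum.
Variables (R : pzRingType) (I : finType) (U : I -> lmodType R).

Definition dsum : Type := {dffun forall i : I, U i}.
HB.instance Definition _ := Choice.on dsum.

Implicit Types f g h : dsum.
Definition dsum_zero : dsum := [ffun i : I => 0 : U i].
Definition dsum_opp f : dsum := [ffun i : I => - f i].
Definition dsum_add f g : dsum := [ffun i : I => f i + g i].
Definition dsum_scale a f : dsum := [ffun i : I => a *: f i].

Fact dsum_addA : associative dsum_add.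
Proof. by move=> f g h; apply/ffunP => i; rewrite !ffunE addrA. Qed.
Fact dsum_addC : commutative dsum_add.
Proof. by move=> f g; apply/ffunP => i; rewrite !ffunE addrC. Qed.
Fact dsum_add0 : left_id dsum_zero dsum_add.
Proof. by move=> f; apply/ffunP => i; rewrite !ffunE add0r. Qed.
Fact dsum_addN : left_inverse dsum_zero dsum_opp dsum_add.
Proof. by move=> f; apply/ffunP => i; rewrite !ffunE addNr. Qed.
HB.instance Definition _ :=
  GRing.isZmodule.Build dsum dsum_addA dsum_addC dsum_add0 dsum_addN.

Fact dsum_scaleA a b f : dsum_scale a (dsum_scale b f) = dsum_scale (a * b) f.
Proof. by apply/ffunP => i; rewrite !ffunE scalerA. Qed.
Fact dsum_scale1 : left_id 1 dsum_scale.
Proof. by move=> f; apply/ffunP => i; rewrite !ffunE scale1r. Qed.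
Fact dsum_scaleDr : right_distributive dsum_scale +%R.
Proof. by move=> a f g; apply/ffunP => i; rewrite !ffunE scalerDr. Qed.
Fact dsum_scaleDl f : {morph dsum_scale^~ f : a b / a + b}.
Proof. by move=> a b; apply/ffunP => i; rewrite !ffunE scalerDl. Qed.
HB.instance Definition _ := GRing.Zmodule_isLmodule.Build R dsum
  dsum_scaleA dsum_scale1 dsum_scaleDr dsum_scaleDl.
End DirectSum.

Section LeftIdeal.
Variables (A : nzRingType) (x : A).

Definition lideal : {pred A^o} := fun y => `[< exists a : A, y = a * x >].

Fact lideal_closed : GRing.submod_closed lideal.
Proof.
split; first by apply/asboolP; exists 0; rewrite mul0r.
move=> a u v /asboolP [b ->] /asboolP [c ->]; apply/asboolP.
by exists (a * b + c); rewrite mulrDl -mulrA.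
Qed.
HB.instance Definition _ :=
  GRing.isSubmodClosed.Build A A^o lideal lideal_closed.

Definition lideal_mod : Type := {y : A^o | y \in lideal}.
HB.instance Definition _ := [isSub of lideal_mod for @sval _ _].
HB.instance Definition _ := [Choice of lideal_mod by <:].
HB.instance Definition _ := [SubChoice_isSubLmodule of lideal_mod by <:].
End LeftIdeal.

Section GeneratedSubalgebra.
Variables (F : comNzRingType) (A : algType F) (G : A -> Prop).

Definition subalg_gen : {pred A} := fun x => `[<
  forall S : {pred A}, GRing.subalg_closed S ->
    (forall g, G g -> g \in S) -> x \in S >].

Fact subalg_gen_closed : GRing.subalg_closed subalg_gen.
Proof.
split; first by apply/asboolP => S [S1 _ _] _.
- move=> a u v /asboolP Hu /asboolP Hv; apply/asboolP => S cS GS.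
  by case: (cS) => _ + _; apply; [apply: Hu | apply: Hv].
- move=> u v /asboolP Hu /asboolP Hv; apply/asboolP => S cS GS.
  by case: (cS) => _ _; apply; [apply: Hu | apply: Hv].
Qed.
HB.instance Definition _ :=
  GRing.isSubalgClosed.Build F A subalg_gen subalg_gen_closed.

Definition subalg : Type := {x : A | x \in subalg_gen}.
HB.instance Definition _ := [isSub of subalg for @sval _ _].
HB.instance Definition _ := [Choice of subalg by <:].
HB.instance Definition _ := [SubChoice_isSubAlgebra of subalg by <:].
End GeneratedSubalgebra.

(* A module over an F-algebra A, presented as an action of A on an F-vector
   space, and the corresponding lmodType A. *)
Section ModuleAction.
Variables (F : comNzRingType) (A : algType F) (V : lmodType F).

Definition module_action (act : A -> V -> V) : Prop :=
  [/\ forall a, linear (act a), forall v, linear (act^~ v),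
      forall v, act 1 v = v & forall a b v, act (a * b) v = act a (act b v)].

Variables (act : A -> V -> V) (actP : module_action act).

Definition act_mod of module_action act : Type := V.
Local Notation M := (act_mod actP).
HB.instance Definition _ := GRing.Zmodule.on M.

Definition act_mod_scale (a : A) (v : M) : M := act a v.
Fact act_mod_scaleA a b v :
  act_mod_scale a (act_mod_scale b v) = act_mod_scale (a * b) v.
Proof. by have [_ _ _ actA] := actP; rewrite /act_mod_scale actA. Qed.
Fact act_mod_scale1 : left_id 1 act_mod_scale.
Proof. by have [_ _ act1 _] := actP. Qed.
Fact act_mod_scaleDr : right_distributive act_mod_scale +%R.
Proof.
move=> a u v; have [linr _ _ _] := actP; rewrite /act_mod_scale.
by have := linr a 1 u v; rewrite !scale1r.
Qed.
Fact act_mod_scaleDl v : {morph act_mod_scale^~ v : a b / a + b}.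
Proof.
move=> a b; have [_ linl _ _] := actP; rewrite /act_mod_scale.
by have := linl v 1 a b; rewrite !scale1r.
Qed.
HB.instance Definition _ := GRing.Zmodule_isLmodule.Build A M
  act_mod_scaleA act_mod_scale1 act_mod_scaleDr act_mod_scaleDl.
End ModuleAction.

Arguments act_mod {F A V act}.

(* The tensor product over F of a finite family of modules: the free module on
   the tuples (u_i)_i modulo multilinearity. *)
Section Tensor.
Variables (F : comNzRingType) (I : finType) (V : I -> lmodType F).

Local Notation tup := {dffun forall i : I, V i}.

Definition tup_set (u : tup) (i : I) (x : V i) : tup :=
  [ffun j : I => dfwith u x j].

Inductive tensor_rel : {malg F[tup]} -> Prop :=
| TensorRel (u : tup) (i : I) (c : F) (x y : V i) :
    tensor_rel (<< tup_set u (c *: x + y) >>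
                - c *: << tup_set u x >> - << tup_set u y >>).

Definition tensor : lmodType F := submod_quot tensor_rel.
Definition pure_tensor (u : tup) : tensor := submod_pi tensor_rel << u >>.
End Tensor.

(* For a ring morphism iota : B -> A and a B-module N, the A-module A (x)_B N:
   the free abelian group on A * N modulo biadditivity and B-balancedness,
   where A acts by a *: (b (x) v) = (a * b) (x) v. *)
Section Induced.
Variables (A B : nzRingType) (iota : {rmorphism B -> A}) (N : lmodType B).

Local Notation pre := {malg int[(A * N)%type]}.
Implicit Types (a b : A) (v w : N) (g h : pre).

Inductive ind_rel : pre -> Prop :=
| IndRelDl a b v : ind_rel (<< (a + b, v) >> - << (a, v) >> - << (b, v) >>)
| IndRelDr a v w : ind_rel (<< (a, v + w) >> - << (a, v) >> - << (a, w) >>)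
| IndRelB a (c : B) v : ind_rel (<< (a * iota c, v) >> - << (a, c *: v) >>).

Definition ind_sub : {pred pre} := fun g => `[<
  forall S : {pred pre}, GRing.zmod_closed S ->
    (forall h, ind_rel h -> h \in S) -> g \in S >].

Fact ind_sub_closed : GRing.zmod_closed ind_sub.
Proof.
split; first by apply/asboolP => S [S0 _] _.
move=> g h /asboolP Hg /asboolP Hh; apply/asboolP => S cS GS.
by case: (cS) => _; apply; [apply: Hg | apply: Hh].
Qed.
HB.instance Definition _ := GRing.isZmodClosed.Build pre ind_sub ind_sub_closed.

Definition induced : Type := quot ind_sub.
HB.instance Definition _ := GRing.Zmodule.on induced.

Definition ind_pi g : induced := \pi_(quot ind_sub) g.
Definition ind_tensor a v : induced := ind_pi << (a, v) >>.

Definition pre_scale a g : pre :=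
  \sum_(p <- msupp g) << mcoeff p g *g (a * p.1, p.2) >>.

Fact pre_scalew a g (d : {fset (A * N)%type}) : (msupp g `<=` d)%fset ->
  pre_scale a g = \sum_(p <- d) << mcoeff p g *g (a * p.1, p.2) >>.
Proof.
move=> le; rewrite [LHS](big_fset_incl _ le) => //= x xd /mcoeff_outdom ->.
by rewrite monalgU0.
Qed.

Fact pre_scaleB a : {morph pre_scale a : g h / g - h}.
Proof.
move=> g h; pose d := (msupp g `|` msupp h)%fset.
rewrite !(pre_scalew _ (d := d)) ?fsubsetUl ?fsubsetUr ?msuppB_le //.
by rewrite -sumrB; apply: eq_bigr => p _; rewrite mcoeffB monalgUB.
Qed.
HB.instance Definition _ a :=
  GRing.isZmodMorphism.Build pre pre (pre_scale a) (pre_scaleB a).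

Fact pre_scaleU a z p : pre_scale a << z *g p >> = << z *g (a * p.1, p.2) >>.
Proof. by rewrite (pre_scalew _ msuppU_le) big_seq_fset1 mcoeffUU. Qed.

Fact pre_scale_sub a g : g \in ind_sub -> pre_scale a g \in ind_sub.
Proof.
move=> /asboolP Hg; apply/asboolP => S cS GS.
apply: (Hg (fun h => pre_scale a h \in S)).
  case: cS => S0 SB; split=> [|h h' Hh Hh']; rewrite -topredE /=.
    by rewrite raddf0.
  by rewrite raddfB; apply: SB.
move=> h [b c v|b v w|b c v]; rewrite -topredE /= !raddfB /= !pre_scaleU /=;
  apply: GS.
- by rewrite mulrDr; apply: IndRelDl.
- exact: IndRelDr.
- by rewrite mulrA; apply: IndRelB.
Qed.

Definition ind_scale a (x : induced) : induced :=
  ind_pi (pre_scale a (repr (x : quot ind_sub))).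

Fact ind_piE g h : (ind_pi g = ind_pi h) <-> (g - h \in ind_sub).
Proof. by rewrite idealrBE; split => /eqP. Qed.

Fact ind_piP (x : induced) : exists g, x = ind_pi g.
Proof. by exists (repr (x : quot ind_sub)); rewrite /ind_pi reprK. Qed.

Fact ind_piB g h : ind_pi (g - h) = ind_pi g - ind_pi h.
Proof. exact: raddfB. Qed.
HB.instance Definition _ :=
  GRing.isZmodMorphism.Build pre induced ind_pi ind_piB.

Fact ind_scale_pi a g : ind_scale a (ind_pi g) = ind_pi (pre_scale a g).
Proof.
apply/ind_piE; rewrite -raddfB; apply: pre_scale_sub.
by apply/ind_piE; rewrite /ind_pi reprK.
Qed.

Fact ind_scaleB a : {morph ind_scale a : x y / x - y}.
Proof.
move=> x y; case: (ind_piP x) (ind_piP y) => g -> [h ->].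
by rewrite -raddfB !ind_scale_pi raddfB raddfB.
Qed.
HB.instance Definition _ a :=
  GRing.isZmodMorphism.Build induced induced (ind_scale a) (ind_scaleB a).

Fact ind_scaleE a b v : ind_scale a (ind_tensor b v) = ind_tensor (a * b) v.
Proof. by rewrite /ind_tensor ind_scale_pi pre_scaleU. Qed.

Fact ind_tensor_ind (P : induced -> Prop) :
  P 0 -> (forall x y, P x -> P y -> P (x - y)) ->
  (forall a v, P (ind_tensor a v)) -> forall x, P x.
Proof.
move=> P0 PB PT x; case: (ind_piP x) => g ->; rewrite (monalgE g).
have PN y : P y -> P (- y) by move=> Py; rewrite -sub0r; apply: PB.
have PD y z : P y -> P z -> P (y + z).
  by move=> Py Pz; rewrite -[z]opprK; apply/PB/PN.
have Pn y n : P y -> P (y *+ n).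
  by move=> Py; elim: n => [|n IH]; rewrite ?mulr0n // mulrS; apply: PD.
elim/big_ind: _ => [|y z|[a v] _]; first by rewrite raddf0.
  by rewrite raddfD; apply: PD.
set z : int := mcoeff _ _.
have -> : << z *g (a, v) >> = << (a, v) >> *~ z :> pre.
  by rewrite -[in LHS](intz z) -[z%:~R]/(1 *~ z) raddfMz.
rewrite raddfMz; case: z => n; first by apply/Pn/PT.
by apply/PN/Pn/PT.
Qed.

Fact ind_tensorDl a b v : ind_tensor (a + b) v = ind_tensor a v + ind_tensor b v.
Proof.
rewrite /ind_tensor -raddfD; apply/ind_piE; apply/asboolP => S _ GS; apply: GS.
by rewrite opprD addrA; apply: IndRelDl.
Qed.

Fact ind_scaleA a b x : ind_scale a (ind_scale b x) = ind_scale (a * b) x.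
Proof.
elim/ind_tensor_ind: x => [|x y Hx Hy|c v]; first by rewrite !raddf0.
  by rewrite !raddfB /= Hx Hy.
by rewrite !ind_scaleE mulrA.
Qed.
Fact ind_scale1 : left_id 1 ind_scale.
Proof.
elim/ind_tensor_ind => [|x y Hx Hy|c v]; first by rewrite !raddf0.
  by rewrite !raddfB /= Hx Hy.
by rewrite !ind_scaleE mul1r.
Qed.
Fact ind_scaleDr : right_distributive ind_scale +%R.
Proof. by move=> a x y; rewrite raddfD. Qed.
Fact ind_scaleDl x : {morph ind_scale^~ x : a b / a + b}.
Proof.
move=> a b; elim/ind_tensor_ind: x => [|x y Hx Hy|c v].
- by rewrite !raddf0 addr0.
- by rewrite !raddfB /= Hx Hy opprD addrACA.
- by rewrite !ind_scaleE mulrDl ind_tensorDl.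
Qed.
HB.instance Definition _ := GRing.Zmodule_isLmodule.Build A induced
  ind_scaleA ind_scale1 ind_scaleDr ind_scaleDl.
End Induced.

(* The generator pi_i of the literature, 1 <= i <= n - 1, has index i - 1 in
   'I_n.-1. *)
Section Hecke.
Variables (F : fieldType) (n : nat).

Local Notation free := {malg F[{fmonom 'I_n.-1}]}.
Local Notation X i := (<< fmu i >> : free).

Inductive hecke_rel : free -> Prop :=
| HeckeQuad (i : 'I_n.-1) : hecke_rel (X i * X i - X i)
| HeckeComm (i j : 'I_n.-1) : (i.+1 < j)%N -> hecke_rel (X i * X j - X j * X i)
| HeckeBraid (i j : 'I_n.-1) : j = i.+1 :> nat ->
    hecke_rel (X i * X j * X i - X j * X i * X j).

Definition two_sided (S : {pred free}) : Prop :=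
  forall x y z, y \in S -> x * y * z \in S.

Definition hecke_ideal : {pred free} := fun x => `[<
  forall S : {pred free}, GRing.zmod_closed S -> two_sided S ->
    (forall g, hecke_rel g -> g \in S) -> x \in S >].

Fact hecke_ideal_closed : GRing.zmod_closed hecke_ideal.
Proof.
split; first by apply/asboolP => S [S0 _] _ _.
move=> g h /asboolP Hg /asboolP Hh; apply/asboolP => S cS tS GS.
by case: (cS) => _; apply; [apply: Hg | apply: Hh].
Qed.
HB.instance Definition _ :=
  GRing.isZmodClosed.Build free hecke_ideal hecke_ideal_closed.

Fact hecke_idealM : two_sided hecke_ideal.
Proof.
move=> x y z /asboolP Hy; apply/asboolP => S cS tS GS.
exact/tS/Hy.
Qed.

Definition hecke : Type := quot hecke_ideal.
HB.instance Definition _ := GRing.Zmodule.on hecke.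

Definition hecke_class (x : free) : hecke := \pi_(quot hecke_ideal) x.

Fact hecke_classE x y : (hecke_class x = hecke_class y) <-> (x - y \in hecke_ideal).
Proof. by rewrite idealrBE; split => /eqP. Qed.

Fact hecke_classP (h : hecke) : exists x, h = hecke_class x.
Proof. by exists (repr (h : quot hecke_ideal)); rewrite /hecke_class reprK. Qed.

Fact hecke_classB x y : hecke_class (x - y) = hecke_class x - hecke_class y.
Proof. exact: raddfB. Qed.
HB.instance Definition _ :=
  GRing.isZmodMorphism.Build free hecke hecke_class hecke_classB.

Definition hecke_one : hecke := hecke_class 1.
Definition hecke_mul (h k : hecke) : hecke :=
  hecke_class (repr (h : quot hecke_ideal) * repr (k : quot hecke_ideal)).
Definition hecke_scale (c : F) (h : hecke) : hecke :=
  hecke_class (c *: repr (h : quot hecke_ideal)).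

Fact hecke_class_repr x : x - repr (hecke_class x : quot hecke_ideal) \in hecke_ideal.
Proof. by apply/hecke_classE; rewrite /hecke_class reprK. Qed.

Fact hecke_mulE x y : hecke_mul (hecke_class x) (hecke_class y) = hecke_class (x * y).
Proof.
apply/esym/hecke_classE; set x' := repr _; set y' := repr _.
have -> : x * y - x' * y' = 1 * (x - x') * y + x' * (y - y') * 1.
  by rewrite mul1r mulr1 mulrBl mulrBr addrA subrK.
by apply: rpredD; apply: hecke_idealM; apply: hecke_class_repr.
Qed.

Fact hecke_scaleE c x : hecke_scale c (hecke_class x) = hecke_class (c *: x).
Proof.
apply/esym/hecke_classE; rewrite -scalerBr -mul_malgC -[_ * _]mulr1.
exact/hecke_idealM/hecke_class_repr.
Qed.

Fact hecke_classD x y : hecke_class (x + y) = hecke_class x + hecke_class y.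
Proof. exact: raddfD. Qed.

Fact hecke_mulA : associative hecke_mul.
Proof.
move=> h k l; case: (hecke_classP h) (hecke_classP k) => x -> [y ->].
by case: (hecke_classP l) => z ->; rewrite !hecke_mulE mulrA.
Qed.
Fact hecke_mul1 : left_id hecke_one hecke_mul.
Proof. by move=> h; case: (hecke_classP h) => x ->; rewrite hecke_mulE mul1r. Qed.
Fact hecke_mulr1 : right_id hecke_one hecke_mul.
Proof. by move=> h; case: (hecke_classP h) => x ->; rewrite hecke_mulE mulr1. Qed.
Fact hecke_mulDl : left_distributive hecke_mul +%R.
Proof.
move=> h k l; case: (hecke_classP h) (hecke_classP k) => x -> [y ->].
case: (hecke_classP l) => z ->.
by rewrite -hecke_classD !hecke_mulE mulrDl hecke_classD.
Qed.
Fact hecke_mulDr : right_distributive hecke_mul +%R.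
Proof.
move=> h k l; case: (hecke_classP h) (hecke_classP k) => x -> [y ->].
case: (hecke_classP l) => z ->.
by rewrite -hecke_classD !hecke_mulE mulrDr hecke_classD.
Qed.

(* The algebra is nontrivial: the augmentation pi_i |-> 1 is a character. *)
Let aug_word (_ : {fmonom 'I_n.-1}) : F := 1.
Fact aug_word_morph : mmorphism aug_word.
Proof. by split=> // x y; rewrite mulr1. Qed.
HB.instance Definition _ := isMultiplicative.Build _ _ aug_word aug_word_morph.
Let aug : {rmorphism free -> F} := mmap idfun aug_word.

Fact free_aug : exists f : free -> F,
  [/\ {morph f : x y / x * y}, {morph f : x y / x - y}, f 0 = 0, f 1 = 1
    & forall i, f (X i) = 1].
Proof.
exists aug; split; [exact: rmorphM | exact: rmorphB | exact: rmorph0 |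
  exact: rmorph1 | by move=> i; rewrite /aug /= mmapU mulr1].
Qed.

Fact hecke_one_neq0 : hecke_one != 0.
Proof.
case: free_aug => f [fM fB f0 f1 fX].
apply/eqP; rewrite -(raddf0 hecke_class) => /hecke_classE; rewrite subr0.
pose K : {pred free} := fun x => f x == 0.
have inK x : (x \in K) = (f x == 0) by [].
move=> /asboolP /(_ K) H; suff: 1 \in K by rewrite inK f1 oner_eq0.
have eK x y : f x = 1 -> f y = 1 -> x - y \in K.
  by move=> xE yE; rewrite inK fB xE yE subrr.
have oneM x y : f x = 1 -> f y = 1 -> f (x * y) = 1.
  by move=> xE yE; rewrite fM xE yE mulr1.
apply: H => [|x y z|_ [i|i j _|i j _]].
- split=> [|x y]; rewrite !inK ?f0 // fB.
  by move=> /eqP -> /eqP ->; rewrite subrr.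
- by rewrite !inK !fM => /eqP ->; rewrite mulr0 mul0r.
- exact: eK (oneM _ _ (fX i) (fX i)) (fX i).
- exact: eK (oneM _ _ (fX i) (fX j)) (oneM _ _ (fX j) (fX i)).
- exact: eK (oneM _ _ (oneM _ _ (fX i) (fX j)) (fX i))
            (oneM _ _ (oneM _ _ (fX j) (fX i)) (fX j)).
Qed.

HB.instance Definition _ := GRing.Zmodule_isNzRing.Build hecke
  hecke_mulA hecke_mul1 hecke_mulr1 hecke_mulDl hecke_mulDr hecke_one_neq0.

Fact hecke_scaleA a b h : hecke_scale a (hecke_scale b h) = hecke_scale (a * b) h.
Proof. by case: (hecke_classP h) => x ->; rewrite !hecke_scaleE scalerA. Qed.
Fact hecke_scale1 : left_id 1 hecke_scale.
Proof. by move=> h; case: (hecke_classP h) => x ->; rewrite hecke_scaleE scale1r. Qed.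
Fact hecke_scaleDr : right_distributive hecke_scale +%R.
Proof.
move=> c h k; case: (hecke_classP h) (hecke_classP k) => x -> [y ->].
by rewrite -hecke_classD !hecke_scaleE scalerDr hecke_classD.
Qed.
Fact hecke_scaleDl h : {morph hecke_scale^~ h : a b / a + b}.
Proof.
move=> a b; case: (hecke_classP h) => x ->.
by rewrite !hecke_scaleE scalerDl hecke_classD.
Qed.
HB.instance Definition _ := GRing.Zmodule_isLmodule.Build F hecke
  hecke_scaleA hecke_scale1 hecke_scaleDr hecke_scaleDl.

Fact hecke_scaleAl (c : F) (h k : hecke) : c *: (h * k) = (c *: h) * k.
Proof.
case: (hecke_classP h) (hecke_classP k) => x -> [y ->].
change (hecke_scale c (hecke_mul (hecke_class x) (hecke_class y)) =
  hecke_mul (hecke_scale c (hecke_class x)) (hecke_class y)).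
by rewrite hecke_mulE !hecke_scaleE hecke_mulE scalerAl.
Qed.
HB.instance Definition _ :=
  GRing.LSemiModule_isLSemiAlgebra.Build F hecke hecke_scaleAl.

Fact free_scaleAr (c : F) (x y : free) : c *: (x * y) = x * (c *: y).
Proof.
have cC : c%:MP * x = x * c%:MP.
  rewrite !malgM_def fgmulgU fgmulUg.
  by apply: eq_bigr => k _; rewrite mulrC mul1m mulm1.
have C (R : nzRingType) (d u v : R) : d * u = u * d -> d * (u * v) = u * (d * v).
  by move=> E; rewrite mulrA E mulrA.
by rewrite -(mul_malgC c (x * y)) -(mul_malgC c y); apply: C.
Qed.

Fact hecke_scaleAr (c : F) (h k : hecke) : c *: (h * k) = h * (c *: k).
Proof.
case: (hecke_classP h) (hecke_classP k) => x -> [y ->].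
change (hecke_scale c (hecke_mul (hecke_class x) (hecke_class y)) =
  hecke_mul (hecke_class x) (hecke_scale c (hecke_class y))).
by rewrite hecke_mulE !hecke_scaleE hecke_mulE free_scaleAr.
Qed.
HB.instance Definition _ :=
  GRing.LSemiAlgebra_isSemiAlgebra.Build F hecke hecke_scaleAr.

Definition hpi (i : 'I_n.-1) : hecke := hecke_class (X i).
Definition hpibar (i : 'I_n.-1) : hecke := hpi i - 1.

End Hecke.

Section Coxeter.
Variable n : nat.
Implicit Types (i j : 'I_n.-1) (w : 'S_n) (I J : {set 'I_n.-1}).

Fact lo_subproof i : (i < n)%N.
Proof. by apply: leq_trans (ltn_ord i) (leq_pred n). Qed.
Fact hi_subproof i : (i.+1 < n)%N.
Proof. by have := ltn_ord i; case: (n) i => [|m] []. Qed.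

Fact ltn_pred1 m : (m.+1 < n -> m < n.-1)%N.
Proof. by case: (n). Qed.

Definition lo i : 'I_n := Ordinal (lo_subproof i).
Definition hi i : 'I_n := Ordinal (hi_subproof i).

Definition adj i : 'S_n := tperm (lo i) (hi i).
Definition word_perm (s : seq 'I_n.-1) : 'S_n := (\prod_(i <- s) adj i)%g.

Fact word_tperm k (x y : 'I_n) : y = (x + k.+1)%N :> nat ->
  exists s, word_perm s = tperm x y.
Proof.
elim: k y => [|k IH] y yE.
  have xn : (x < n.-1)%N by apply: ltn_pred1; have := ltn_ord y; rewrite yE addn1.
  exists [:: Ordinal xn]; rewrite /word_perm big_seq1.
  by congr tperm; apply: val_inj; rewrite //= yE addn1.
have zn : ((x + k.+1) < n)%N.
  by apply: leq_ltn_trans (ltn_ord y); rewrite yE leq_add2l.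
pose z := Ordinal zn; case: (IH z erefl) => s sE.
have zn1 : (z < n.-1)%N by apply: ltn_pred1; have := ltn_ord y; rewrite yE addnS.
pose i := Ordinal zn1.
exists (i :: rcons s i); rewrite /word_perm big_cons big_rcons -/(word_perm s) sE.
have -> : adj i = tperm z y.
  by congr tperm; apply: val_inj; rewrite //= yE -addnS.
have xz : x != z by rewrite -val_eqE /= -[X in X != _]addn0 eqn_add2l.
have xy : x != y by rewrite -val_eqE /= yE -[X in X != _]addn0 eqn_add2l.
have zV : (tperm z y)^-1%g = tperm z y by rewrite tpermV.
rewrite -{1}zV -/(conjg _ _).
by rewrite tpermJ tpermL tpermD // eq_sym.
Qed.

Fact word_exists w : exists s, word_perm s = w.
Proof.
case: (prod_tpermP w) => ts -> _.
elim: ts => [|[x y] ts [s sE]]; first by exists [::]; rewrite /word_perm !big_nil.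
suff [t tE] : exists t, word_perm t = tperm x y.
  by exists (t ++ s); rewrite /word_perm big_cat big_cons -tE -sE.
have H (a b : 'I_n) : (a < b)%N -> exists t, word_perm t = tperm a b.
  move=> ab; apply: (@word_tperm (b - a).-1).
  by rewrite prednK ?subn_gt0 // subnKC // ltnW.
case: (ltngtP x y) => [|/H|/val_inj ->]; first exact: H.
  by rewrite tpermC.
by exists [::]; rewrite /word_perm big_nil tperm1.
Qed.

Fact coxlen_subproof w :
  exists k, [exists u : k.-tuple 'I_n.-1, word_perm u == w].
Proof.
case: (word_exists w) => s sE; exists (size s).
by apply/existsP; exists (in_tuple s); rewrite sE.
Qed.

Definition coxlen w : nat := ex_minn (coxlen_subproof w).

Fact redword_subproof w :
  exists u : (coxlen w).-tuple 'I_n.-1, word_perm u == w.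
Proof. by rewrite /coxlen; case: ex_minnP => k /existsP. Qed.

(* a reduced expression of w, i.e. one of minimal length *)
Definition redword w : seq 'I_n.-1 := xchoose (redword_subproof w).

Definition longest I : 'S_n :=
  [arg max_(w > 1%g in <<[set adj i | i in I]>>%g) coxlen w]%N.
End Coxeter.

(* D(a), as a subset of {1, ..., n - 1} *)
Definition Dset (a : seq nat) : seq nat :=
  [seq sumn (take i.+1 a) | i <- iota 0 (size a).-1].

Section Projectives.
Variables (F : fieldType) (n : nat).

(* By Matsumoto's theorem these do not depend on the reduced expression. The
   product of 'S_n in MathComp is opposite to composition, which is immaterial
   for the involutions to which pi_w is applied here. *)
Definition hpi_w (w : 'S_n) : hecke F n := \prod_(i <- redword w) hpi F i.
Definition hpibar_w (w : 'S_n) : hecke F n := \prod_(i <- redword w) hpibar F i.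

Definition projI (I : {set 'I_n.-1}) : lmodType (hecke F n) :=
  lideal_mod (hpibar_w (longest I) * hpi_w (longest (~: I))).

Definition projIJ (I J : {set 'I_n.-1}) : lmodType (hecke F n) :=
  lideal_mod (hpibar_w (longest I) * hpi_w (longest (J :\: I))).

(* The subalgebra H_{n_1,...,n_k}(0), where ns = [:: n_1; ...; n_k]. *)
Definition parabolic_gen (ns : seq nat) (h : hecke F n) : Prop :=
  exists2 l : 'I_n.-1, l.+1 \notin Dset ns & h = hpi F l.
Definition parabolic (ns : seq nat) : algType F := subalg (@parabolic_gen ns).
End Projectives.

Definition is_comp (n : nat) (a : seq nat) : bool :=
  all (leq 1) a && (sumn a == n).

(* [:: a^1; ...; a^k] stands for a^1 (+) ... (+) a^k, with k >= 1 and every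
   component a nonempty ribbon. *)
Definition is_gribbon (n : nat) (al : seq (seq nat)) : bool :=
  [&& al != [::], all (fun a => (a != [::]) && all (leq 1) a) al
    & sumn (map sumn al) == n].

(* the operation a |> b; concatenation a . b is a ++ b *)
Definition near_concat (a b : seq nat) : seq nat :=
  match a, b with
  | x :: a', y :: b' => belast x a' ++ (last x a' + y)%N :: b'
  | [::], _ => b
  | _, [::] => a
  end.

Definition near_concats (al : seq (seq nat)) : seq nat :=
  if al is a :: al' then foldl near_concat a al' else [::].

Definition brackets (al : seq (seq nat)) : seq (seq nat) :=
  if al is a :: al' then
    foldl (fun L c => flatten [seq [:: b ++ c; near_concat b c] | b <- L])
      [:: a] al'
  else [::].

(* {s_i : i \in D(a)}, with the indexing of the generators by 'I_n.-1 *)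
Definition descents (n : nat) (a : seq nat) : {set 'I_n.-1} :=
  [set i : 'I_n.-1 | i.+1 \in Dset a].

(* The boxes are pairs (row, column), the rows being numbered from bottom to
   top and the columns from left to right. The lowest row of the ribbon starts
   at (r, c). *)
Fixpoint ribbon_cells (r c : nat) (a : seq nat) : seq (nat * nat) :=
  if a is x :: a' then
    [seq (r, j) | j <- iota c x] ++ ribbon_cells r.+1 (c + x.-1) a'
  else [::].

(* A ribbon a of n boxes has size a rows and n - size a + 1 columns; the next
   component starts one row above and one column to the right of its last box. *)
Fixpoint gribbon_cells (r c : nat) (al : seq (seq nat)) : seq (nat * nat) :=
  if al is a :: al' then
    ribbon_cells r c a
      ++ gribbon_cells (r + size a) (c + (sumn a - size a).+1) al'
  else [::].

Section Tableaux.
Variables (F : fieldType) (n : nat) (al : seq (seq nat)).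

Definition box : finType := seq_sub (gribbon_cells 0 0 al).
Definition row (b : box) : nat := (val b).1.
Definition col (b : box) : nat := (val b).2.

(* The entries 1, ..., n are shifted to the elements 0, ..., n - 1 of 'I_n. *)
Definition filling := {ffun box -> 'I_n}.

Definition standard (t : filling) : bool :=
  [&& [forall i, #|[set b | t b == i]| == 1%N],
      [forall b, forall b', (row b == row b') && (col b < col b')%N
                              ==> (t b < t b')%N]
    & [forall b, forall b', (col b == col b') && (row b' < row b)%N
                              ==> (t b < t b')%N]].

Definition SYT : finType := {t : filling | standard t}.

Definition row_of (t : filling) (i : 'I_n) : nat :=
  if [pick b | t b == i] is Some b then row b else 0.

Definition swap (i : 'I_n.-1) (t : filling) : filling :=
  [ffun b => adj i (t b)].

Definition tab_space : lmodType F := {ffun SYT -> F^o}.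
Definition tab_vec (t : SYT) : tab_space := [ffun u : SYT => (u == t)%:R : F^o].

Definition tab_action (act : hecke F n -> tab_space -> tab_space) : Prop :=
  module_action act /\
  forall (i : 'I_n.-1) (t : SYT),
    let r := row_of (val t) (lo i) in
    let r' := row_of (val t) (hi i) in
    [/\ (r' < r)%N -> act (hpibar F i) (tab_vec t) = - tab_vec t,
        r = r' -> act (hpibar F i) (tab_vec t) = 0
      & (r < r')%N -> exists2 u : SYT, val u = swap i (val t) &
          act (hpibar F i) (tab_vec t) = tab_vec u].

Record tabmod := Tabmod {
  tabmod_act : hecke F n -> tab_space -> tab_space;
  tabmod_actP : tab_action tabmod_act
}.

Definition tabmod_lmod (P : tabmod) : lmodType (hecke F n) :=
  act_mod (proj1 (tabmod_actP P)).
End Tableaux.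

Coercion tabmod_lmod : tabmod >-> GRing.Lmodule.type.

Section OuterTensor.
Variables (F : fieldType) (n : nat) (al : seq (seq nat)).

Local Notation cmp i := (nth [::] al i).
Local Notation ns := (map sumn al).

Variable P : forall i : 'I_(size al), tabmod F (sumn (cmp i)) [:: cmp i].

Definition outer_space : lmodType F :=
  tensor (fun i : 'I_(size al) => tab_space F (sumn (cmp i)) [:: cmp i]).

(* Through the isomorphism of H_{n_1,...,n_k}(0) with the tensor product of the
   H_{n_i}(0), the generator of index n_1 + ... + n_{i-1} + j is the generator
   of index j of the i-th factor. These generators determine the action. *)
Definition outer_action
    (act : parabolic F n ns -> outer_space -> outer_space) : Prop :=
  module_action act /\
  forall (i : 'I_(size al)) (j : 'I_(sumn (cmp i)).-1) (l : 'I_n.-1)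
         (h : parabolic F n ns) u,
    l = (sumn (take i ns) + j)%N :> nat -> \val h = hpi F l ->
    act h (pure_tensor u) =
      pure_tensor (tup_set u (tabmod_act (P i) (hpi F j) (u i))).

Record outermod := Outermod {
  outermod_act : parabolic F n ns -> outer_space -> outer_space;
  outermod_actP : outer_action outermod_act
}.

Definition outermod_lmod (N : outermod) : lmodType (parabolic F n ns) :=
  act_mod (proj1 (outermod_actP N)).

Definition outer_induced (N : outermod) : lmodType (hecke F n) :=
  induced (\val : {rmorphism parabolic F n ns -> hecke F n}) (outermod_lmod N).
End OuterTensor.

(* Main.v *)
(* Let pib_w (w in S_n) be the products of the generators pib_i = pi_i - 1 along
   reduced words; they form a basis of H = H_n(0). Write x = pib_{w0(I)} and
   y = pi_{w0(K)} with K = J \ I. Encoding a standard tableau by the permutation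
   w sending each entry to its position in the reading word, the standard
   tableaux of shape alpha are the w with right descents containing I and
   disjoint from K, and the rule defining P_alpha is the one satisfied by left
   multiplication on the elements pib_w y, which span H x y. They are
   independent because pib_w y is pib_w plus longer terms. Hence the action
   exists, is unique, and P_alpha is isomorphic to H x y.

   The other two modules are embedded in H with the same image. For the direct
   sum, P_beta is H x' y' and is mapped into H x y by right multiplication by
   x y; triangularity with respect to length makes the sum of these maps
   injective, and counting dimensions makes it onto. For the induced module, the
   tableaux of a tuple of components are encoded by the block permutations v;
   the span V of the pib_v y is the outer tensor product N, and is equal to
   H_{n_1,...,n_k}(0) x y. The obvious map from H (x) N onto H x y is injective
   because x y has the form (x y) v0 with v0 in V: by triangularity right
   multiplication by x y is bijective on V. *)
Require Import Defs.
From HB Require Import structures.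
From mathcomp Require Import all_boot all_fingroup all_algebra.
From mathcomp Require Import generic_quotient boolp.
From mathcomp Require Import finmap monalg.
From mathcomp Require Import zify.

Set Implicit Arguments.
Unset Strict Implicit.
Unset Printing Implicit Defensive.

Import GRing.Theory ring_quotient.Quotient.
Local Open Scope ring_scope.

(** * Presentation and representations of H_n(0) *)

(** No isomorphism is given by a formula: each module receives an injective H-linear map into H with
    image H x y, and any two modules with such maps are isomorphic. Independence of the pib_w cannot
    be read off the presentation; it comes from a representation on functions on the symmetric
    group, where pi_i acts by precomposition with one bubble-sort step. These operators are the
    transposes of left multiplication by pi_i, so the orbit of one vector records all coordinates.
    Both dimension arguments rest on one fact: an independent family lying in the span of a family
    with the same index set spans it ([indep_span]). It applies to the direct sum because the
    tableaux of the beta in [alpha] and those of alpha give the same permutations, and to the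
    induced module because right multiplication by x y maps V into itself. The product of
    permutations applies its left factor first: left multiplication by s_i permutes entries of a
    tableau, right multiplication permutes positions, and right descents of w are the descents of
    its inverse. *)

Section HeckeGeneration.
Variables (F : fieldType) (n : nat).
Local Notation H := (hecke F n).
Local Notation free := {malg F[{fmonom 'I_n.-1}]}.

Lemma hecke_classM (x y : free) : hecke_class (x * y) = hecke_class x * hecke_class y.
Proof. by rewrite -hecke_mulE. Qed.

Lemma hecke_classZ c (x : free) : hecke_class (c *: x) = c *: hecke_class x.
Proof. by rewrite -hecke_scaleE. Qed.

Lemma fmonom_cons (i : 'I_n.-1) (s : seq 'I_n.-1) :
  (<< FMonom (i :: s) >> : free) = << fmu i >> * << FMonom s >>.
Proof.
rewrite malgM_def fgmulUU mulr1; congr (mkmalgU _ 1); apply: val_inj.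
by rewrite /= fmM fmU.
Qed.

(** Words in the pi_i span H, and a word is built from 1 by left multiplications, so closure under
    products of arbitrary elements need not be proved. *)
Lemma hecke_ind (P : H -> Prop) :
  P 1 -> (forall h k, P h -> P k -> P (h + k)) ->
  (forall c h, P h -> P (c *: h)) -> (forall i h, P h -> P (hpi F i * h)) ->
  forall h, P h.
Proof.
move=> P1 PD PZ PM h; case: (hecke_classP h) => x ->; rewrite (monalgE x).
elim/big_ind: _ => [|y z Py Pz|m _].
- by rewrite raddf0 -(scale0r 1); apply: PZ.
- by rewrite raddfD; apply: PD.
have -> : << mcoeff m x *g m >> = mcoeff m x *: << m >> :> free.
  apply/malgP => k.
    rewrite mcoeffZ.
    rewrite [in RHS]mcoeffU1.
    rewrite mcoeffU.
    by rewrite mulr_natr.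
rewrite hecke_classZ; apply: PZ; case: m => s; elim: s => [|i s IH].
  have -> : << FMonom [::] >> = 1 :> free.
    by congr (mkmalgU _ 1); apply: val_inj; exact: (esym (@fm1 _)).
  exact: P1.
by rewrite fmonom_cons hecke_classM; apply: PM.
Qed.

Lemma hecke_rel0 g : @hecke_rel F n g -> hecke_class g = 0.
Proof.
move=> rg; rewrite -(raddf0 (@hecke_class F n)).
apply/hecke_classE; rewrite subr0; apply/asboolP => S _ _ GS; exact: GS.
Qed.

(* Products in the free algebra are only ever folded: a failed match between
   products of distinct elements unfolds its whole construction. *)
Let class_eq (x y : free) : hecke_class (x - y) = 0 ->
  hecke_class x = hecke_class y.
Proof. by move=> E; apply: subr0_eq; rewrite -hecke_classB. Qed.

Let class_comm (x y : free) : hecke_class (x * y - y * x) = 0 ->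
  hecke_class x * hecke_class y = hecke_class y * hecke_class x.
Proof.
move/class_eq => E; rewrite -(hecke_classM x y) -(hecke_classM y x).
exact: E.
Qed.

Let class_braid (x y : free) : hecke_class (x * y * x - y * x * y) = 0 ->
  hecke_class x * hecke_class y * hecke_class x =
  hecke_class y * hecke_class x * hecke_class y.
Proof.
move/class_eq => E; rewrite -(hecke_classM x y) -(hecke_classM y x).
move: (x * y) (y * x) E => p q E.
rewrite -(hecke_classM p x) -(hecke_classM q y).
exact: E.
Qed.

Lemma hecke_quad (i : 'I_n.-1) : hpi F i * hpi F i = hpi F i.
Proof.
have := hecke_rel0 (HeckeQuad F i).
by rewrite hecke_classB hecke_classM => /subr0_eq.
Qed.

Lemma hecke_comm (i j : 'I_n.-1) : (i.+1 < j)%N ->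
  hpi F i * hpi F j = hpi F j * hpi F i.
Proof. by move=> ij; apply/class_comm/hecke_rel0/HeckeComm. Qed.

Lemma hecke_braid (i j : 'I_n.-1) : j = i.+1 :> nat ->
  hpi F i * hpi F j * hpi F i = hpi F j * hpi F i * hpi F j.
Proof. by move=> ij; apply/class_braid/hecke_rel0/HeckeBraid. Qed.

Section Representation.
Variables (V : lmodType F) (T : 'I_n.-1 -> V -> V).
Hypothesis Tlin : forall i, linear (T i).
Hypothesis Tquad : forall i v, T i (T i v) = T i v.
Hypothesis Tcomm : forall (i j : 'I_n.-1) v, (i.+1 < j)%N -> T i (T j v) = T j (T i v).
Hypothesis Tbraid : forall (i j : 'I_n.-1) v, j = i.+1 :> nat ->
  T i (T j (T i v)) = T j (T i (T j v)).

Let wact (m : {fmonom 'I_n.-1}) (v : V) : V := foldr T v m.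
Let fact (g : free) (v : V) : V := \sum_(m <- msupp g) mcoeff m g *: wact m v.

Let wactM m1 m2 v : wact (mmul m1 m2) v = wact m1 (wact m2 v).
Proof. by rewrite /wact fmM foldr_cat. Qed.

Let wact_lin m : linear (wact m).
Proof.
case: m => s c u v; rewrite /wact /=.
by elim: s => [|i s IH] //=; rewrite IH Tlin.
Qed.

Let factw v g (d : {fset {fmonom 'I_n.-1}}) : (msupp g `<=` d)%fset ->
  fact g v = \sum_(m <- d) mcoeff m g *: wact m v.
Proof.
move=> le; rewrite [LHS](big_fset_incl _ le) => //= x xd /mcoeff_outdom ->.
by rewrite scale0r.
Qed.

Let fact_lin v c g h : fact (c *: g + h) v = c *: fact g v + fact h v.
Proof.
pose d := (msupp (c *: g + h) `|` (msupp g `|` msupp h))%fset.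
rewrite !(@factw v _ d); first last.
- exact: fsubsetUl.
- by apply: fsubset_trans (fsubsetUr _ _); apply: fsubsetUl.
- by apply: fsubset_trans (fsubsetUr _ _); apply: fsubsetUr.
rewrite scaler_sumr -big_split; apply: eq_bigr => m _ /=.
by rewrite mcoeffD mcoeffZ scalerDl scalerA.
Qed.

Let fact0 v : fact 0 v = 0.
Proof. by rewrite /fact msupp0 big_seq_fset0. Qed.

Let factD v g h : fact (g + h) v = fact g v + fact h v.
Proof. by have := fact_lin v 1 g h; rewrite !scale1r. Qed.

Let factB v g h : fact (g - h) v = fact g v - fact h v.
Proof. by have := fact_lin v (-1) h g; rewrite !scaleN1r addrC => ->; rewrite addrC. Qed.

Let factU v c m : fact << c *g m >> v = c *: wact m v.
Proof. by rewrite (factw _ msuppU_le) big_seq_fset1 mcoeffUU. Qed.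

Let fact_sum v (I : Type) (r : seq I) (G : I -> free) :
  fact (\sum_(i <- r) G i) v = \sum_(i <- r) fact (G i) v.
Proof.
elim: r => [|i r IH]; first by rewrite !big_nil fact0.
by rewrite !big_cons factD IH.
Qed.

Let wact_sum m (I : Type) (r : seq I) (c : I -> F) (G : I -> V) :
  wact m (\sum_(i <- r) c i *: G i) = \sum_(i <- r) c i *: wact m (G i).
Proof.
have w0 : wact m 0 = 0.
  have := wact_lin m 1 0 0; rewrite !scale1r addr0 => /esym/eqP.
  by rewrite -subr_eq0 addrK => /eqP.
by elim: r => [|i r IH]; rewrite ?big_nil ?w0 // !big_cons wact_lin IH.
Qed.

Let fact0r g : fact g 0 = 0.
Proof.
rewrite /fact big1 // => m _.
have := wact_sum m [::] (fun _ : unit => 0) (fun _ => 0).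
by rewrite !big_nil => ->; rewrite scaler0.
Qed.

Let factM v g h : fact (g * h) v = fact g (fact h v).
Proof.
rewrite malgME fact_sum /fact; apply: eq_bigr => m _.
rewrite wact_sum scaler_sumr -/(fact _ _) fact_sum; apply: eq_bigr => m' _.
by rewrite factU wactM scalerA.
Qed.

(** The annihilator [S] of V in the free algebra is a two-sided ideal, and it contains the defining
    relations by the hypotheses on [T]. *)
Let fact_ideal x : x \in @hecke_ideal F n -> forall v, fact x v = 0.
Proof.
pose S : {pred free} := fun g => `[< forall v, fact g v = 0 >].
move=> /asboolP /(_ S) E; apply/asboolP; apply: E.
- split; first by apply/asboolP.
  move=> g h /asboolP Hg /asboolP Hh; apply/asboolP => v.
  by rewrite factB Hg Hh subrr.
- move=> a b c /asboolP Hb; apply/asboolP => v.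
  by rewrite !factM Hb fact0r.
have X u i : fact << fmu i >> u = T i u.
  by rewrite factU scale1r /wact fmU.
have eq0 g h : (forall v, fact g v = fact h v) -> g - h \in S.
  by move=> E; apply/asboolP => v; rewrite factB E subrr.
have M2 i j v : fact (<< fmu i >> * << fmu j >>) v = T i (T j v).
  by apply: etrans (factM v _ _) _; rewrite !X.
have M3 i j k v :
    fact (<< fmu i >> * << fmu j >> * << fmu k >>) v = T i (T j (T k v)).
  by apply: etrans (factM v _ _) _; rewrite M2 X.
move=> _ [i|i j ij|i j ij]; apply: eq0 => v.
- by apply: etrans (M2 _ _ _) _; rewrite Tquad X.
- by apply: etrans (M2 _ _ _) (etrans (Tcomm v ij) (esym (M2 _ _ _))).
- by apply: etrans (M3 _ _ _ _) (etrans (Tbraid v ij) (esym (M3 _ _ _ _))).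
Qed.

(** [c] is the orbit map of v for the module structure defined by the operators [T]. *)
Lemma hecke_rep (v : V) : exists c : H -> V,
  [/\ linear c, c 1 = v & forall i h, c (hpi F i * h) = T i (c h)].
Proof.
pose c (h : H) := fact (repr (h : quot (@hecke_ideal F n))) v.
have cE x : c (hecke_class x) = fact x v.
  apply/esym/eqP; rewrite -subr_eq0 -factB; apply/eqP/fact_ideal.
  exact: hecke_class_repr.
exists c; split.
- move=> a h k; case: (hecke_classP h) (hecke_classP k) => x -> [y ->].
  by rewrite -hecke_classZ -hecke_classD !cE fact_lin.
- by rewrite (cE 1) factU scale1r /wact fm1.
- move=> i h; case: (hecke_classP h) => x ->.
  by rewrite /hpi -hecke_classM !cE factM factU scale1r /wact fmU.
Qed.
End Representation.
End HeckeGeneration.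

(** * Reduced words and Matsumoto's theorem *)

Section ReducedWords.
Variable n : nat.
Implicit Types (i j k : 'I_n.-1) (w : 'S_n) (s t u : seq 'I_n.-1).

Lemma adj_val i (x : 'I_n) :
  nat_of_ord (adj i x) =
  if (x : nat) == i then i.+1 else if (x : nat) == i.+1 then (i : nat) else x.
Proof.
rewrite /adj; case: tpermP => [->|->|]; rewrite /= ?eqxx //.
  by rewrite eqn_leq ltnn.
move=> /eqP nlo /eqP nhi; move: nlo nhi; rewrite -!val_eqE /=.
by move=> /negbTE -> /negbTE ->.
Qed.

Lemma adjL i : adj i (lo i) = hi i. Proof. exact: tpermL. Qed.
Lemma adjR i : adj i (hi i) = lo i. Proof. exact: tpermR. Qed.
Lemma adjK i w : (adj i * (adj i * w))%g = w.
Proof. by rewrite mulgA tperm2 mul1g. Qed.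
Lemma adjKr i w : ((w * adj i) * adj i)%g = w.
Proof. by rewrite -mulgA tperm2 mulg1. Qed.
Lemma adjV i : (adj i)^-1%g = adj i. Proof. exact: tpermV. Qed.

Lemma adj_out i (x : 'I_n) : (x : nat) != i -> (x : nat) != i.+1 -> adj i x = x.
Proof. by move=> xi xi1; apply: tpermD; rewrite eq_sym -val_eqE. Qed.

Lemma adj_lo_succ i j : j = i.+1 :> nat -> adj j (lo i) = lo i.
Proof. by move=> ij; apply: adj_out => /=; lia. Qed.

Lemma adj_hi_pred i j : j = i.+1 :> nat -> adj i (hi j) = hi j.
Proof. by move=> ij; apply: adj_out => /=; lia. Qed.

Lemma adj_far i j : (i.+1 < j)%N ->
  (adj j (lo i) = lo i /\ adj j (hi i) = hi i) /\
  (adj i (lo j) = lo j /\ adj i (hi j) = hi j).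
Proof. by move=> ij; split; split; apply: adj_out => /=; lia. Qed.

Lemma adjJ i (z : 'S_n) : (adj i ^ z = tperm (z (lo i)) (z (hi i)))%g.
Proof. exact: tpermJ. Qed.

(** Each side conjugates one transposition by the other, and both conjugates exchange [lo i] and
    [hi j]. *)
Lemma adj_braid i j : j = i.+1 :> nat ->
  (adj j * (adj i * adj j) = adj i * (adj j * adj i))%g.
Proof.
move=> ij; transitivity (adj i ^ adj j)%g; first by rewrite conjgE adjV.
transitivity (adj j ^ adj i)%g; last by rewrite conjgE adjV.
rewrite !adjJ.
have hilo : lo j = hi i by apply: val_inj.
rewrite (@adj_out j (lo i)) /=; try by rewrite ij; lia.
by rewrite -hilo adjL hilo adjR adj_out //= ?ij; lia.
Qed.

Lemma adj_comm i j : (i.+1 < j)%N -> (adj j * adj i = adj i * adj j)%g.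
Proof.
move=> ij; apply/commgP/conjg_fixP; rewrite adjJ.
by rewrite !adj_out //=; lia.
Qed.

Lemma adj_lt i (x y : 'I_n) : (x < y)%N -> (x, y) != (lo i, hi i) ->
  (adj i x < adj i y)%N.
Proof.
rewrite xpair_eqE -!val_eqE /= !adj_val => xy.
by do !case: ifP => ?; lia.
Qed.

(** Since [adj i * w] applies [adj i] first, it exchanges the values of w at two adjacent places;
    [asc i w] thus says that left multiplication by [adj i] lengthens w. Right multiplication is
    governed by [asc i w^-1]. *)
Definition asc i w : bool := (w (lo i) < w (hi i))%N.

Lemma ascN i w : ~~ asc i w = (w (hi i) < w (lo i))%N.
Proof.
rewrite /asc -leqNgt leq_eqVlt; case: eqP => //= /val_inj/perm_inj/(congr1 val) /=.
lia.
Qed.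

Lemma asc_adj i w : asc i (adj i * w) = ~~ asc i w.
Proof. by rewrite ascN /asc !permM adjL adjR. Qed.

Definition invset w : {set 'I_n * 'I_n} :=
  [set p : 'I_n * 'I_n | (p.1 < p.2)%N && (w p.2 < w p.1)%N].
Definition inv w : nat := #|invset w|.

(** Moving both positions by s_i carries the inversions of w to inversions of [adj i * w], because
    s_i reverses the order of a single pair; that pair is the one new inversion. *)
Lemma inv_asc i w : asc i w -> inv (adj i * w) = (inv w).+1.
Proof.
rewrite /asc => a; pose phi (p : 'I_n * 'I_n) := (adj i p.1, adj i p.2).
have phiK : involutive phi.
  by case=> x y; rewrite /phi /= -!permM !tperm2 !perm1.
have mem_phi p : (p \in phi @: invset w) = (phi p \in invset w).
  by rewrite -{1}(phiK p) (mem_imset _ _ (can_inj phiK)).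
have -> : inv (adj i * w) = #|(lo i, hi i) |: phi @: invset w|.
  apply: eq_card => -[x y]; rewrite in_setU1 mem_phi !inE /= !permM.
  case: eqP => [[-> ->]|/eqP xyN] /=; first by rewrite adjL adjR a ltnSn.
  case: (ltngtP x y) => [xy|yx|/val_inj xy] /=; last by rewrite xy ltnn.
    by rewrite adj_lt.
  case: (altP ((y, x) =P (lo i, hi i))) => [[-> ->]|yxN].
    by rewrite adjL adjR [X in _ && X]ltnNge (ltnW a) andbF.
  by have := adj_lt yx yxN; case: (ltngtP (adj i x) (adj i y)).
rewrite cardsU1 card_imset //; last exact: can_inj phiK.
by rewrite mem_phi inE /= adjL adjR ltnNge leqnSn.
Qed.

Lemma inv_desc i w : ~~ asc i w -> (inv (adj i * w)).+1 = inv w.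
Proof. by rewrite -asc_adj => /inv_asc; rewrite adjK. Qed.

Lemma inv1 : inv 1 = 0%N.
Proof.
apply: eq_card0 => -[x y]; rewrite !inE !perm1 /=.
by case: ltngtP.
Qed.

Lemma invV w : inv w^-1 = inv w.
Proof.
pose phi (p : 'I_n * 'I_n) := (w p.2, w p.1).
have phi_inj : injective phi by case=> x y [x' y'] [/perm_inj -> /perm_inj ->].
rewrite /inv -[RHS](card_imset _ phi_inj); apply: eq_card => -[x y].
have -> : (x, y) = phi (w^-1 y, w^-1 x)%g by rewrite /phi /= !permKV.
by rewrite (mem_imset _ _ phi_inj) !inE /phi /= !permK !permKV andbC.
Qed.

(** Without descents w is increasing, and so is its inverse. An increasing map never lies below the
    identity; applied to both, this leaves only equality. *)
Lemma asc_id w : (forall i, asc i w) -> w = 1%g.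
Proof.
have mono v : (forall i, asc i v) -> forall x y : 'I_n, (x < y)%N -> (v x < v y)%N.
  move=> a x y; move d : (y - x)%N => k; elim: k y d => [|k IH] y d xy; first by lia.
  have zn : (y.-1 < n.-1)%N by have := ltn_ord y; lia.
  pose z := Ordinal zn; have yE : y = hi z by apply: val_inj => /=; lia.
  case: (ltngtP x (lo z)) => [xz||/val_inj ->]; last by rewrite yE; exact: a.
    apply: ltn_trans (IH _ _ xz) _; first by rewrite /= in d xz *; lia.
    rewrite yE; exact: a.
  by rewrite /=; lia.
have ge v : (forall x y : 'I_n, (x < y)%N -> (v x < v y)%N) ->
    forall x : 'I_n, (x <= v x)%N.
  move=> m x; case: x => x; elim: x => // x IH xn.
  have xn' : (x < n)%N by lia.
  by apply: leq_ltn_trans (IH xn') _; apply: m.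
move=> /mono m; apply/permP => x; apply: val_inj; rewrite perm1.
apply/eqP; rewrite eqn_leq (ge _ m) andbT.
have mV (a b : 'I_n) : (a < b)%N -> (w^-1 a < w^-1 b)%g%N.
  move=> ab; case: (ltngtP (w^-1 a)%g (w^-1 b)%g) => // [/m|/val_inj/perm_inj].
    by rewrite !permKV; lia.
  by move=> E; rewrite E ltnn in ab.
by have := ge _ mV (w x); rewrite permK.
Qed.

Lemma word_perm_cons i s : word_perm (i :: s) = (adj i * word_perm s)%g.
Proof. by rewrite /word_perm big_cons. Qed.

Lemma word_perm_rcons i s : word_perm (rcons s i) = (word_perm s * adj i)%g.
Proof. by rewrite /word_perm big_rcons. Qed.

Lemma inv_word s : (inv (word_perm s) <= size s)%N.
Proof.
elim: s => [|i s IH]; first by rewrite /word_perm big_nil inv1.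
rewrite word_perm_cons /=; case: (boolP (asc i (word_perm s))) => a.
  by rewrite inv_asc.
by have := inv_desc a; lia.
Qed.

(** A recursive form of minimality, in which each prepended letter creates an inversion, so that
    inductions on reduced words need no length count. *)
Fixpoint reduced s : bool :=
  if s is i :: s' then asc i (word_perm s') && reduced s' else true.

Lemma reducedE s : reduced s = (inv (word_perm s) == size s).
Proof.
elim: s => [|i s IH]; first by rewrite /word_perm big_nil inv1.
rewrite word_perm_cons /= IH; have := inv_word s.
case: (boolP (asc i (word_perm s))) => a /=; first by rewrite inv_asc.
by have := inv_desc a => <- ?; apply/esym/eqP; lia.
Qed.

Lemma reduced_size s : reduced s -> size s = inv (word_perm s).
Proof. by rewrite reducedE => /eqP. Qed.

Lemma reduced_exists w : exists2 s, reduced s & word_perm s = w.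
Proof.
move d : (inv w) => m; elim: m w d => [|m IH] w d.
  exists [::] => //; rewrite /word_perm big_nil; apply/esym/asc_id => i.
  by apply/negPn/negP => /inv_desc; rewrite d.
case: (boolP [forall i, asc i w]) => [/forallP/asc_id w1|].
  by rewrite w1 inv1 in d.
rewrite negb_forall => /existsP [i a]; have := inv_desc a; rewrite d => -[/IH].
case=> s rs sE; exists (i :: s); last by rewrite word_perm_cons sE adjK.
by rewrite /= rs sE asc_adj a.
Qed.

Lemma redwordE w : word_perm (redword w) = w.
Proof. exact/eqP/(xchooseP (redword_subproof w)). Qed.

Lemma coxlenE w : coxlen w = inv w.
Proof.
rewrite /coxlen; case: ex_minnP => k /existsP [u /eqP uE] kmin.
case: (reduced_exists w) => s /reduced_size rs sE.
apply/eqP; rewrite eqn_leq; apply/andP; split.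
  rewrite -sE -rs; apply: kmin; apply/existsP.
  by exists (in_tuple s); rewrite sE.
by rewrite -(size_tuple u) -uE inv_word.
Qed.

Lemma redword_reduced w : reduced (redword w).
Proof. by rewrite reducedE redwordE -coxlenE size_tuple. Qed.

Lemma inv_rcons_asc k w : asc k w^-1 -> inv (w * adj k) = (inv w).+1.
Proof. by move=> a; rewrite -invV invMg adjV inv_asc // invV. Qed.

Lemma inv_rcons_desc k w : ~~ asc k w^-1 -> (inv (w * adj k)).+1 = inv w.
Proof. by move=> a; rewrite -(invV (_ * _)) invMg adjV inv_desc // invV. Qed.

Lemma reduced_rcons k s : asc k (word_perm s)^-1 -> reduced s ->
  reduced (rcons s k).
Proof.
rewrite !reducedE => a /eqP s1.
by rewrite word_perm_rcons inv_rcons_asc // s1 size_rcons.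
Qed.

Section Matsumoto.
Variables (R : pzRingType) (m : 'I_n.-1 -> R).
Hypothesis mcomm : forall i j, (i.+1 < j)%N -> m i * m j = m j * m i.
Hypothesis mbraid : forall i j, j = i.+1 :> nat -> m i * m j * m i = m j * m i * m j.

(** Induction on length. If the first letters i and j differ, both are left descents of w, which
    therefore has reduced words starting with i j i and j i j, or with i j and j i. The induction
    hypothesis joins each given word to one of these, and one relation joins the two. Only relations
    shared by the pi_i and the pib_i are assumed. *)
Lemma matsumoto s t : reduced s -> reduced t -> word_perm s = word_perm t ->
  \prod_(i <- s) m i = \prod_(i <- t) m i.
Proof.
move d : (size s) => l; elim: l s t d => [|l IH] s t d rs rt E.
  have /size0nil -> : size t = 0%N.
    by rewrite reduced_size // -E -reduced_size.
  by move/size0nil: d => ->.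
have dt : size t = l.+1 by rewrite reduced_size // -E -reduced_size.
case: s d rs E => // i s [d] rs E; case: t dt rt E => // j t [dt] rt E.
have {}IH u v : size u = l -> reduced u -> reduced v -> word_perm u = word_perm v ->
  \prod_(i <- u) m i = \prod_(i <- v) m i by exact: IH.
rewrite !big_cons.
wlog ij : i j s t d dt rs rt E / (i <= j)%N.
  move=> W; case: (leqP i j) => [|/ltnW] ij; first exact: W.
  by apply/esym/W.
have [ra rs'] := andP rs; have [rb rt'] := andP rt.
move: ij; rewrite leq_eqVlt => /orP [/eqP/val_inj ij|].
  subst j; congr (_ * _); apply: IH => //.
  by move: E; rewrite !word_perm_cons => /mulgI.
set w := word_perm (i :: s) in E; rewrite !word_perm_cons in E.
have sE : word_perm s = (adj i * w)%g by rewrite /w word_perm_cons adjK.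
have tE : word_perm t = (adj j * w)%g by rewrite E adjK.
have di : ~~ asc i w by rewrite -asc_adj -sE.
have dj : ~~ asc j w by rewrite -asc_adj -tE.
rewrite leq_eqVlt => /orP [/eqP ij|ij].
  have hilo : hi i = lo j by apply: val_inj.
  set a := lo i; set b := hi i; set c := hi j.
have [jb jc] : adj j b = c /\ adj j c = b by rewrite /b hilo adjL adjR.
  have ja : adj j a = a by apply: adj_lo_succ.
  have [ia ib] : adj i a = b /\ adj i b = a by rewrite adjL adjR.
  have ic : adj i c = c by apply: adj_hi_pred.
  move: di dj; rewrite !ascN -hilo -/a -/b -/c => di dj.
  (* The word [r] represents what remains of w once the longest element of the group generated by
     s_i and s_j is removed on the left. *)
  case: (reduced_exists (adj i * (adj j * (adj i * w)))) => r rr rE.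
  have rE' : word_perm r = (adj j * (adj i * (adj j * w)))%g.
    by rewrite rE; have := congr1 (mulg^~ w) (adj_braid (esym ij)); rewrite -!mulgA => ->.
  rewrite (IH s [:: j, i & r]) //; first last.
  - by rewrite !word_perm_cons rE !adjK sE.
  - rewrite /= rr !word_perm_cons rE adjK andbT /asc -hilo !permM -/a -/b -/c.
    by rewrite !(ia, ib, ic, ja, jb, jc) (ltn_trans dj di) dj.
  rewrite (IH t [:: i, j & r]) //; first last.
  - by rewrite !word_perm_cons rE' !adjK tE.
  - rewrite /= rr !word_perm_cons rE' adjK andbT /asc -hilo !permM -/a -/b -/c.
    by rewrite !(ia, ib, ic, ja, jb, jc) (ltn_trans dj di) di.
  by rewrite !big_cons !mulrA mbraid.
have [[ja jb] [ia ib]] := adj_far ij.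
case: (reduced_exists (adj i * (adj j * w))) => r rr rE.
rewrite (IH s (j :: r)) //; first last.
- by rewrite !word_perm_cons rE sE mulgA adj_comm // -mulgA adjK.
- rewrite /= rr rE andbT.
  by move: dj; rewrite !ascN /asc !permM ia ib adjL adjR.
rewrite (IH t (i :: r)) //; first last.
- by rewrite !word_perm_cons rE tE adjK.
- rewrite /= rr rE andbT asc_adj !ascN.
  by move: di; rewrite !ascN !permM ja jb.
by rewrite !big_cons !mulrA mcomm.
Qed.
End Matsumoto.
End ReducedWords.

(** * The basis of H_n(0) *)

Lemma idem_sub1_mul (R : pzRingType) (x : R) : x * x = x -> (x - 1) * x = 0.
Proof. by move=> xx; rewrite mulrBl mul1r xx subrr. Qed.

Lemma idem_sub1_quad (R : pzRingType) (x : R) : x * x = x ->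
  (x - 1) * (x - 1) = - (x - 1).
Proof. by move=> xx; rewrite mulrBr mulr1 idem_sub1_mul // sub0r. Qed.

(** Idempotence cancels [x * x] against one of the two linear terms [x]; what is left is symmetric
    in [x] and [y] apart from [x * y * x]. *)
Lemma braid_sub1 (R : pzRingType) (x y : R) : x * x = x ->
  (x - 1) * (y - 1) * (x - 1) = x * y * x - (x * y + y * x) + (x + y) - 1.
Proof.
move=> xx; rewrite !mulrBr !mulrBl !mul1r !mulr1 xx.
rewrite !opprB !opprD subrr addr0 -!addrA; congr (_ + _).
rewrite !addrA [LHS](ACl (5*1*2*4*3)%AC) /=.
by [].
Qed.

Lemma idem_sub1_braid (R : pzRingType) (x y : R) : x * x = x -> y * y = y ->
  x * y * x = y * x * y ->
  (x - 1) * (y - 1) * (x - 1) = (y - 1) * (x - 1) * (y - 1).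
Proof.
move=> xx yy br; rewrite !braid_sub1 // br.
by rewrite [x * y + _]addrC [x + _]addrC.
Qed.

Section Bubble.
Variable n : nat.
Implicit Types (i j k : 'I_n.-1) (w u : 'S_n).

(** One step of bubble sort. The coefficient of pib_w in pi_i h is that of pib_u in h, where u is
    [bubble i w]. *)
Definition bubble i w : 'S_n := if asc i w then w else (adj i * w)%g.

Lemma bubble_idem i w : bubble i (bubble i w) = bubble i w.
Proof. by rewrite /bubble; case a: (asc i w); rewrite ?asc_adj a. Qed.

Lemma bubble_comm i j w : (i.+1 < j)%N ->
  bubble i (bubble j w) = bubble j (bubble i w).
Proof.
move=> ij; have [[ja jb] [ia ib]] := adj_far ij.
have Ei : asc i (adj j * w) = asc i w by rewrite /asc !permM ja jb.
have Ej : asc j (adj i * w) = asc j w by rewrite /asc !permM ia ib.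
rewrite /bubble; case ai: (asc i w); case aj: (asc j w); rewrite ?Ei ?Ej ?ai ?aj //.
by rewrite !mulgA (adj_comm ij).
Qed.

(** Both sides sort the values of w at three consecutive places, so everything depends on three
    comparisons. *)
Lemma bubble_braid i j w : j = i.+1 :> nat ->
  bubble i (bubble j (bubble i w)) = bubble j (bubble i (bubble j w)).
Proof.
move=> ij; have hilo : lo j = hi i by apply: val_inj.
have ja := adj_lo_succ ij; have ic := adj_hi_pred ij.
have ia := adjL i; have ib := adjR i.
have jb := adjL j; have jc := adjR j; rewrite hilo in jb jc.
have br : (adj j * (adj i * (adj j * w)) = adj i * (adj j * (adj i * w)))%g.
  by have := congr1 (mulg^~ w) (adj_braid ij); rewrite -!mulgA => ->.
rewrite /bubble /asc hilo; move: ja ic ia ib jb jc.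
set a := lo i; set b := hi i; set c := hi j => ja ic ia ib jb jc.
have neg (x y : 'I_n) : x != y -> (w y < w x)%N = ~~ (w x < w y)%N.
  move=> xy; rewrite -leqNgt [RHS]leq_eqVlt; case: eqP => // E.
  by rewrite (perm_inj (val_inj E)) eqxx in xy.
have ab : a != b by rewrite -val_eqE /=; lia.
have bc : b != c by rewrite -val_eqE /=; lia.
have ac : a != c by rewrite -val_eqE /=; lia.
pose R := (neg _ _ ab, neg _ _ bc, neg _ _ ac).
pose V := (permM, ja, ic, ia, ib, jb, jc, R).
case E1: (w a < w b)%N; case E2: (w b < w c)%N; case E3: (w a < w c)%N => //;
  do 4?[rewrite ?(V, E1, E2, E3) /=] => //; lia.
Qed.

End Bubble.

(* The 0-Hecke algebra seen abstractly: computing in an algebra A which is a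
   variable keeps conversion away from the construction of hecke F n. *)
Record heckeAlg (F : fieldType) (n : nat) (A : algType F) := HeckeAlg {
  gen : 'I_n.-1 -> A;
  gen_quad : forall i, gen i * gen i = gen i;
  gen_comm : forall i j : 'I_n.-1, (i.+1 < j)%N -> gen i * gen j = gen j * gen i;
  gen_braid : forall i j : 'I_n.-1, j = i.+1 :> nat ->
    gen i * gen j * gen i = gen j * gen i * gen j;
  gen_ind : forall P : A -> Prop, P 1 ->
    (forall h k, P h -> P k -> P (h + k)) ->
    (forall c h, P h -> P (c *: h)) -> (forall i h, P h -> P (gen i * h)) ->
    forall h, P h;
  coord : 'S_n -> A -> F;
  coord_linear : forall w, linear (coord w : A -> F^o);
  coord1 : forall w, coord w 1 = (w == 1%g)%:R;
  coord_gen : forall i w h, coord w (gen i * h) = coord (bubble i w) h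
}.

(** The coordinate functionals are the components of the orbit map of the indicator function of the
    identity permutation, under precomposition with [bubble]. *)
Fact hecke_heckeAlg (F : fieldType) (n : nat) : exists D : heckeAlg n (hecke F n),
  gen D = @hpi F n.
Proof.
pose V : lmodType F := {ffun 'S_n -> F^o}.
pose T i (v : V) : V := [ffun w => v (bubble i w)].
have Tlin i : linear (T i) by move=> a u v; apply/ffunP => w; rewrite !ffunE.
have Tquad i v : T i (T i v) = T i v.
  by apply/ffunP => w; rewrite !ffunE bubble_idem.
have Tcomm (i j : 'I_n.-1) v : (i.+1 < j)%N -> T i (T j v) = T j (T i v).
  by move=> ij; apply/ffunP => w; rewrite !ffunE (bubble_comm _ ij).
have Tbraid (i j : 'I_n.-1) v : j = i.+1 :> nat ->
    T i (T j (T i v)) = T j (T i (T j v)).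
  by move=> ij; apply/ffunP => w; rewrite !ffunE bubble_braid.
have [c [lc c1 cp]] := hecke_rep Tlin Tquad Tcomm Tbraid [ffun w => (w == 1%g)%:R].
unshelve eexists (@HeckeAlg F n (hecke F n) (@hpi F n) (@hecke_quad F n)
  (@hecke_comm F n) (@hecke_braid F n) (@hecke_ind F n)
  (fun w h => (c h : {ffun 'S_n -> F^o}) w) _ _ _).
- by move=> w a g h; rewrite lc !ffunE.
- by move=> w; apply: etrans (congr1 (fun v : {ffun 'S_n -> F^o} => v w) c1) _;
    rewrite ffunE.
- move=> i w h; apply: etrans (congr1 (fun v : {ffun 'S_n -> F^o} => v w) (cp i h)) _.
  by rewrite ffunE.
by [].
Qed.

Section HeckeBasis.
Variables (F : fieldType) (n : nat) (A : algType F) (D : heckeAlg n A).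
Implicit Types (i j k : 'I_n.-1) (w u : 'S_n) (s t : seq 'I_n.-1) (h g : A).

Local Notation pi := (gen D).
Definition genb i : A := pi i - 1.
Local Notation pib := genb.
Definition basis_w w : A := \prod_(i <- redword w) genb i.
Local Notation B := basis_w.

Lemma genE i : pi i = 1 + pib i.
Proof. by rewrite addrC subrK. Qed.

Lemma genb_quad i : pib i * pib i = - pib i.
Proof. exact/idem_sub1_quad/gen_quad. Qed.

Lemma genb_gen i : pib i * pi i = 0.
Proof. exact/idem_sub1_mul/gen_quad. Qed.

Lemma genb_comm i j : (i.+1 < j)%N -> pib i * pib j = pib j * pib i.
Proof.
move=> ij; have C : GRing.comm (pi i) (pi j) by apply: gen_comm.
apply: commrB; last exact: commr1.
by apply/commr_sym/commrB; [apply: commr_sym | apply: commr1].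
Qed.

Lemma genb_braid i j : j = i.+1 :> nat ->
  pib i * pib j * pib i = pib j * pib i * pib j.
Proof.
move=> ij.
exact: idem_sub1_braid (gen_quad D i) (gen_quad D j) (gen_braid D ij).
Qed.

HB.instance Definition _ w :=
  GRing.isLinear.Build F A F^o *:%R (coord D w) (coord_linear D w).

Lemma coordZ w c h : coord D w (c *: h) = c * coord D w h.
Proof. exact: linearZ. Qed.

Lemma coord0 w : coord D w 0 = 0.
Proof. exact: raddf0. Qed.

Lemma coordD w h g : coord D w (h + g) = coord D w h + coord D w g.
Proof. exact: raddfD. Qed.

Lemma coordN w h : coord D w (- h) = - coord D w h.
Proof. exact: raddfN. Qed.

Lemma coord_sum w (I : Type) (r : seq I) (P : pred I) (G : I -> A) :
  coord D w (\sum_(i <- r | P i) G i) = \sum_(i <- r | P i) coord D w (G i).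
Proof. exact: raddf_sum. Qed.

Lemma coord_genb i w h : coord D w (pib i * h) =
  if asc i w then 0 else coord D (adj i * w) h - coord D w h.
Proof.
rewrite /genb mulrBl mul1r raddfB /= coord_gen /bubble.
by case: ifP => // _; rewrite subrr.
Qed.

Lemma basis_word s : reduced s -> \prod_(i <- s) pib i = B (word_perm s).
Proof.
by move=> rs; apply: (matsumoto genb_comm genb_braid);
  rewrite ?redwordE ?redword_reduced.
Qed.

Lemma gen_word s : reduced s ->
  \prod_(i <- s) pi i = \prod_(i <- redword (word_perm s)) pi i.
Proof.
by move=> rs; apply: (matsumoto (@gen_comm _ _ _ D) (@gen_braid _ _ _ D));
  rewrite ?redwordE ?redword_reduced.
Qed.

Lemma basis_w1 : B 1%g = 1.
Proof. by have := @basis_word [::] isT; rewrite /word_perm !big_nil. Qed.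

Lemma basis_mul_asc i w : asc i w -> pib i * B w = B (adj i * w).
Proof.
move=> a; have rs : reduced (i :: redword w).
  by rewrite /= redwordE a redword_reduced.
rewrite (_ : adj i * w = word_perm (i :: redword w))%g -?basis_word //.
  by rewrite big_cons.
by rewrite word_perm_cons redwordE.
Qed.

Lemma basis_mul_desc i w : ~~ asc i w -> pib i * B w = - B w.
Proof.
move=> a; rewrite -{1}(adjK i w) -basis_mul_asc ?asc_adj //.
by rewrite mulrA genb_quad mulNr basis_mul_asc ?asc_adj // adjK.
Qed.

Lemma mul_basis_asc k w : asc k w^-1 -> B w * pib k = B (w * adj k).
Proof.
move=> a; have rs : reduced (rcons (redword w) k).
  by apply: reduced_rcons; rewrite ?redwordE // redword_reduced.
rewrite (_ : w * adj k = word_perm (rcons (redword w) k))%g -?basis_word //.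
  by rewrite big_rcons.
by rewrite word_perm_rcons redwordE.
Qed.

Lemma asc_adjr k w : asc k (w * adj k)^-1 = ~~ asc k w^-1.
Proof. by rewrite invMg adjV asc_adj. Qed.

Lemma mul_basis_desc k w : ~~ asc k w^-1 -> B w * pib k = - B w.
Proof.
move=> a; rewrite -{1}(adjKr k w) -mul_basis_asc ?asc_adjr //.
by rewrite -mulrA genb_quad mulrN mul_basis_asc ?asc_adjr // adjKr.
Qed.

(** Duality of the functionals with the pib_u, proved along a reduced word of u; linear independence
    of the pib_u is a consequence. *)
Lemma coord_basis w u : coord D w (B u) = (w == u)%:R.
Proof.
rewrite -(redwordE u) -basis_word ?redword_reduced //.
have := redword_reduced u; elim: (redword u) w => [|i s IH] w.
  by rewrite /word_perm !big_nil coord1.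
move=> /= /andP [a rs]; rewrite big_cons coord_genb !IH // word_perm_cons.
have -> : (adj i * w == word_perm s)%g = (w == adj i * word_perm s)%g.
  by rewrite -(inj_eq (mulgI (adj i))) adjK.
case: ifP => b.
  by case: eqP b => // ->; rewrite asc_adj a.
by case: (eqVneq w (word_perm s)) b a => [-> -> //|]; rewrite subr0.
Qed.

(** By duality the coefficients are forced, so only spanning remains, and the span of the pib_w
    contains 1 and is closed under left multiplication by generators. *)
Lemma basis_sum h : h = \sum_w coord D w h *: B w.
Proof.
suff [a ->] : exists a : 'S_n -> F, h = \sum_w a w *: B w.
  apply: eq_bigr => w _; rewrite coord_sum (bigD1 w) //= big1 ?addr0 => [|u uw].
    by rewrite coordZ coord_basis eqxx mulr1.
  by rewrite coordZ coord_basis eq_sym (negbTE uw) mulr0.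
elim/(@gen_ind _ _ _ D): h => [|h g [a ->] [b ->]|c h [a ->]|i h [a ->]].
- exists (fun w => (w == 1%g)%:R); rewrite (bigD1 1%g) //= big1 ?addr0.
    by rewrite eqxx scale1r basis_w1.
  by move=> w /negbTE ->; rewrite scale0r.
- exists (fun w => a w + b w); rewrite -big_split; apply: eq_bigr => w _.
  by rewrite scalerDl.
- exists (fun w => c * a w); rewrite scaler_sumr; apply: eq_bigr => w _.
  by rewrite scalerA.
have [b bE] : exists b : 'S_n -> F, \sum_w a w *: (pib i * B w) = \sum_w b w *: B w.
  (* For an ascent u, pib_i pib_u is indexed by [adj i * u], which has i as a descent; for a descent
     it is -pib_u. So only descents carry a coefficient, with these two contributions. *)
  exists (fun w => if asc i w then 0 else a (adj i * w)%g - a w).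
  rewrite (bigID (asc i)) [RHS](bigID (asc i)) /=.
  rewrite [X in _ = X + _]big1 ?add0r; last by move=> w ->; rewrite scale0r.
  under [X in _ = X]eq_bigr => w aw do rewrite (negbTE aw) scalerBl.
  rewrite sumrB; congr (_ + _).
    rewrite (reindex_inj (mulgI (adj i))); apply: eq_big => w; rewrite asc_adj //.
    by move=> aw; rewrite basis_mul_asc ?asc_adj // adjK.
  by rewrite -sumrN; apply: eq_bigr => w aw; rewrite basis_mul_desc // scalerN.
exists (fun w => a w + b w); rewrite genE mulrDl mul1r mulr_sumr.
under [X in _ + X]eq_bigr do rewrite -scalerAr.
rewrite bE -big_split; apply: eq_bigr => w _.
by rewrite scalerDl.
Qed.

End HeckeBasis.

(** * Longest elements and the length filtration *)

Section Parabolic.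
Variable n : nat.
Implicit Types (i j k : 'I_n.-1) (w u : 'S_n) (I : {set 'I_n.-1}).

Definition young I : {group 'S_n} := [group of <<[set adj i | i in I]>>%g].

Lemma young_initial I i w (x : 'I_n) : w \in young I -> i \notin I ->
  (w x <= i)%N = (x <= i)%N.
Proof.
move=> wI iI; pose S : {set 'I_n} := [set y : 'I_n | (y <= i)%N].
have : w \in ('N(S | 'P))%g.
  have /subsetP : young I \subset ('N(S | 'P))%g; last exact.
  rewrite gen_subG; apply/subsetP => _ /imsetP [j jI ->].
  apply/astabsP => y; rewrite !inE /= apermE adj_val.
  have : (j : nat) != i by apply: contraNneq iI => /val_inj <-.
  by do !case: ifP => ?; lia.
by move=> /astabsP /(_ x); rewrite !inE /= apermE.
Qed.

(** Membership in [young I] expressed by preserved initial segments, a form that can be checked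
    directly on block permutations. One direction is [young_stable]; the other follows from
    [stable_word]. *)
Definition stable I w : Prop := forall i (x : 'I_n),
  i \notin I -> (w x <= i)%N = (x <= i)%N.

Lemma young_stable I w : w \in young I -> stable I w.
Proof. by move=> wI i x iI; apply: young_initial wI iI. Qed.

Lemma stable_asc I i w : stable I w -> i \notin I -> asc i w.
Proof.
move=> wI iI; have := wI i (lo i) iI; have := wI i (hi i) iI.
by rewrite /asc /= leqnn ltnn; lia.
Qed.

Lemma young_asc I i w : w \in young I -> i \notin I -> asc i w.
Proof. by move/young_stable; apply: stable_asc. Qed.

(** The first letter is a descent, while a stable permutation ascends outside [I]; so that letter is
    in [I], preserves the same segments, and may be removed. *)
Lemma stable_word I s : reduced s -> stable I (word_perm s) -> {subset s <= I}.
Proof.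
elim: s => [|i s IH] //= /andP [a rs]; rewrite word_perm_cons => wI.
have iI : i \in I.
  by apply/negPn/negP => /(stable_asc wI); rewrite asc_adj a.
move=> j; rewrite inE => /predU1P [-> //|]; apply: IH => // m x mI.
have aK : adj i (adj i x) = x by exact: tpermK.
have := wI m (adj i x) mI; rewrite permM aK => ->.
rewrite adj_val; have : (m : nat) != i by apply: contraNneq mI => /val_inj ->.
by do !case: ifP => ?; lia.
Qed.

Lemma longest_young I : longest I \in young I.
Proof. by rewrite /longest; case: arg_maxnP => //; exact: group1. Qed.

Lemma longest_max I w : w \in young I -> (inv w <= inv (longest I))%N.
Proof.
move=> wI; rewrite /longest; case: arg_maxnP => [|u uI umax]; first exact: group1.
by rewrite -!coxlenE; apply: umax.
Qed.

Lemma adj_young I i : i \in I -> adj i \in young I.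
Proof. by move=> iI; rewrite mem_gen // imset_f. Qed.

Lemma longest_desc I i : i \in I -> ~~ asc i (longest I).
Proof.
move=> iI; apply/negP => /inv_asc E.
have := @longest_max I (adj i * longest I).
by rewrite E ltnn groupM ?longest_young ?adj_young // => /(_ isT).
Qed.

Lemma longest_rdesc I i : i \in I -> ~~ asc i (longest I)^-1.
Proof.
move=> iI; apply/negP => /inv_rcons_asc E.
have := @longest_max I (longest I * adj i).
by rewrite E ltnn groupM ?longest_young ?adj_young // => /(_ isT).
Qed.

Lemma longest_rasc I i : i \notin I -> asc i (longest I)^-1.
Proof. by apply: young_asc; rewrite groupV longest_young. Qed.

Lemma redword_longest I : {subset redword (longest I) <= I}.
Proof.
apply: stable_word; rewrite ?redword_reduced // redwordE.
exact/young_stable/longest_young.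
Qed.

End Parabolic.

Section Filtration.
Variables (F : fieldType) (n : nat) (A : algType F) (D : heckeAlg n A).
Implicit Types (i j k : 'I_n.-1) (w u : 'S_n) (s t : seq 'I_n.-1) (h g : A).
Implicit Types (I K E : {set 'I_n.-1}).
Local Notation pib := (genb D).
Local Notation B := (basis_w D).

Definition xI I : A := B (longest I).
Definition yK K : A := \prod_(i <- redword (longest K)) gen D i.

(** The longest element has a reduced word beginning with any chosen k in [K], and pib_k pi_k =
    0. *)
Lemma genb_yK K k : k \in K -> pib k * yK K = 0.
Proof.
move=> kK; have d := longest_desc kK.
case: (reduced_exists (adj k * longest K)) => s rs sE.
have rks : reduced (k :: s) by rewrite /= sE asc_adj d.
have -> : yK K = \prod_(i <- k :: s) gen D i.
  by rewrite gen_word // word_perm_cons sE adjK.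
by rewrite big_cons mulrA genb_gen mul0r.
Qed.

Lemma basis_mul_word w s : {in s, forall k, ~~ asc k w^-1} ->
  B w * \prod_(i <- s) pib i = (-1) ^+ size s *: B w.
Proof.
elim/last_ind: s => [|s k IH] ds; first by rewrite big_nil mulr1 scale1r.
rewrite big_rcons mulrA IH => [|j js]; last by apply: ds; rewrite mem_rcons inE js orbT.
rewrite -scalerAl mul_basis_desc; last by apply: ds; rewrite mem_rcons mem_head.
by rewrite size_rcons exprSr scalerN mulrN1 scaleNr.
Qed.

(** The scalar by which right multiplication by x acts on pib_w when [I] consists of right descents
    of w. *)
Definition bsign I : F := (-1) ^+ size (redword (longest I)).

Lemma bsignK I : bsign I * bsign I = 1.
Proof. by rewrite /bsign -expr2 sqrr_sign. Qed.

Lemma basis_mul_xI w I : {in I, forall i, ~~ asc i w^-1} ->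
  B w * xI I = bsign I *: B w.
Proof.
move=> wI; rewrite -basis_mul_word // => k /redword_longest; exact: wI.
Qed.

(** The span of the pib_w of length at least m. Right multiplication by a pib_k either lengthens w
    or changes a sign, so this is a right ideal ([filtMr]), which is what makes triangularity
    survive multiplication. *)
Definition filt m h : Prop := forall w, (inv w < m)%N -> coord D w h = 0.

Lemma filt0 m : filt m 0.
Proof. by move=> w _; apply: coord0. Qed.

Lemma filtD m h g : filt m h -> filt m g -> filt m (h + g).
Proof. by move=> mh mg w wm; rewrite coordD mh // mg // addr0. Qed.

Lemma filtZ m c h : filt m h -> filt m (c *: h).
Proof. by move=> mh w wm; rewrite coordZ mh // mulr0. Qed.

Lemma filtN m h : filt m h -> filt m (- h).
Proof. by move=> mh w wm; rewrite coordN mh // oppr0. Qed.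

Lemma filt_sum m (T : finType) (G : T -> A) :
  (forall x, filt m (G x)) -> filt m (\sum_x G x).
Proof. by move=> mG w wm; rewrite coord_sum big1 // => x _; apply: mG. Qed.

Lemma filt_basis m w : (m <= inv w)%N -> filt m (B w).
Proof.
move=> mw u um; rewrite coord_basis; case: eqP => // uw.
by move: um; rewrite uw; lia.
Qed.

Lemma filt_genb m h k : filt m h -> filt m (h * pib k).
Proof.
move=> mh; rewrite (basis_sum D h) mulr_suml; apply: filt_sum => w.
rewrite -scalerAl; case: (ltnP (inv w) m) => [wm|mw].
  by rewrite mh // scale0r; apply: filt0.
apply: filtZ; case: (boolP (asc k w^-1)) => a.
  by rewrite mul_basis_asc //; apply: filt_basis; rewrite inv_rcons_asc // ltnW.
by rewrite mul_basis_desc //; apply/filtN/filt_basis.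
Qed.

Lemma filtMr m h g : filt m h -> filt m (h * g).
Proof.
move=> mh; rewrite (basis_sum D g) mulr_sumr; apply: filt_sum => w.
rewrite -scalerAr; apply: filtZ; rewrite /basis_w.
elim: (redword w) h mh => [|i s IH] h mh; first by rewrite big_nil mulr1.
by rewrite big_cons mulrA; apply/IH/filt_genb.
Qed.

(** Expand the first factor as 1 + pib_k. The pib_k term is already longer and stays so whatever
    follows, hence ascents of the original w suffice throughout. *)
Lemma basis_mul_gens w s : {in s, forall k, asc k w^-1} ->
  filt (inv w).+1 (B w * \prod_(i <- s) gen D i - B w).
Proof.
elim: s => [|k s IH] ds; first by rewrite big_nil mulr1 subrr; apply: filt0.
have dk : asc k w^-1 by apply: ds; rewrite mem_head.
rewrite big_cons genE mulrDl mul1r mulrDr addrAC; apply: filtD.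
  by apply: IH => j js; apply: ds; rewrite inE js orbT.
rewrite mulrA mul_basis_asc //; apply/filtMr/filt_basis.
by rewrite inv_rcons_asc.
Qed.

Lemma basis_mul_yK w K : {in K, forall k, asc k w^-1} ->
  filt (inv w).+1 (B w * yK K - B w).
Proof.
move=> wK; apply: basis_mul_gens => k /redword_longest; exact: wK.
Qed.

(** Induction on the length of [p x], reading the coefficient at [p x]: terms with shorter leading
    permutation vanish by induction, the others contribute nothing there because [p] is
    injective. *)
Lemma triangular_free (T : finType) (p : T -> 'S_n) (c : T -> F) (e : T -> A)
    (v : T -> F) :
  injective p -> (forall x, c x != 0) ->
  (forall x, filt (inv (p x)).+1 (e x - c x *: B (p x))) ->
  \sum_x v x *: e x = 0 -> forall x, v x = 0.
Proof.
move=> pI c0 eE sum0 x.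
move d : (inv (p x)) => m; elim/ltn_ind: m x d => m IH x xm.
have /eqP := congr1 (coord D (p x)) sum0.
rewrite coord_sum (bigD1 x) //= big1 ?addr0 => [|y yx].
  rewrite coordZ -[e x](subrK (c x *: B (p x))) coordD eE // add0r coordZ.
  rewrite coord_basis eqxx mulr1 coord0.
  by rewrite mulf_eq0 (negbTE (c0 x)) orbF => /eqP.
rewrite coordZ; case: (ltnP (inv (p y)) m) => ym; first by rewrite (IH _ ym y) // mul0r.
rewrite -[e y](subrK (c y *: B (p y))) coordD eE; last by rewrite xm; lia.
by rewrite coordZ coord_basis (inj_eq pI) eq_sym (negbTE yx) mulr0 addr0 mulr0.
Qed.

End Filtration.

(** * Modules embedded in H_n(0) *)

Section LinearCombinations.
Variables (F : fieldType) (A : lmodType F) (T : finType).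
Implicit Types (e f : T -> A) (u v : {ffun T -> F^o}).

Definition lincomb e v : A := \sum_x v x *: e x.
Definition indep e : Prop := forall v, lincomb e v = 0 -> v = 0.
Definition delta (x : T) : {ffun T -> F^o} := [ffun y => (y == x)%:R].

Lemma lincomb_linear e : linear (lincomb e).
Proof.
move=> c u v; rewrite /lincomb scaler_sumr -big_split; apply: eq_bigr => x _.
by rewrite !ffunE scalerDl scalerA.
Qed.
HB.instance Definition _ e :=
  GRing.isLinear.Build F {ffun T -> F^o} A *:%R (lincomb e) (lincomb_linear e).

Lemma lincomb_delta e x : lincomb e (delta x) = e x.
Proof.
rewrite /lincomb (bigD1 x) //= big1 ?addr0 => [|y yx].
  by rewrite ffunE eqxx scale1r.
by rewrite ffunE (negbTE yx) scale0r.
Qed.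

Lemma delta_sum v : v = \sum_x (v x : F) *: delta x.
Proof.
apply/ffunP => y; rewrite sum_ffunE (bigD1 y) //= big1 ?addr0 => [|x xy].
  by rewrite !ffunE eqxx /= [_ *: _]mulr1.
by rewrite !ffunE eq_sym (negbTE xy) [_ *: _]mulr0.
Qed.

Lemma indep_inj e : indep e -> injective (lincomb e).
Proof.
move=> ie u v E; apply/subr0_eq/ie.
by rewrite raddfB /= E subrr.
Qed.

Lemma lincombZ e (c : F) v : lincomb e (c *: v) = c *: lincomb e v.
Proof. exact: linearZZ. Qed.

(** The dimension count: choosing coordinates of each [e x] with respect to [f] gives an
    endomorphism of F^T, injective since [e] is independent, hence surjective. *)
Lemma indep_span e f : indep e -> (forall x, exists u, lincomb f u = e x) ->
  forall u, exists v, lincomb e v = lincomb f u.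
Proof.
move=> ie fe; pose g0 (v : {ffun T -> F^o}) := \sum_x (v x : F) *: sval (cid (fe x)).
have g0E v : lincomb f (g0 v) = lincomb e v.
  rewrite raddf_sum; apply: eq_bigr => x _ /=.
  by rewrite lincombZ; case: cid => u /= ->.
have g0l : linear g0.
  move=> c u v; rewrite /g0 scaler_sumr -big_split; apply: eq_bigr => x _.
  by rewrite !ffunE scalerDl scalerA.
pose gL : {linear {ffun T -> F^o} -> {ffun T -> F^o}} :=
  HB.pack g0 (GRing.isLinear.Build _ _ _ _ g0 g0l).
pose g := linfun gL.
have kg : lker g == 0%VS.
  apply/lker0P => u v; rewrite !lfunE /= => E.
  by apply: (indep_inj ie); rewrite -!g0E E.
move=> u; exists (g^-1%VF u); rewrite -g0E.
by rewrite -[g0 _](lfunE gL) lker0_lfunVK.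
Qed.

End LinearCombinations.

Section Transport.
Variables (F : fieldType) (A R : algType F) (V : lmodType F).
Variables (rho : R -> A) (f : V -> A).
Hypotheses (rho_lin : linear rho) (rho1 : rho 1 = 1).
Hypothesis rhoM : {morph rho : x y / x * y}.
Hypotheses (f_lin : linear f) (f_inj : injective f).
Hypothesis closed : forall r v, exists v', f v' = rho r * f v.

(** Left multiplication is pulled back along [f], and injectivity of [f] transfers the module
    axioms. It is applied with [rho] the identity for tableaux and with the inclusion of the
    parabolic subalgebra for tensor products. *)
Lemma transport_action : exists act : R -> V -> V,
  module_action act /\ forall r v, f (act r v) = rho r * f v.
Proof.
pose act r v := sval (cid (closed r v)).
have actE r v : f (act r v) = rho r * f v by rewrite /act; case: cid.
exists act; split=> //; split.
- move=> r c u v; apply: f_inj; rewrite f_lin !actE f_lin.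
  by rewrite mulrDr scalerAr.
- move=> v c r s; apply: f_inj; rewrite f_lin !actE rho_lin.
  by rewrite mulrDl scalerAl.
- by move=> v; apply: f_inj; rewrite actE rho1 mul1r.
- by move=> r s v; apply: f_inj; rewrite !actE rhoM mulrA.
Qed.
End Transport.

Section SameImage.
Variables (A : nzRingType) (x : A).

Definition ideal_model (U : lmodType A) : Prop := exists f : U -> A,
  [/\ forall a u v, f (a *: u + v) = a * f u + f v, injective f
    & forall h, (exists u, f u = h) <-> (exists a, h = a * x)].

Lemma ideal_model_iso (U V : lmodType A) :
  ideal_model U -> ideal_model V -> lmod_iso U V.
Proof.
move=> [f [fl fi fx]] [g [gl gi gx]].
have ex u : exists v, g v = f u by apply/gx/fx; exists u.
have ey v : exists u, f u = g v by apply/fx/gx; exists v.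
pose phi u := sval (cid (ex u)); pose psi v := sval (cid (ey v)).
have phiE u : g (phi u) = f u by rewrite /phi; case: cid.
have psiE v : f (psi v) = g v by rewrite /psi; case: cid.
have phil : linear phi by move=> a u v; apply: gi; rewrite gl !phiE fl.
pose phiL : {linear U -> V} := HB.pack phi (GRing.isLinear.Build _ _ _ _ phi phil).
exists phiL; exists psi => [u|v]; first by apply: fi; rewrite psiE phiE.
by apply: gi; rewrite phiE psiE.
Qed.

Lemma lideal_model : ideal_model (lideal_mod x).
Proof.
exists (fun u => val u : A); split=> //.
- exact: val_inj.
- move=> h; split=> [[u <-]|hx]; first exact/asboolP/(valP u).
  have hI : (h : A^o) \in lideal x by apply/asboolP.
  by exists (Sub (h : A^o) hI); rewrite SubK.
Qed.
End SameImage.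

Section Models.
Variables (F : fieldType) (n : nat) (A : algType F) (D : heckeAlg n A).
Implicit Types (i j k : 'I_n.-1) (w u : 'S_n) (I K E : {set 'I_n.-1}).
Local Notation B := (basis_w D).

Definition xset I K w : bool :=
  [forall i in I, ~~ asc i w^-1] && [forall k in K, asc k w^-1].

Lemma xsetP I K w : reflect
  ({in I, forall i, ~~ asc i w^-1%g} /\ {in K, forall k, asc k w^-1%g}) (xset I K w).
Proof.
by apply: (iffP andP) => -[/forall_inP a /forall_inP b]; split=> //; apply/forall_inP.
Qed.

Lemma longest_xset I K : {in K, forall k, k \notin I} -> xset I K (longest I).
Proof.
move=> KI; apply/xsetP; split=> [i /longest_rdesc //|k /KI].
exact: longest_rasc.
Qed.

(** Up to a sign of square 1, pib_w absorbs x on its right; this places pib_w y in H x y. *)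
Lemma basis_yK_ideal I K w : xset I K w ->
  B w * yK D K = bsign F I *: B w * (xI D I * yK D K).
Proof.
move=> /xsetP [wI _]; rewrite -scalerAl mulrA basis_mul_xI //.
by rewrite -scalerAl scalerA bsignK scale1r.
Qed.

(** The equality of permutations lets pib_i pass through pib_w and become pib_k, which annihilates
    y. *)
Lemma genb_basis_row K i w k : k \in K -> asc i w -> (adj i * w = w * adj k)%g ->
  genb D i * (B w * yK D K) = 0.
Proof.
move=> kK a E; rewrite mulrA basis_mul_asc // E -mul_basis_asc.
  by rewrite -mulrA genb_yK // mulr0.
apply/negPn/negP => /inv_rcons_desc; rewrite -E inv_asc //.
lia.
Qed.

Variables (T : finType) (p : T -> 'S_n).
Hypothesis pI : injective p.

Lemma indep_basis_yK I K : (forall x, xset I K (p x)) ->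
  indep (fun x => B (p x) * yK D K).
Proof.
move=> pX v E; apply/ffunP => x; rewrite ffunE.
apply: (triangular_free (D := D) (c := fun=> 1) pI _ _ E) => [_|y].
  exact: oner_neq0.
by rewrite scale1r; apply: basis_mul_yK; case/xsetP: (pX y).
Qed.

(** The leading term is pib_{p x} up to sign: the corrections on the left lie in a right ideal of
    longer elements, and x acts on the leading term by its sign. Letting [E] vary serves the direct
    sum, where it is the complement of the descents of beta. *)
Lemma indep_basis_mul I K (E : T -> {set 'I_n.-1}) :
  (forall x, xset I K (p x)) ->
  (forall x, {in E x, forall k, asc k (p x)^-1%g}) ->
  indep (fun x => B (p x) * yK D (E x) * (xI D I * yK D K)).
Proof.
move=> pX pE v sum0; apply/ffunP => x; rewrite ffunE.
apply: (triangular_free (D := D) (c := fun=> bsign F I) pI _ _ sum0) => [_|y].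
  by rewrite /bsign signr_eq0.
have /xsetP [yI yKK] := pX y.
have -> : B (p y) * yK D (E y) * (xI D I * yK D K) - bsign F I *: B (p y) =
   (B (p y) * yK D (E y) - B (p y)) * (xI D I * yK D K) +
   bsign F I *: (B (p y) * yK D K - B (p y)).
  rewrite mulrBl [B _ * (xI _ _ * _)]mulrA basis_mul_xI // -scalerAl scalerBr.
  by rewrite addrA subrK.
apply: filtD; first exact/filtMr/basis_mul_yK/pE.
exact/filtZ/basis_mul_yK.
Qed.

(** Closure under the generators makes the span a left ideal. It contains x y, the element with w
    the longest of [I], and each spanning element is a left multiple of x y. *)
Lemma lincomb_ideal I K : (forall x, xset I K (p x)) ->
  (exists x, p x = longest I) ->
  (forall i x, exists v : {ffun T -> F^o},
     lincomb (fun x => B (p x) * yK D K) v = genb D i * (B (p x) * yK D K)) ->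
  forall h, (exists v, lincomb (fun x => B (p x) * yK D K) v = h) <->
            (exists a, h = a * (xI D I * yK D K)).
Proof.
move=> pX [x0 x0E] closed; set e := fun x : T => B (p x) * yK D K.
have closed_gen i v : exists v', lincomb e v' = gen D i * lincomb e v.
  exists (v + \sum_x (v x : F) *: sval (cid (closed i x))).
  rewrite raddfD /= genE mulrDl mul1r; congr (_ + _).
  rewrite raddf_sum mulr_sumr; apply: eq_bigr => x _ /=.
  by rewrite lincombZ -scalerAr; case: cid => u /= ->.
have closedA a v : exists v', lincomb e v' = a * lincomb e v.
  elim/(@gen_ind _ _ _ D): a => [|h k [u uE] [u' uE']|c h [u uE]|i h [u uE]].
  - by exists v; rewrite mul1r.
  - by exists (u + u'); rewrite raddfD /= uE uE' mulrDl.
  - by exists (c *: u); rewrite lincombZ uE scalerAl.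
  - by have [u' u'E] := closed_gen i u; exists u'; rewrite u'E uE mulrA.
move=> h; split=> [[v <-]|[a ->]].
  exists (\sum_x (v x : F) *: (bsign F I *: B (p x))).
  rewrite mulr_suml; apply: eq_bigr => x _.
  by rewrite -!scalerAl /e (basis_yK_ideal (pX x)) scalerAl.
have -> : xI D I * yK D K = lincomb e (delta F x0).
  by rewrite lincomb_delta /e x0E.
exact: closedA.
Qed.

End Models.

(** * Standard tableaux as permutations *)

Section TableauPerm.
Variables (n : nat) (al : seq (seq nat)) (I K : {set 'I_n.-1}).
Local Notation cells := (gribbon_cells 0 0 al).

Definition cell_row (x : nat) : nat := (nth (0, 0)%N cells x).1.
Definition cell_col (x : nat) : nat := (nth (0, 0)%N cells x).2.

(** Boxes are read from the lower left. Steps in [I] go up inside a ribbon, steps in [K] go right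
    inside a row, and the remaining steps jump from one component to the next. *)
Definition cell_steps : Prop := size cells = n /\ forall k : 'I_n.-1,
  nth (0, 0)%N cells k.+1 =
  if k \in I then ((cell_row k).+1, cell_col k)
  else if k \in K then (cell_row k, (cell_col k).+1)
  else ((cell_row k).+1, (cell_col k).+1).

Hypothesis steps : cell_steps.
Hypothesis KI : {in K, forall k, k \notin I}.

Lemma cell_mono (x y : nat) : (x <= y)%N -> (y < n)%N ->
  [/\ (cell_row x <= cell_row y)%N, (cell_col x <= cell_col y)%N &
      (x < y)%N -> (cell_row x + cell_col x < cell_row y + cell_col y)%N].
Proof.
elim: y => [|y IH] xy yn; first by rewrite leqn0 in xy; rewrite (eqP xy); split.
move: xy; rewrite leq_eqVlt => /predU1P [-> |xy]; first by split; rewrite ?ltnn.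
have [r c rc] := IH xy (ltnW yn).
have yn1 : (y < n.-1)%N by lia.
have := steps.2 (Ordinal yn1); rewrite /cell_row /cell_col /= => ->.
rewrite /cell_row /cell_col in r c rc.
by do 2?[case: ifP => _]; rewrite /=; split; lia.
Qed.

Lemma cell_size (x : 'I_n) : (x < size cells)%N.
Proof. by rewrite steps.1. Qed.

Definition box_at (x : 'I_n) : box al := SeqSub (mem_nth (0, 0)%N (cell_size x)).

Lemma box_at_inj : injective box_at.
Proof.
move=> x y /(congr1 val) /= E; apply: val_inj => /=.
have [xy|] := leqP x y.
  have [_ _] := cell_mono xy (ltn_ord y); rewrite /cell_row /cell_col E.
  by move: xy; rewrite leq_eqVlt => /predU1P [//|xy] /(_ xy); rewrite ltnn.
move=> yx; have [_ _ /(_ yx)] := cell_mono (ltnW yx) (ltn_ord x).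
by rewrite /cell_row /cell_col E ltnn.
Qed.

Lemma box_index (b : box al) : (index (val b) cells < n)%N.
Proof. by rewrite -steps.1 index_mem; apply: (valP b). Qed.

Definition box_pos (b : box al) : 'I_n := Ordinal (box_index b).

Lemma box_posK : cancel box_pos box_at.
Proof. by move=> b; apply: val_inj; rewrite /= nth_index //; apply: (valP b). Qed.

Lemma box_atK : cancel box_at box_pos.
Proof. by move=> x; apply: box_at_inj; rewrite box_posK. Qed.

Lemma row_box_at x : Defs.row (box_at x) = cell_row x. Proof. by []. Qed.
Lemma col_box_at x : Defs.col (box_at x) = cell_col x. Proof. by []. Qed.

Lemma cell_row_hi (k : 'I_n.-1) : k \in K -> cell_row (hi k) = cell_row (lo k).
Proof. by move=> kK; rewrite /cell_row steps.2 (negbTE (KI kK)) kK. Qed.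

Lemma cell_row_K (k : 'I_n.-1) : cell_row (hi k) = cell_row (lo k) -> k \in K.
Proof.
rewrite {1}/cell_row steps.2 /=.
by do 2?[case: ifP => //= _]; move=> /eqP; rewrite eqn_leq ltnn.
Qed.

Lemma cell_col_hi (k : 'I_n.-1) : k \in I -> cell_col (hi k) = cell_col (lo k).
Proof. by move=> kI; rewrite /cell_col steps.2 kI. Qed.

Lemma cell_col_I (k : 'I_n.-1) : cell_col (hi k) = cell_col (lo k) -> k \in I.
Proof.
rewrite {1}/cell_col steps.2 /=.
by do 2?[case: ifP => //= _]; move=> /eqP; rewrite eqn_leq ltnn.
Qed.

(** As [g] is monotone it is constant between x and y, so every intermediate step is in [L] and
    transitivity applies. Rows use [K] with increasing values, columns use [I] with decreasing
    values. *)
Lemma row_chain (R : rel nat) (w : 'I_n -> 'I_n) (g : nat -> nat) (L : {set 'I_n.-1}) :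
  transitive R -> (forall x y : nat, (x <= y)%N -> (y < n)%N -> (g x <= g y)%N) ->
  (forall k : 'I_n.-1, g (hi k) = g (lo k) -> k \in L) ->
  {in L, forall k, R (w (lo k)) (w (hi k))} ->
  forall x y : 'I_n, (x < y)%N -> g x = g y -> R (w x) (w y).
Proof.
move=> tR gm gL wL x y; move d : (y - x)%N => m.
elim: m y d => [|m IH] y d xy gxy; first by lia.
have zn : (y.-1 < n.-1)%N by have := ltn_ord y; lia.
pose z := Ordinal zn; have yE : y = hi z by apply: val_inj => /=; lia.
have xz : (x <= lo z)%N by rewrite /=; lia.
have gz1 := gm _ _ xz (ltn_ord (lo z)).
have gz2 : (g (lo z) <= g (hi z))%N by apply: gm; [exact: leqnSn | exact: ltn_ord].
rewrite -yE in gz2.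
have Rz : R (w (lo z)) (w y) by rewrite yE; apply/wL/gL; rewrite -yE; lia.
move: xz; rewrite leq_eqVlt => /predU1P [/val_inj -> //|xz].
apply: tR Rz; apply: IH => //; last by lia.
by rewrite /= in xz *; lia.
Qed.

Section OneTableau.
Variable t : SYT n al.

Lemma syt_inj : injective (val t).
Proof.
move=> b b' E; have /and3P [/forallP /(_ (val t b)) /cards1P [b0 E0] _ _] := valP t.
have : b \in [set b1 | val t b1 == val t b] by rewrite inE.
have : b' \in [set b1 | val t b1 == val t b] by rewrite inE E.
by rewrite E0 !inE => /eqP -> /eqP ->.
Qed.

Lemma syt_at_inj : injective (fun x => val t (box_at x)).
Proof. by move=> x y /syt_inj/box_at_inj. Qed.

(* The position of each entry in the reading word. *)
Definition tabperm : 'S_n := (perm syt_at_inj)^-1%g.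

Lemma tabpermV x : (tabperm^-1)%g x = val t (box_at x).
Proof. by rewrite invgK permE. Qed.

Lemma tabperm_pos b : tabperm (val t b) = box_pos b.
Proof. by apply: (@perm_inj _ tabperm^-1)%g; rewrite permK tabpermV box_posK. Qed.

Lemma row_of_tabperm i : row_of (val t) i = cell_row (tabperm i).
Proof.
rewrite /row_of; case: pickP => [b /eqP <-|/(_ (box_at (tabperm i)))].
  by rewrite tabperm_pos -row_box_at box_posK.
by rewrite -tabpermV permK eqxx.
Qed.

Lemma tabperm_xset : xset I K tabperm.
Proof.
have /and3P [_ /forallP rowP /forallP colP] := valP t.
apply/xsetP; split=> k kS; rewrite ?ascN /asc !tabpermV.
  have := forallP (colP (box_at (hi k))) (box_at (lo k)).
  rewrite !row_box_at !col_box_at cell_col_hi // eqxx /cell_row steps.2 kS /=.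
  by rewrite ltnSn.
have := forallP (rowP (box_at (lo k))) (box_at (hi k)).
rewrite !row_box_at !col_box_at cell_row_hi // eqxx /cell_col steps.2.
by rewrite (negbTE (KI kS)) kS /= ltnSn.
Qed.
End OneTableau.

Lemma tabperm_inj : injective tabperm.
Proof.
move=> t u E; apply/val_inj/ffunP => b.
by rewrite -(box_posK b) -!tabpermV E.
Qed.

Lemma row_ltW (x y : 'I_n) : (cell_row x < cell_row y)%N -> (x < y)%N.
Proof.
case: (leqP y x) => // yx; have [+ _ _] := cell_mono yx (ltn_ord x); lia.
Qed.

Lemma col_ltW (x y : 'I_n) : (cell_col x < cell_col y)%N -> (x < y)%N.
Proof.
case: (leqP y x) => // yx; have [_ + _] := cell_mono yx (ltn_ord x); lia.
Qed.

Lemma row_chain_lt (w : 'S_n) (x y : 'I_n) : {in K, forall k, asc k w} ->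
  (x < y)%N -> cell_row x = cell_row y -> (w x < w y)%N.
Proof.
move=> wK; apply: (@row_chain (fun a b => (a < b)%N) w cell_row K) => //.
- by move=> a b c; apply: ltn_trans.
- by move=> a b ab bn; have [] := cell_mono ab bn.
- exact: cell_row_K.
Qed.

Lemma col_chain_gt (w : 'S_n) (x y : 'I_n) : {in I, forall k, ~~ asc k w} ->
  (x < y)%N -> cell_col x = cell_col y -> (w y < w x)%N.
Proof.
move=> wI; apply: (@row_chain (fun a b => (b < a)%N) w cell_col I) => //.
- by move=> a b c ba cb; apply: ltn_trans cb ba.
- by move=> a b ab bn; have [] := cell_mono ab bn.
- exact: cell_col_I.
- by move=> k /wI; rewrite ascN.
Qed.

(** Rows and columns are intervals of the reading word, so the conditions at neighbouring boxes
    propagate to all pairs. *)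
Lemma tabperm_surj w : xset I K w -> exists t : SYT n al, tabperm t = w.
Proof.
move=> /xsetP [wI wK]; pose t : filling n al := [ffun b => w^-1%g (box_pos b)].
have st : standard t.
  apply/and3P; split.
  - apply/forallP => i; apply/cards1P; exists (box_at (w i)); apply/setP => b.
    by rewrite !inE ffunE -(can2_eq box_posK box_atK) (canF_eq (permKV w)).
  - apply/forallP => b; apply/forallP => b'; apply/implyP => /andP [/eqP r c].
    rewrite !ffunE; apply: row_chain_lt => //.
      by apply: col_ltW; rewrite -!col_box_at !box_posK.
    by rewrite -!row_box_at !box_posK.
  - apply/forallP => b; apply/forallP => b'; apply/implyP => /andP [/eqP c r].
    rewrite !ffunE; apply: col_chain_gt => //.
      by apply: row_ltW; rewrite -!row_box_at !box_posK.
    by rewrite -!col_box_at !box_posK.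
exists (Sub t st); apply: invg_inj; apply/permP => x.
by rewrite tabpermV SubK ffunE box_atK.
Qed.

Lemma tabperm_desc (t : SYT n al) i :
  (row_of (val t) (hi i) < row_of (val t) (lo i))%N -> ~~ asc i (tabperm t).
Proof. by rewrite !row_of_tabperm => /row_ltW; rewrite ascN. Qed.

Lemma tabperm_row (t : SYT n al) i :
  row_of (val t) (lo i) = row_of (val t) (hi i) ->
  asc i (tabperm t) /\
  exists2 k, k \in K & (adj i * tabperm t = tabperm t * adj k)%g.
Proof.
rewrite !row_of_tabperm; set w := tabperm t => r.
have /xsetP [_ wK] := tabperm_xset t.
have a : asc i w.
  apply/negPn/negP; rewrite ascN => d.
  by have := row_chain_lt wK d (esym r); rewrite !permK /= ltnNge leqnSn.
split=> //.
(* A box strictly between those of i and i+1 in their row would hold an entry strictly between i and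
   i+1. *)
have hlE : w (hi i) = (w (lo i)).+1 :> nat.
  apply/eqP; rewrite eqn_leq [X in _ && X]a andbT leqNgt; apply/negP => lt.
  have xn : ((w (lo i)).+1 < n)%N by apply: leq_trans lt _; apply: ltnW.
  pose x := Ordinal xn.
  have [r1 _ _] := cell_mono (leqnSn (w (lo i))) xn.
  have [r2 _ _] := cell_mono (ltnW lt) (ltn_ord (w (hi i))).
  have rx : cell_row (w (lo i)) = cell_row x by rewrite /=; lia.
  have := row_chain_lt wK (ltnSn _ : (w (lo i) < x)%N) rx.
  have := row_chain_lt wK (lt : (x < w (hi i))%N) (etrans (esym rx) r).
  by rewrite !permK /=; lia.
have kn : (w (lo i) < n.-1)%N by have := ltn_ord (w (hi i)); lia.
pose k := Ordinal kn; have lk : w (lo i) = lo k by apply: val_inj.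
have hk : w (hi i) = hi k by apply: val_inj.
exists k; first by apply: cell_row_K; rewrite -lk -hk.
by rewrite /adj -/(adj i) -lk -hk -adjJ conjgE mulKVg.
Qed.

(** The exchange could spoil the order of two neighbouring boxes only if they hold i and i+1. In a
    column, i would then be above i+1, against the reading order; in a row, their rows would
    coincide. *)
Lemma tabperm_swap (t : SYT n al) i :
  (row_of (val t) (lo i) < row_of (val t) (hi i))%N ->
  asc i (tabperm t) /\
  exists2 u : SYT n al, val u = swap i (val t) & tabperm u = (adj i * tabperm t)%g.
Proof.
rewrite !row_of_tabperm; set w := tabperm t => r.
have a : asc i w by apply: row_ltW.
split=> //; have /xsetP [wI wK] := tabperm_xset t.
have [u uE] : exists u : SYT n al, tabperm u = (adj i * w)%g.
  apply: tabperm_surj; apply/xsetP; rewrite invMg adjV.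
  split=> k kS; rewrite ?ascN /asc !permM; apply: adj_lt.
  - by rewrite -ascN; apply: wI.
  - apply/eqP => -[E1 E2]; have := a; rewrite /asc -E1 -E2 !permKV /=.
    by rewrite ltnNge leqnSn.
  - exact: wK.
  - apply/eqP => -[E1 E2]; move: r; rewrite -E1 -E2 !permKV.
    by rewrite cell_row_hi // ltnn.
exists u => //; apply/ffunP => b.
rewrite ffunE -(box_posK b) -!tabpermV uE invMg adjV permM; congr (adj i _).
Qed.

End TableauPerm.

(** * The tableau modules *)

Section TableauModule.
Variables (F : fieldType) (n : nat) (A : algType F) (D : heckeAlg n A).
Variables (al : seq (seq nat)) (I K : {set 'I_n.-1}).
Hypothesis steps : cell_steps al I K.
Hypothesis KI : {in K, forall k, k \notin I}.
Local Notation V := (tab_space F n al).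

Definition tab_rule (act : A -> V -> V) : Prop :=
  forall (i : 'I_n.-1) (t : SYT n al),
    let r := row_of (val t) (lo i) in
    let r' := row_of (val t) (hi i) in
    [/\ (r' < r)%N -> act (genb D i) (tab_vec F t) = - tab_vec F t,
        r = r' -> act (genb D i) (tab_vec F t) = 0
      & (r < r')%N -> exists2 u : SYT n al, val u = swap i (val t) &
          act (genb D i) (tab_vec F t) = tab_vec F u].

Definition tab_elt (t : SYT n al) : A := basis_w D (tabperm steps t) * yK D K.

Lemma tab_elt_desc i t : (row_of (val t) (hi i) < row_of (val t) (lo i))%N ->
  genb D i * tab_elt t = - tab_elt t.
Proof.
by move=> /(tabperm_desc steps) a; rewrite mulrA basis_mul_desc // mulNr.
Qed.

Lemma tab_elt_row i t : row_of (val t) (lo i) = row_of (val t) (hi i) ->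
  genb D i * tab_elt t = 0.
Proof.
move=> /(tabperm_row steps KI) [a [k kK E]].
exact: genb_basis_row kK a E.
Qed.

Lemma tab_elt_swap i t u : (row_of (val t) (lo i) < row_of (val t) (hi i))%N ->
  val u = swap i (val t) -> genb D i * tab_elt t = tab_elt u.
Proof.
move=> /(tabperm_swap steps KI) [a [u' u'E pE]] uE.
have -> : u = u' by apply: val_inj; rewrite uE u'E.
by rewrite /tab_elt pE mulrA basis_mul_asc.
Qed.

Lemma indep_tab_elt : indep tab_elt.
Proof.
apply: (@indep_basis_yK F n A D _ (tabperm steps) _ I K).
  exact: tabperm_inj.
exact: tabperm_xset.
Qed.

Lemma tab_elt_ideal h : (exists v, lincomb tab_elt v = h) <->
  (exists a, h = a * (xI D I * yK D K)).
Proof.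
apply: lincomb_ideal => [t||i t]; first exact: tabperm_xset.
  exact/tabperm_surj/longest_xset.
case: (ltngtP (row_of (val t) (lo i)) (row_of (val t) (hi i))) => r.
- have [_ [u uE _]] := tabperm_swap steps KI r.
  by exists (delta F u); rewrite lincomb_delta; apply/esym/tab_elt_swap.
- by exists (- delta F t); rewrite raddfN /= lincomb_delta; apply/esym/tab_elt_desc.
- by exists 0; rewrite raddf0; apply/esym/tab_elt_row.
Qed.

(** The rule fixes the generators on basis vectors, so every action obeying it is carried to left
    multiplication by the same embedding; uniqueness and the embedding of the module both follow. *)
Lemma tab_rule_lincomb act : module_action act -> tab_rule act ->
  forall a v, lincomb tab_elt (act a v) = a * lincomb tab_elt v.
Proof.
move=> [linr linl act1 actM] rule.
have actD a u v : act a (u + v) = act a u + act a v.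
  by have := linr a 1 u v; rewrite !scale1r.
have act0 a : act a 0 = 0.
  by have := linr a (-1) 0 0; rewrite !scaleN1r oppr0 addr0 addNr.
have actZ a c v : act a (c *: v) = c *: act a v.
  by have := linr a c v 0; rewrite !addr0 act0 addr0.
have actlD a b v : act (a + b) v = act a v + act b v.
  by have := linl v 1 a b; rewrite !scale1r.
have act0l v : act 0 v = 0.
  by have := linl v (-1) 0 0; rewrite !scaleN1r oppr0 addr0 addNr.
have actlZ c a v : act (c *: a) v = c *: act a v.
  by have := linl v c a 0; rewrite !addr0 act0l addr0.
have base i t : lincomb tab_elt (act (genb D i) (tab_vec F t)) = genb D i * tab_elt t.
  have [d e s] := rule i t.
  case: (ltngtP (row_of (val t) (lo i)) (row_of (val t) (hi i))) => r.
  - by have [u uE ->] := s r; rewrite lincomb_delta (tab_elt_swap r uE).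
  - by rewrite d // raddfN /= lincomb_delta tab_elt_desc.
  - by rewrite e // raddf0 tab_elt_row.
have genP i v : lincomb tab_elt (act (genb D i) v) = genb D i * lincomb tab_elt v.
  rewrite [in LHS](delta_sum v) /lincomb -/(lincomb _ _).
  have -> : act (genb D i) (\sum_x (v x : F) *: delta F x) =
      \sum_x (v x : F) *: act (genb D i) (delta F x).
    by elim/big_rec2: _ => [|x y z _ <-]; rewrite ?act0 // actD actZ.
  rewrite raddf_sum mulr_sumr; apply: eq_bigr => x _ /=.
  by rewrite lincombZ base scalerAr.
move=> a; elim/(@gen_ind _ _ _ D): a => [v|h k IH IH' v|c h IH v|i h IH v].
- by rewrite act1 mul1r.
- by rewrite actlD raddfD /= IH IH' mulrDl.
- by rewrite actlZ lincombZ IH scalerAl.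
- have -> : gen D i * h = h + genb D i * h by rewrite genE mulrDl mul1r.
  by rewrite actlD actM raddfD /= IH genP IH mulrA -[LHS]mulrDl.
Qed.

Lemma tab_rule_exists : exists act, module_action act /\ tab_rule act.
Proof.
have closed (a : A) (v : V) : exists v' : V, lincomb tab_elt v' = a * lincomb tab_elt v.
  apply/tab_elt_ideal.
  have /tab_elt_ideal [b ->] : exists u, lincomb tab_elt u = lincomb tab_elt v.
    by exists v.
  by exists (a * b); rewrite mulrA.
have [act [mact actE]] := transport_action (V := V) (rho := id)
  (fun _ _ _ => erefl) erefl (fun _ _ => erefl) (lincomb_linear tab_elt)
  (indep_inj indep_tab_elt) closed.
exists act; split=> // i t r r'; split=> rr.
- apply: (indep_inj indep_tab_elt); rewrite actE raddfN /= !lincomb_delta.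
  exact: tab_elt_desc.
- apply: (indep_inj indep_tab_elt); rewrite actE raddf0 !lincomb_delta.
  exact: tab_elt_row.
- have [_ [u uE _]] := tabperm_swap steps KI rr; exists u => //.
  apply: (indep_inj indep_tab_elt); rewrite actE !lincomb_delta.
  exact: tab_elt_swap.
Qed.

Lemma tab_rule_unique act act' : module_action act -> tab_rule act ->
  module_action act' -> tab_rule act' -> act = act'.
Proof.
move=> m r m' r'; apply/funext => a; apply/funext => v.
by apply: (indep_inj indep_tab_elt); rewrite !tab_rule_lincomb.
Qed.

Lemma tab_model act (m : module_action act) : tab_rule act ->
  ideal_model (xI D I * yK D K) (act_mod m).
Proof.
move=> r; exists (fun v => lincomb tab_elt (v : V)); split.
- move=> a u v; rewrite -(tab_rule_lincomb m r) -raddfD.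
  by [].
- exact: indep_inj indep_tab_elt.
- exact: tab_elt_ideal.
Qed.

End TableauModule.

(** * Compositions and generalized ribbons *)

Section Compositions.
Local Open Scope nat_scope.
Implicit Types (a b c : seq nat) (al : seq (seq nat)) (x y z r q m : nat).

(** The guard on [a] reflects that the total sum of a composition is not in its descent set. *)
Lemma mem_Dset_cons x a z : (z \in Dset (x :: a)) =
  (a != [::]) && ((z == x) || (x <= z) && (z - x \in Dset a)).
Proof.
case: a => [|y a] //; rewrite /Dset /= inE addn0; case: eqP => //= zx.
rewrite -[1]/(1 + 0) iotaDl -map_comp.
apply/mapP/andP => [[i i_in ->] | [xz /mapP [i i_in E]]].
  rewrite /= leq_addr addKn; split=> //.
  by apply/mapP; exists i.
by exists i => //=; move: E; rewrite add0n /=; lia.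
Qed.

Lemma Dset_bound a z : all (leq 1) a -> z \in Dset a -> 0 < z < sumn a.
Proof.
elim: a z => // x a IH z /= /andP [x0 a0]; rewrite mem_Dset_cons.
case: a IH a0 => // y a IH a0 /=; case: eqP => [->|_] /=.
  by case/andP: a0; lia.
by move=> /andP [xz /(IH _ a0)] /=; lia.
Qed.

Lemma mem_Dset_cat b c z : b != [::] -> c != [::] ->
  (z \in Dset (b ++ c)) =
  [|| z \in Dset b, z == sumn b | (sumn b <= z) && (z - sumn b \in Dset c)].
Proof.
elim: b z => // x b IH z _ c0; rewrite cat_cons !mem_Dset_cons.
case: b IH => [|y b] IH /=; first by rewrite c0 addn0.
rewrite IH //= !subnDA.
by case: (z == x) => //=; case: (z - x \in Dset _); case: (_ \in Dset c); lia.
Qed.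

Lemma near_concat_cons x x' a b : b != [::] ->
  near_concat (x :: x' :: a) b = x :: near_concat (x' :: a) b.
Proof. by case: b. Qed.

Lemma near_concat_neq0 b c : b != [::] -> near_concat b c != [::].
Proof. by case: b => // x b _; case: c => //= y c; case: b. Qed.

Lemma mem_Dset_near b c z : b != [::] -> c != [::] ->
  (z \in Dset (near_concat b c)) =
  (z \in Dset b) || (sumn b <= z) && (z - sumn b \in Dset c).
Proof.
elim: b z => // x b IH z _ c0; case: b IH => [|y b] IH.
  case: c c0 IH => // y c _ _; rewrite /= !mem_Dset_cons /= addn0 !subnDA.
  case: (c == [::]) => /=; first by rewrite andbF.
  by case: (_ \in Dset c); lia.
rewrite near_concat_cons // !(mem_Dset_cons x) near_concat_neq0 //= IH //= !subnDA.
by case: (z == x) => //=; case: (z - x \in Dset _); case: (_ \in Dset c); lia.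
Qed.

Lemma sumn_near b c : sumn (near_concat b c) = sumn b + sumn c.
Proof.
case: b => // x b; elim: b x c => [|x' b IH] x [|y c] //=.
1-3: lia.
by have := IH x' (y :: c); rewrite /= => ->; lia.
Qed.

Lemma all_near b c : all (leq 1) b -> all (leq 1) c -> all (leq 1) (near_concat b c).
Proof.
case: b => // x b; elim: b x c => [|x' b IH] x [|y c] //=.
  by move=> /andP [x0 _] /andP [_ ->]; lia.
move=> /andP [-> b0] c0 /=; exact: (IH x' (y :: c) b0 c0).
Qed.

(** The descent set of the near concatenation of the components, as a recursion on the first
    component; junctions are never descents here. *)
Fixpoint ribbon_descent al z : bool :=
  if al is a :: al' then
    (z \in Dset a) || (sumn a <= z) && ribbon_descent al' (z - sumn a)
  else false.

Definition proper al : bool := all (fun a => (a != [::]) && all (leq 1) a) al.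
Definition total al : nat := sumn (map sumn al).

Lemma ribbon_descent_rcons al c z : ribbon_descent (rcons al c) z =
  ribbon_descent al z || (total al <= z) && (z - total al \in Dset c).
Proof.
elim: al z => [|a al IH] z /=; first by rewrite subn0 andbF orbF.
rewrite IH /total /= !subnDA -/(total al).
case: (z \in Dset a) => //=; case: (ribbon_descent _ _); case: (_ \in Dset c); lia.
Qed.

Lemma total_rcons al c : total (rcons al c) = total al + sumn c.
Proof. by rewrite /total map_rcons sumn_rcons. Qed.

Lemma mem_Dset_foldl al b z : b != [::] -> proper al ->
  (z \in Dset (foldl near_concat b al)) =
  (z \in Dset b) || (sumn b <= z) && ribbon_descent al (z - sumn b).
Proof.
elim: al b => [|a al IH] b b0 /=; first by rewrite andbF orbF.
move=> /andP [/andP [a0 _] pal]; rewrite IH ?near_concat_neq0 //.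
rewrite mem_Dset_near // sumn_near !subnDA.
by case: (z \in Dset b) => //=; case: (_ \in Dset a); case: (ribbon_descent _ _); lia.
Qed.

Lemma mem_Dset_near_concats al z : proper al ->
  (z \in Dset (near_concats al)) = ribbon_descent al z.
Proof.
case: al => // a al /= /andP [/andP [a0 _] pal].
by rewrite mem_Dset_foldl.
Qed.

Lemma sumn_gt0 a : a != [::] -> all (leq 1) a -> 0 < sumn a.
Proof. by case: a => // x a _ /=; lia. Qed.

Lemma ribbon_descent_bound al z : proper al -> ribbon_descent al z -> 0 < z < total al.
Proof.
elim: al z => // a al IH z /= /andP [/andP [a0 ap] pal].
rewrite /total /= -/(total al); case/orP => [/(Dset_bound ap)|]; first by lia.
by move=> /andP [az /(IH _ pal)]; have := sumn_gt0 a0 ap; lia.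
Qed.

Lemma mem_Dset_nseq m z : (z \in Dset (nseq m 1)) = (0 < z < m).
Proof.
elim: m z => [|m IH] z; first by rewrite ltn0 andbF.
rewrite mem_Dset_cons IH; case: m IH => [|m] IH /=; lia.
Qed.

Lemma proper_sums al : proper al -> all (leq 1) (map sumn al).
Proof.
elim: al => //= a al IH /andP [/andP [a0 ap] /IH ->].
by rewrite sumn_gt0.
Qed.

Lemma ribbon_descent_junction al z : proper al -> ribbon_descent al z ->
  z \notin Dset (map sumn al).
Proof.
elim: al z => // a al IH z /= /andP [/andP [a0 ap] pal] rd.
rewrite mem_Dset_cons negb_and negb_or negb_and negbK.
case/orP: rd => [/(Dset_bound ap) za|/andP [az rd]]; first by apply/orP; right; lia.
have := IH _ pal rd; have := ribbon_descent_bound pal rd; lia.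
Qed.

Definition columns al : seq (seq nat) := [seq nseq (sumn a) 1 | a <- al].

Lemma proper_columns al : proper al -> proper (columns al).
Proof.
elim: al => //= a al IH /andP [/andP [a0 ap] /IH ->]; rewrite andbT.
by have := sumn_gt0 a0 ap; case: (sumn a) => // m _ /=; elim: m.
Qed.

(** A column has a descent at each interior position, and near concatenation omits the junctions, so
    J is the complement of the junctions. *)
Lemma ribbon_descent_columns al z : proper al -> 0 < z < total al ->
  ribbon_descent (columns al) z = (z \notin Dset (map sumn al)).
Proof.
elim: al z => [|a al IH] z /=; first by move=> _; rewrite /total /=; lia.
move=> /andP [/andP [a0 ap] pal].
rewrite /total /= -/(total al) => zb.
rewrite mem_Dset_nseq sumn_nseq mul1n mem_Dset_cons negb_and negb_or negb_and negbK.
case: (ltngtP z (sumn a)) => za /=; rewrite ?orbT ?andbT /=.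
- by have -> : 0 < z by lia.
- rewrite andbF IH //; last by lia.
  case: (map sumn al =P [::]) => // E.
  by move: zb; rewrite /total E /=; lia.
- rewrite andbF za subnn /=.
  have -> : ribbon_descent (columns al) 0 = false.
    by apply/negP => /(ribbon_descent_bound (proper_columns pal)).
  by rewrite orbF; apply/esym/eqP => E; move: zb; rewrite /total E /=; lia.
Qed.

Lemma size_ribbon_cells r q a : size (ribbon_cells r q a) = sumn a.
Proof.
by elim: a r q => //= x a IH r q; rewrite size_cat size_map size_iota IH.
Qed.

Lemma size_gribbon_cells r q al : size (gribbon_cells r q al) = total al.
Proof.
elim: al r q => //= a al IH r q.
by rewrite size_cat size_ribbon_cells IH.
Qed.

Lemma ribbon_cells_head r q a : a != [::] -> all (leq 1) a ->
  nth (0, 0) (ribbon_cells r q a) 0 = (r, q).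
Proof. by case: a => [|[|x] a]. Qed.

Lemma size_le_sumn a : all (leq 1) a -> size a <= sumn a.
Proof. by elim: a => //= x a IH /andP [x0 /IH]; lia. Qed.

Lemma ribbon_cells_last r q a : a != [::] -> all (leq 1) a ->
  nth (0, 0) (ribbon_cells r q a) (sumn a).-1 =
  (r + (size a).-1, q + (sumn a - size a)).
Proof.
elim: a r q => // x a IH r q _ /= /andP [x0 ap].
rewrite nth_cat size_map size_iota; case: a IH ap => [|y a] IH ap.
  rewrite addn0 ifT; last by lia.
  rewrite (nth_map 0) ?size_iota ?nth_iota; try lia.
  by congr pair; rewrite /=; lia.
have yp := sumn_gt0 (isT : (y :: a) != [::]) ap.
have sz := size_le_sumn ap.
rewrite ifF; last by lia.
have -> : (x + sumn (y :: a)).-1 - x = (sumn (y :: a)).-1 by lia.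
rewrite IH //; congr pair; rewrite /= in sz *; lia.
Qed.

Lemma ribbon_cells_step r q a z : all (leq 1) a -> z.+1 < sumn a ->
  let b := nth (0, 0) (ribbon_cells r q a) z in
  nth (0, 0) (ribbon_cells r q a) z.+1 =
  if z.+1 \in Dset a then (b.1.+1, b.2) else (b.1, b.2.+1).
Proof.
elim: a r q z => // x a IH r q z /= /andP [x0 ap] zx.
rewrite !nth_cat size_map size_iota mem_Dset_cons.
case: (ltngtP z.+1 x) => zx1 /=.
- rewrite andbF !(nth_map 0) ?size_iota ?nth_iota //; try lia.
  by rewrite addnS.
- have a0 : a != [::] by case: a zx {IH ap} => //=; lia.
  by rewrite a0 /= subSn ?IH //; lia.
- have a0 : a != [::] by case: a zx {IH ap} => //=; lia.
  rewrite a0 /= -zx1 subnn ribbon_cells_head // (nth_map 0) ?size_iota ?nth_iota; try lia.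
  by [].
Qed.

Lemma gribbon_cells_step r q al z : proper al -> z.+1 < total al ->
  let b := nth (0, 0) (gribbon_cells r q al) z in
  nth (0, 0) (gribbon_cells r q al) z.+1 =
  if ribbon_descent al z.+1 then (b.1.+1, b.2)
  else if z.+1 \in Dset (map sumn al) then (b.1.+1, b.2.+1)
  else (b.1, b.2.+1).
Proof.
elim: al r q z => [|a al IH] r q z; first by rewrite /total /=.
move=> /= /andP [/andP [a0 ap] pal].
rewrite /total /= -/(total al) => zt.
rewrite !nth_cat size_ribbon_cells mem_Dset_cons.
have za_D : sumn a <= z.+1 -> z.+1 \in Dset a = false.
  by move=> az; apply/negP => /(Dset_bound ap); lia.
case: (ltngtP z.+1 (sumn a)) => za /=.
- by rewrite andbF orbF ribbon_cells_step.
- rewrite za_D ?(ltnW za) //= subSn // IH //; last by lia.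
  case: (map sumn al =P [::]) => // E.
  by move: zt; rewrite /total E /=; lia.
(* Junction: z is the last box of [a], and the next box opens the following component. *)
- have al0 : al != [::] by case: al zt {IH pal} => //=; rewrite /total /=; lia.
  rewrite za_D ?za // subnn.
  have -> : ribbon_descent al 0 = false.
    by apply/negP => /(ribbon_descent_bound pal).
  have -> : map sumn al != [::] by case: al al0 {zt IH pal}.
  have -> : z = (sumn a).-1 by lia.
  rewrite ribbon_cells_last //=; case: al al0 pal {IH zt} => // b al _.
  move=> /= /andP [/andP [b0 bp] _].
  rewrite nth_cat size_ribbon_cells sumn_gt0 // ribbon_cells_head //.
  have := size_le_sumn ap; have : 0 < size a by case: a a0 {ap za za_D}.
  by move=> ??; congr pair; lia.
Qed.

Lemma brackets_rcons a al c : brackets (a :: rcons al c) =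
  flatten [seq [:: b ++ c; near_concat b c] | b <- brackets (a :: al)].
Proof. by rewrite /= foldl_rcons. Qed.

Lemma mem_brackets_rcons a al c b : b \in brackets (a :: rcons al c) ->
  exists2 b', b' \in brackets (a :: al) & b = b' ++ c \/ b = near_concat b' c.
Proof.
rewrite brackets_rcons => /flatten_mapP [b' b'in].
by rewrite !inE => /orP [] /eqP ->; exists b'; auto.
Qed.

Lemma brackets_comp al b : al != [::] -> proper al -> b \in brackets al ->
  [/\ b != [::], all (leq 1) b & sumn b = total al].
Proof.
case: al => // a al _; elim/last_ind: al b => [|al c IH] b.
  rewrite /= inE andbT => /andP [a0 ap] /eqP ->.
  by rewrite /total /= addn0.
rewrite -rcons_cons /proper all_rcons => /andP [/andP [c0 cp] pal].
move=> /mem_brackets_rcons [b' /(IH _ pal) [b0 bp bs]].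
rewrite total_rcons -bs; case=> ->; split.
- by case: b' b0 {bp bs}.
- by rewrite all_cat bp.
- by rewrite sumn_cat.
- exact: near_concat_neq0.
- exact: all_near.
- exact: sumn_near.
Qed.

Lemma mem_Dset_rcons a x z : a != [::] ->
  (z \in Dset (rcons a x)) = (z \in Dset a) || (z == sumn a).
Proof. by move=> a0; rewrite -cats1 mem_Dset_cat //= /Dset /= in_nil andbF orbF. Qed.

(** Each member of the bracket decides at every junction whether it becomes a descent, and changes
    nothing elsewhere. *)
Lemma brackets_descents al b z : al != [::] -> proper al -> b \in brackets al ->
  (ribbon_descent al z -> z \in Dset b) /\
  (z \in Dset b -> ribbon_descent al z || (z \in Dset (map sumn al))).
Proof.
case: al => // a al _; elim/last_ind: al b => [|al c IH] b.
  rewrite [proper _]/= [brackets _]/= inE andbT => /andP [a0 ap] /eqP ->.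
  by split=> [|za]; rewrite /= ?za // andbF orbF.
move=> p; have := p; rewrite -rcons_cons /proper all_rcons => /andP [/andP [c0 cp] pal].
move=> /mem_brackets_rcons [b' b'in bE].
have [b0 bp bs] := brackets_comp (isT : a :: al != [::]) pal b'in.
have [IH1 IH2] := IH _ pal b'in.
rewrite map_rcons mem_Dset_rcons // ribbon_descent_rcons -/(total (a :: al)) -bs.
case: bE => ->; rewrite ?mem_Dset_cat ?mem_Dset_near //; split.
- by case/orP => [/IH1 -> //|->]; rewrite !orbT.
- case/or3P => [/IH2|->|->]; rewrite ?orbT //.
  by case/orP => ->; rewrite ?orbT.
- by case/orP => [/IH1 -> //|->]; rewrite !orbT.
- case/orP => [/IH2|->]; rewrite ?orbT //.
  by case/orP => ->; rewrite ?orbT.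
Qed.

Lemma brackets_exists al (P : pred nat) : al != [::] -> proper al ->
  (forall z, ribbon_descent al z -> P z) ->
  (forall z, 0 < z < total al -> P z ->
     ribbon_descent al z || (z \in Dset (map sumn al))) ->
  exists2 b, b \in brackets al & forall z, 0 < z < total al -> (z \in Dset b) = P z.
Proof.
case: al => // a al _; elim/last_ind: al => [|al c IH].
  rewrite [proper _]/= andbT => /andP [a0 ap] lo_P hi_P.
  exists a; first by rewrite /= mem_head.
  move=> z zb; apply/idP/idP => [za|/(hi_P _ zb)].
    by apply: lo_P; rewrite /= za.
  by rewrite /= andbF orbF => /orP [//|]; rewrite mem_Dset_cons.
move=> p; have := p; rewrite -rcons_cons /proper all_rcons => /andP [/andP [c0 cp] pal].
set al1 := a :: al in pal *.
have m0 : 0 < sumn c by exact: sumn_gt0.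
have s0 : map sumn al1 != [::] by [].
move=> lo_P hi_P.
case: IH => [//|z rz|z zb Pz|b b_in bP].
- by apply: lo_P; rewrite ribbon_descent_rcons rz.
- have := hi_P z; rewrite total_rcons map_rcons mem_Dset_rcons // -/(total al1).
  rewrite ribbon_descent_rcons -/al1 => H; rewrite -/al1 in zb.
  have [z0 zt] := andP zb.
  have zc : 0 < z < total al1 + sumn c by rewrite z0 ltn_addr.
  have := H zc Pz.
  by rewrite [total al1 <= z]leqNgt zt /= orbF (ltn_eqF zt) orbF.
have [b0 bp bs] := brackets_comp (isT : al1 != [::]) pal b_in.
(* Treats both ways of attaching [c] at once; they differ only at the last junction, where the value
   of [P] selects one. *)
have key op : (forall z, (z \in Dset op) = (z \in Dset b) ||
     ((z == total al1) && P z) || (total al1 <= z) && (z - total al1 \in Dset c)) ->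
   forall z, 0 < z < total (rcons al1 c) -> (z \in Dset op) = P z.
  move=> opE z zb; rewrite opE.
  have zP := hi_P z zb.
  have lzP : ribbon_descent (rcons al1 c) z -> P z by apply: lo_P.
  rewrite map_rcons mem_Dset_rcons // -/(total al1) ribbon_descent_rcons in zP lzP.
  rewrite total_rcons in zb.
  have D0 : z \in Dset b -> 0 < z < total al1 by rewrite -bs; apply: Dset_bound.
  have R0 : ribbon_descent al1 z -> 0 < z < total al1 by apply: ribbon_descent_bound.
  have S0 : z \in Dset (map sumn al1) -> 0 < z < total al1.
    by apply: Dset_bound; apply: proper_sums.
  have Dz : 0 < z < total al1 -> (z \in Dset b) = P z by apply: bP.
  have F0 (x : bool) : (x -> 0 < z < total al1) -> total al1 <= z -> x = false.
    by case: x => // /(_ isT) /andP [_]; rewrite ltnNge => /negbTE ->.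
  have [zm|zm|zm] := ltngtP z (total al1); rewrite ?orbF ?andbF /=.
  - by apply: Dz; rewrite zm andbT; case/andP: zb.
  - rewrite (F0 _ D0 (ltnW zm)) /=; apply/idP/idP => [cz|Pz].
      by apply: lzP; rewrite cz (ltnW zm) orbT.
    move: (zP Pz); rewrite (F0 _ R0 (ltnW zm)) (F0 _ S0 (ltnW zm)) /=.
    by rewrite (gtn_eqF zm) orbF => /andP [].
  - rewrite (F0 _ D0) ?zm // subnn /=.
    have -> : (0 \in Dset c) = false by apply/negP => /(Dset_bound cp).
    by rewrite orbF.
case Pm: (P (total al1)).
  exists (b ++ c).
    rewrite brackets_rcons; apply/flatten_mapP; exists b => //.
    by rewrite mem_head.
  apply: key => z; rewrite mem_Dset_cat // bs orbA; congr (_ || _ || _).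
  by case: eqP => // ->; rewrite Pm.
exists (near_concat b c).
  rewrite brackets_rcons; apply/flatten_mapP; exists b => //.
  by rewrite !inE eqxx orbT.
apply: key => z; rewrite mem_Dset_near // bs; congr (_ || _).
by case: eqP => [->|]; rewrite ?Pm orbF.
Qed.

Lemma brackets_Dset_inj al b b' : al != [::] -> proper al ->
  b \in brackets al -> b' \in brackets al ->
  (forall z, 0 < z < total al -> (z \in Dset b) = (z \in Dset b')) -> b = b'.
Proof.
case: al => // a al _; elim/last_ind: al b b' => [|al c IH] b b'.
  by rewrite /= !inE => _ /eqP -> /eqP ->.
move=> p; have := p; rewrite -rcons_cons /proper all_rcons => /andP [/andP [c0 cp] pal].
set al1 := a :: al in pal *.
move=> /mem_brackets_rcons [b1 b1in bE] /mem_brackets_rcons [b1' b1'in b'E] E.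
have [b0 bp bs] := brackets_comp (isT : al1 != [::]) pal b1in.
have [b0' bp' bs'] := brackets_comp (isT : al1 != [::]) pal b1'in.
have m0 := sumn_gt0 c0 cp.
have m1 : 0 < total al1 by rewrite -bs sumn_gt0.
have D0 : (0 \in Dset c) = false by apply/negP => /(Dset_bound cp).
have Dm b2 : sumn b2 = total al1 -> all (leq 1) b2 -> (total al1 \in Dset b2) = false.
  by move=> s2 p2; apply/negP => /(Dset_bound p2); rewrite s2 ltnn andbF.
rewrite total_rcons in E.
have bb : b1 = b1'.
  apply: IH => // z; rewrite -/al1 => zb; have [z0 zt] := andP zb.
  have zc : 0 < z < total al1 + sumn c by rewrite z0 ltn_addr.
  have nz : (total al1 <= z) = false by rewrite leqNgt zt.
  have := E z zc.
  by case: bE b'E => -> [] ->; rewrite ?mem_Dset_cat ?mem_Dset_near //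
    bs bs' nz ?(ltn_eqF zt) /= ?orbF.
have := E (total al1); rewrite m1 -[X in X < _]addn0 ltn_add2l m0 => /(_ isT).
rewrite -bb in b'E *.
by case: bE b'E => -> [] ->; rewrite ?mem_Dset_cat ?mem_Dset_near // bs ?eqxx subnn D0
  (Dm _ bs bp) leqnn.
Qed.

End Compositions.

(** * The direct sum *)

Section Bridge.
Variable n : nat.
Implicit Types (al : seq (seq nat)) (b : seq nat).

Definition desc_set al : {set 'I_n.-1} := descents n (near_concats al).
Definition col_set al : {set 'I_n.-1} := descents n (near_concats (columns al)).
Definition row_set al : {set 'I_n.-1} := col_set al :\: desc_set al.

Lemma gribbon_proper al : is_gribbon n al -> [/\ al != [::], proper al & total al = n].
Proof. by case/and3P => ? ? /eqP. Qed.

Lemma in_desc_set al (k : 'I_n.-1) : proper al ->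
  (k \in desc_set al) = ribbon_descent al k.+1.
Proof. by move=> pal; rewrite inE mem_Dset_near_concats. Qed.

Lemma ord_pred_bound (k : 'I_n.-1) : (0 < k.+1 < n)%N.
Proof. by have := ltn_ord k; lia. Qed.

Lemma in_col_set al (k : 'I_n.-1) : proper al -> total al = n ->
  (k \in col_set al) = (k.+1 \notin Dset (map sumn al)).
Proof.
move=> pal tal; rewrite inE mem_Dset_near_concats; last exact: proper_columns.
by rewrite ribbon_descent_columns // tal ord_pred_bound.
Qed.

Lemma row_set_disjoint al : {in row_set al, forall k, k \notin desc_set al}.
Proof. by move=> k; rewrite inE => /andP []. Qed.

Lemma desc_set_col al : proper al -> total al = n ->
  {subset desc_set al <= col_set al}.
Proof.
move=> pal tal k; rewrite in_desc_set // in_col_set //.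
exact: ribbon_descent_junction.
Qed.

Lemma gribbon_steps al : is_gribbon n al ->
  cell_steps al (desc_set al) (row_set al).
Proof.
case/gribbon_proper => _ pal tal; split=> [|k]; first by rewrite size_gribbon_cells.
rewrite gribbon_cells_step // ?tal; last by case/andP: (ord_pred_bound k).
rewrite in_setD in_desc_set // in_col_set //.
by case: (ribbon_descent al k.+1) => //=; case: (_ \in _).
Qed.

Lemma comp_steps b : is_comp n b ->
  cell_steps [:: b] (descents n b) (~: descents n b).
Proof.
(* The empty composition, for n = 0, is not a generalized ribbon; the step condition is then
   vacuous. *)
case: (eqVneq b [::]) => [-> /andP [_ /eqP n0]|b0 /andP [bp /eqP bs]].
  split=> [//|k]; exfalso; have := ltn_ord k.
  by move: (nat_of_ord k) => m; rewrite -n0.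
have g : is_gribbon n [:: b] by rewrite /is_gribbon /= b0 bp addn0 bs eqxx.
have [_ pb tb] := gribbon_proper g.
have -> : ~: descents n b = row_set [:: b]; last exact: gribbon_steps g.
apply/setP => k; rewrite in_setC in_setD in_col_set // /desc_set /=.
by case: (k \in _).
Qed.

Section Brackets.
Variable al : seq (seq nat).
Hypothesis g : is_gribbon n al.

Lemma brackets_is_comp b : b \in brackets al -> is_comp n b.
Proof.
have [al0 pal tal] := gribbon_proper g.
by move=> /(brackets_comp al0 pal) [_ bp bs]; rewrite /is_comp bp bs tal eqxx.
Qed.

Lemma brackets_sub b : b \in brackets al ->
  {subset desc_set al <= descents n b}.
Proof.
have [al0 pal tal] := gribbon_proper g.
move=> bin k; rewrite in_desc_set // inE.
exact: (brackets_descents k.+1 al0 pal bin).1.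
Qed.

Lemma brackets_row b : b \in brackets al ->
  {in row_set al, forall k, k \notin descents n b}.
Proof.
have [al0 pal tal] := gribbon_proper g.
move=> bin k; rewrite in_setD in_desc_set // in_col_set // inE => /andP [rk dk].
by apply/negP => /(brackets_descents k.+1 al0 pal bin).2; rewrite (negbTE rk) (negbTE dk).
Qed.

Lemma brackets_set (E : {set 'I_n.-1}) : {subset desc_set al <= E} ->
  {in row_set al, forall k, k \notin E} ->
  exists2 b, b \in brackets al & descents n b = E.
Proof.
have [al0 pal tal] := gribbon_proper g.
(* Generator k stands for position [k.+1]; only positions strictly between 0 and n are tested, so
   other values are arbitrary. *)
move=> dE rE; pose P z := if insub z.-1 is Some k then k \in E else false.
have PE (k : 'I_n.-1) : P k.+1 = (k \in E) by rewrite /P /= valK.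
have ordz z : (0 < z < total al)%N -> exists k : 'I_n.-1, z = k.+1.
  rewrite tal => /andP [z0 zn]; have kn : (z.-1 < n.-1)%N by lia.
  by exists (Ordinal kn); rewrite /= prednK.
have [z rz|z zb|b bin bE] := brackets_exists (P := P) al0 pal.
- have [k zk] := ordz _ (ribbon_descent_bound pal rz).
  by rewrite zk PE; apply: dE; rewrite in_desc_set // -zk.
- have [k zk] := ordz _ zb; rewrite zk PE => kE; apply/norP => -[rk dk].
  by have := rE k; rewrite in_setD in_desc_set // in_col_set // rk dk kE => /(_ isT).
exists b => //; apply/setP => k; rewrite inE bE ?PE //.
by rewrite tal ord_pred_bound.
Qed.

Lemma brackets_set_inj b b' : b \in brackets al -> b' \in brackets al ->
  descents n b = descents n b' -> b = b'.
Proof.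
have [al0 pal tal] := gribbon_proper g.
move=> bin bin' /setP E; apply: (brackets_Dset_inj al0 pal bin bin') => z.
rewrite tal => /andP [z0 zn]; have kn : (z.-1 < n.-1)%N by lia.
by have := E (Ordinal kn); rewrite !inE /= prednK.
Qed.
End Brackets.
End Bridge.

Section DirectSumModel.
Variables (F : fieldType) (n : nat) (A : algType F) (D : heckeAlg n A).
Variables (al : seq (seq nat)) (g : is_gribbon n al).
Local Notation I := (desc_set n al).
Local Notation K := (row_set n al).
Local Notation Br := (seq_sub (brackets al)).
Local Notation V b := (tab_space F n [:: val b]).
Variable act : forall b : Br, A -> V b -> V b.
Hypothesis actM : forall b, module_action (@act b).
Hypothesis actR : forall b, tab_rule D (@act b).

Local Notation stepsb b := (comp_steps (brackets_is_comp g (valP b))).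
Local Notation Db b := (descents n (val b)).
Local Notation z := (xI D I * yK D K).
Let T : finType := {b : Br & SYT n [:: val b]}.
Let tg (b : Br) (t : SYT n [:: val b]) : T :=
  existT (fun b : Br => Finite.sort (SYT n [:: val b])) b t.
Let p (x : T) : 'S_n := tabperm (stepsb (tag x)) (tagged x).
Let e (x : T) : A := tab_elt D (stepsb (tag x)) (tagged x) * z.

Let Db_disjoint (b : Br) : {in ~: Db b, forall k, k \notin Db b}.
Proof. by move=> k; rewrite inE. Qed.

Let p_xset (x : T) : xset (Db (tag x)) (~: Db (tag x)) (p x).
Proof. exact/tabperm_xset/Db_disjoint. Qed.

(** The right descent set of the permutation is exactly that of beta, and beta is determined by it
    within the bracket; the tableau is then determined too. *)
Let p_inj : injective p.
Proof.
move=> [b t] [b' t'] E.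
have bb : b = b'.
  apply/val_inj/(brackets_set_inj g (valP b) (valP b'))/setP => k.
  have /xsetP [x1 x2] := p_xset (tg t).
  have /xsetP [y1 y2] := p_xset (tg t').
  apply/idP/idP => kb; apply/negPn/negP => kb'.
    by have := x1 k kb; rewrite E y2 // inE.
  by have := y1 k kb; rewrite -E x2 // inE.
subst b'; congr (existT _ b _); exact: tabperm_inj E.
Qed.

Let p_xset_al (x : T) : xset I K (p x).
Proof.
have /xsetP [x1 x2] := p_xset x; apply/xsetP; split=> k kS.
  by apply: x1; apply: (brackets_sub g (valP (tag x))).
by apply: x2; rewrite inE; apply: (brackets_row g (valP (tag x))).
Qed.

Let e_indep : indep e.
Proof.
apply: (@indep_basis_mul F n A D T p p_inj I K (fun x => ~: Db (tag x))).
  exact: p_xset_al.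
by move=> x; have /xsetP [] := p_xset x.
Qed.

(** For the converse inclusion, match each tableau of alpha with a tableau of some beta having the
    same permutation. The selected products form an independent family indexed by the tableaux of
    alpha inside H x y, so [indep_span] applies. *)
Let e_image h : (exists v, lincomb e v = h) <-> (exists a, h = a * z).
Proof.
have steps := gribbon_steps g; have KI := @row_set_disjoint n al.
split=> [[v <-]|hz].
  exists (\sum_x (v x : F) *: tab_elt D (stepsb (tag x)) (tagged x)).
  by rewrite mulr_suml; apply: eq_bigr => x _; rewrite scalerAl.
have ex (t : SYT n al) : exists x : T, p x = tabperm steps t.
  have /xsetP [t1 t2] := tabperm_xset steps KI t.
  (* The right descents of the permutation contain I and avoid K, so they form the descent set of
     some beta. *)
  pose E := [set k : 'I_n.-1 | ~~ asc k (tabperm steps t)^-1%g].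
  have [k kI|k kK|b bin bE] := brackets_set (E := E) g.
  - by rewrite inE t1.
  - by rewrite inE t2.
  have [|t' t'E] := @tabperm_surj n [:: b] _ _ (stepsb (SeqSub bin)) (tabperm steps t).
    apply/xsetP; rewrite /= bE; split=> k; rewrite ?inE //.
    by rewrite negbK.
  by exists (tg (t' : SYT n [:: val (SeqSub bin)])).
pose e' (t : SYT n al) := e (sval (cid (ex t))).
have e'_indep : indep e'.
  pose q (t : SYT n al) := sval (cid (ex t)).
  have qE t : p (q t) = tabperm steps t by rewrite /q; case: cid.
  have qI : injective (fun t => p (q t)) by move=> t t'; rewrite !qE => /tabperm_inj.
  apply: (@indep_basis_mul F n A D _ _ qI I K (fun t => ~: Db (tag (q t)))).
    by move=> t; apply: p_xset_al.
  by move=> t; have /xsetP [] := p_xset (q t).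
have [u <-] := (tab_elt_ideal D steps KI h).2 hz.
have [t|v <-] := indep_span e'_indep (f := tab_elt D steps) _ u.
  apply/(tab_elt_ideal D steps KI).
  by exists (tab_elt D (stepsb (tag (sval (cid (ex t))))) (tagged (sval (cid (ex t))))).
exists (\sum_t (v t : F) *: delta F (sval (cid (ex t)))).
rewrite raddf_sum; apply: eq_bigr => t _ /=.
by rewrite lincombZ lincomb_delta.
Qed.

Lemma dsum_model : ideal_model z (dsum (fun b : Br => act_mod (actM b))).
Proof.
pose U b : lmodType A := act_mod (actM b).
pose coef (v : dsum U) : {ffun T -> F^o} :=
  [ffun x : T => ((v : {dffun forall b, U b}) (tag x) : V (tag x)) (tagged x)].
have coefE v : lincomb e (coef v) =
    \sum_b lincomb (tab_elt D (stepsb b)) ((v : {dffun forall b, U b}) b) * z.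
  rewrite /lincomb.
  under [RHS]eq_bigr do rewrite mulr_suml.
  rewrite (sig_big_dep (fun=> true) (fun _ _ => true)
    (fun b t => ((v : {dffun forall b, U b}) b : V b) t *: tab_elt D (stepsb b) t * z)) /=.
  by apply: eq_bigr => -[b t] _; rewrite ffunE /= scalerAl.
exists (fun v => lincomb e (coef v)); split.
- move=> a u v; rewrite !coefE mulr_sumr -big_split; apply: eq_bigr => b _ /=.
  rewrite !ffunE.
  rewrite -[a *: (_ : U b)]/(@act b a _) raddfD /=.
  by rewrite (tab_rule_lincomb _ (@Db_disjoint b) (actM b) (@actR b)) mulrDl -(mulrA a).
- move=> u v /(indep_inj e_indep)/ffunP E; apply/ffunP => b; apply/ffunP => t.
  by have := E (tg t); rewrite !ffunE.
move=> h; rewrite -e_image; split=> -[v <-]; first by exists (coef v).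
exists ([ffun b => [ffun t => v (tg t)] : U b] : {dffun forall b, U b}).
congr lincomb; apply/ffunP => -[b t].
by rewrite !ffunE.
Qed.

End DirectSumModel.

(** * Tensor products and induced modules *)

Section Multilinear.
Variables (F : fieldType) (I : finType) (S : I -> finType).
Local Notation V i := ({ffun S i -> F^o} : lmodType F).
Local Notation tup := {dffun forall i : I, V i}.
Local Notation idx := {dffun forall i : I, S i}.
Implicit Types (u : tup) (t : idx) (W : lmodType F).

Lemma tup_set_eq u i (x : V i) : tup_set u x i = x.
Proof. by rewrite ffunE dfwith_in. Qed.

Lemma tup_set_neq u i (x : V i) j : i != j -> tup_set u x j = u j.
Proof. by move=> ij; rewrite ffunE dfwith_out. Qed.

Lemma tup_set_id u i : tup_set u (u i) = u.
Proof.
apply/ffunP => j; have [<-|ij] := eqVneq i j; first by rewrite tup_set_eq.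
by rewrite tup_set_neq.
Qed.

Lemma tup_set_set u i (x y : V i) : tup_set (tup_set u x) y = tup_set u y.
Proof.
apply/ffunP => j; have [<-|ij] := eqVneq i j; first by rewrite !tup_set_eq.
by rewrite !tup_set_neq.
Qed.

Lemma tup_setC u i j (x : V i) (y : V j) : i != j ->
  tup_set (tup_set u x) y = tup_set (tup_set u y) x.
Proof.
move=> ij; apply/ffunP => k; have [<-|jk] := eqVneq j k.
  by rewrite tup_set_eq tup_set_neq // tup_set_eq.
rewrite (tup_set_neq _ _ jk); have [<-|ik] := eqVneq i k; first by rewrite !tup_set_eq.
by rewrite !tup_set_neq.
Qed.

Definition multilinear W (M : tup -> W) : Prop :=
  forall u i (c : F) (x y : V i),
    M (tup_set u (c *: x + y)) = c *: M (tup_set u x) + M (tup_set u y).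

Definition basis_tup t : tup := [ffun i => delta F (t i) : V i].

Lemma multilinear0 W (M : tup -> W) u i : multilinear M -> M (tup_set u (0 : V i)) = 0.
Proof.
move=> mM; have := mM u i (-1) 0 0; rewrite scaler0 addr0 scaleN1r addNr.
by [].
Qed.

Lemma multilinearD W (M : tup -> W) u i (x y : V i) : multilinear M ->
  M (tup_set u (x + y)) = M (tup_set u x) + M (tup_set u y).
Proof. by move=> mM; have := mM u i 1 x y; rewrite !scale1r. Qed.

Lemma multilinear_sum W (M : tup -> W) u i (x : V i) : multilinear M ->
  M (tup_set u x) = \sum_s (x s : F) *: M (tup_set u (delta F s)).
Proof.
move=> mM; rewrite {1}(delta_sum x).
elim/big_rec2: _ => [|s y z _ <-]; first exact: multilinear0.
exact: mM.
Qed.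

(** Induction on a list [r] of the components not yet known to be basis vectors, expanding one of
    them at a time. *)
Lemma multilinear_ext W (M M' : tup -> W) : multilinear M -> multilinear M' ->
  (forall t, M (basis_tup t) = M' (basis_tup t)) -> M =1 M'.
Proof.
move=> mM mM' E u.
suff H (r : seq I) : forall u, (forall i, i \notin r -> exists s, u i = delta F s) ->
    M u = M' u by apply: (H (enum I)) => i; rewrite mem_enum.
elim: r => [|i r IH] {}u bu.
  pose t : idx := [ffun i => sval (cid (bu i isT))].
  have -> : u = basis_tup t; last exact: E.
  by apply/ffunP => i; rewrite !ffunE; case: cid.
rewrite -(tup_set_id u i) (multilinear_sum _ _ mM) (multilinear_sum _ _ mM').
apply: eq_bigr => s _; congr (_ *: _); apply: IH => j jr.
have [<-|ij] := eqVneq i j; first by exists s; rewrite tup_set_eq.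
by rewrite tup_set_neq //; apply: bu; rewrite inE negb_or eq_sym ij.
Qed.

Definition mlin W (e : idx -> W) u : W := \sum_(t : idx) (\prod_i (u i (t i) : F)) *: e t.

Lemma mlin_multilinear W (e : idx -> W) : multilinear (mlin e).
Proof.
have prodE u i (x : V i) t : \prod_j (tup_set u x j (t j) : F) =
    (x (t i) : F) * \prod_(j | j != i) (u j (t j) : F).
  rewrite (bigD1 i) //= tup_set_eq; congr (_ * _); apply: eq_bigr => j.
  by rewrite eq_sym => ij; rewrite tup_set_neq.
move=> u i c x y; rewrite /mlin scaler_sumr -big_split; apply: eq_bigr => t _ /=.
by rewrite scalerA -scalerDl !prodE !ffunE mulrDl mulrA.
Qed.

Lemma mlin_basis W (e : idx -> W) t : mlin e (basis_tup t) = e t.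
Proof.
rewrite /mlin (bigD1 t) //= [X in _ + X]big1 ?addr0.
  by rewrite big1 ?scale1r // => i _; rewrite !ffunE eqxx.
move=> t' t't; have [i ti] : exists i, t' i != t i.
  apply/existsP; apply: contraNT t't; rewrite negb_exists => /forallP E.
  by apply/eqP/ffunP => i; apply/eqP/negPn/E.
by rewrite (bigD1 i) //= !ffunE (negbTE ti) mul0r scale0r.
Qed.

Local Notation out := (tensor (fun i => V i)).

Lemma submod_pi_linear (R : pzRingType) (U : lmodType R) (G : U -> Prop) :
  linear (submod_pi G).
Proof. by move=> c x y; rewrite submod_piD -submod_scale_pi. Qed.

Lemma submod_pi0 (R : pzRingType) (U : lmodType R) (G : U -> Prop) :
  submod_pi G 0 = 0.
Proof. exact: raddf0. Qed.

Lemma pure_multilinear : multilinear (@pure_tensor F I (fun i => V i)).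
Proof.
move=> u i c x y; rewrite /pure_tensor -submod_pi_linear.
apply/submod_piE; apply/asboolP => P _ GP; rewrite opprD addrA; apply: GP.
exact: TensorRel.
Qed.

Lemma pure_mlin u :
  pure_tensor u = mlin (fun t => pure_tensor (basis_tup t) : out) u.
Proof.
apply: multilinear_ext; [exact: pure_multilinear | exact: mlin_multilinear |].
by move=> t; rewrite mlin_basis.
Qed.

Lemma tensor_span (z : out) : exists v : {ffun idx -> F^o},
  z = lincomb (fun t => pure_tensor (basis_tup t) : out) v.
Proof.
case: (submod_piP z) => g ->; rewrite (monalgE g).
elim/big_ind: _ => [|x y [v vE] [v' v'E]|u _].
- by exists 0; rewrite raddf0; apply: submod_pi0.
- by exists (v + v'); rewrite submod_piD vE v'E raddfD.
have -> : << mcoeff u g *g u >> = mcoeff u g *: << u >> :> {malg F[tup]}.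
  apply/malgP => k.
  rewrite mcoeffZ.
  rewrite [in RHS]mcoeffU.
  rewrite mcoeffU.
  by rewrite mulr_natr.
pose c : {ffun idx -> F^o} := [ffun t : idx => \prod_i (u i (t i) : F)].
exists ((mcoeff u g : F) *: c).
rewrite lincombZ -submod_scale_pi; congr (_ *: _).
rewrite -[submod_pi _ _]/(pure_tensor u) pure_mlin /mlin /lincomb.
by apply: eq_bigr => t _; rewrite ffunE.
Qed.

(** Universal property: multilinearity places the tensor relations in the kernel of the linear
    extension [G0] of [M] to formal sums. *)
Lemma tensor_lift W (M : tup -> W) : multilinear M ->
  exists G : out -> W, linear G /\ forall u, G (pure_tensor u) = M u.
Proof.
move=> mM; pose G0 (g : {malg F[tup]}) : W := \sum_(u <- msupp g) mcoeff u g *: M u.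
have G0w g (d : {fset tup}) : (msupp g `<=` d)%fset ->
    G0 g = \sum_(u <- d) mcoeff u g *: M u.
  move=> le; rewrite [LHS](big_fset_incl _ le) => //= x xd /mcoeff_outdom ->.
  by rewrite scale0r.
have G0l : linear G0.
  move=> c g h; pose d := (msupp (c *: g + h) `|` (msupp g `|` msupp h))%fset.
  rewrite !(@G0w _ d); first last.
  - exact: fsubsetUl.
  - by apply: fsubset_trans (fsubsetUr _ _); apply: fsubsetUl.
  - by apply: fsubset_trans (fsubsetUr _ _); apply: fsubsetUr.
  rewrite scaler_sumr -big_split; apply: eq_bigr => m _ /=.
  by rewrite mcoeffD mcoeffZ scalerDl scalerA.
have G0U u : G0 << u >> = M u.
  by rewrite (G0w _ _ msuppU_le) big_seq_fset1 mcoeffUU scale1r.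
have G00 : G0 0 = 0 by rewrite /G0 msupp0 big_seq_fset0.
have G0B g h : G0 (g - h) = G0 g - G0 h.
  by rewrite [g - h]addrC; have := G0l (-1) h g; rewrite !scaleN1r => ->; rewrite addrC.
pose P : {pred {malg F[tup]}} := fun g => G0 g == 0.
have GP g : g \in submod_gen (@tensor_rel F I (fun i => V i)) -> G0 g = 0.
  move=> /asboolP /(_ P) H; apply/eqP; apply: H.
    split; first by apply/eqP.
    by move=> c x y /eqP x0 /eqP y0; apply/eqP; rewrite G0l x0 y0 scaler0 addr0.
  move=> _ [v i c x y]; apply/eqP; rewrite !G0B.
  have := G0l c << tup_set v x >> 0; rewrite !addr0 G00 addr0 => ->.
  by rewrite !G0U mM addrAC addrK subrr.
pose G (z : out) : W := G0 (repr (z : quot (submod_gen (@tensor_rel F I (fun i => V i))))).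
have GE g : G (submod_pi _ g) = G0 g.
  apply/eqP; rewrite -subr_eq0 -G0B; apply/eqP/GP.
  by apply/submod_piE; rewrite /submod_pi reprK.
exists G; split=> [c x y|u]; last by rewrite /pure_tensor GE G0U.
case: (submod_piP x) (submod_piP y) => g -> [h ->].
by rewrite -submod_pi_linear !GE G0l.
Qed.

End Multilinear.

Section InducedModel.
Variables (A R : nzRingType) (iota : {rmorphism R -> A}) (N : lmodType R).
Variable G : N -> A.
Hypothesis GD : {morph G : v w / v + w}.
Hypothesis GZ : forall c v, G (c *: v) = iota c * G v.

Local Notation pre := {malg int[(A * N)%type]}.
Local Notation ind := (induced iota N).

(** Universal property for the balanced map (a, v) to a G(v); [GZ] is what makes it balanced. *)
Lemma induced_lift : exists L : ind -> A,
  (forall a x y, L (a *: x + y) = a * L x + L y) /\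
  forall a v, L (ind_tensor iota a v) = a * G v.
Proof.
pose h (p : A * N) := p.1 * G p.2.
pose L0 : {additive pre -> A} := mmap intr h.
have L0U p : L0 << p >> = h p by rewrite /L0 /= mmapU mul1r.
pose P : {pred pre} := fun g => L0 g == 0.
have LP g : g \in @ind_sub A R iota N -> L0 g = 0.
  move=> /asboolP /(_ P) H; apply/eqP; apply: H.
    split; first by apply/eqP; rewrite raddf0.
    by move=> x y /eqP x0 /eqP y0; apply/eqP; rewrite raddfB /= x0 y0 subr0.
  move=> _ [a b v|a v w|a c v]; apply/eqP; rewrite !raddfB /= !L0U /h /=.
  - by rewrite mulrDl addrAC addrK subrr.
  - by rewrite GD mulrDr addrAC addrK subrr.
  - by rewrite GZ mulrA subrr.
pose L (x : ind) : A := L0 (repr (x : quot (@ind_sub A R iota N))).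
have LE g : L (ind_pi iota g) = L0 g.
  apply/eqP; rewrite -subr_eq0 -raddfB; apply/eqP/LP.
  by apply/ind_piE; rewrite /ind_pi reprK.
have LT a v : L (ind_tensor iota a v) = a * G v by rewrite LE L0U.
have LB x y : L (x - y) = L x - L y.
  by case: (ind_piP x) (ind_piP y) => g -> [k ->]; rewrite -raddfB !LE raddfB.
have L00 : L 0 = 0 by have := LB 0 0; rewrite !subrr.
have LD x y : L (x + y) = L x + L y.
  have LN z : L (- z) = - L z by rewrite -sub0r LB L00 sub0r.
  by rewrite -{1}[y]opprK LB LN opprK.
exists L; split=> // a x y; rewrite LD; congr (_ + _).
elim/ind_tensor_ind: x => [|x z Hx Hz|b v].
- by rewrite scaler0 L00 mulr0.
- by rewrite scalerBr !LB Hx Hz mulrBr.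
- by rewrite -[a *: _]/(ind_scale a _) ind_scaleE !LT mulrA.
Qed.

Lemma ind_tensor0 (v : N) : ind_tensor iota 0 v = 0.
Proof.
have := ind_tensorDl iota 0 0 v; rewrite addr0 => /esym/eqP.
by rewrite -subr_eq0 addrK => /eqP.
Qed.

Lemma ind_tensorB a b (v : N) :
  ind_tensor iota (a - b) v = ind_tensor iota a v - ind_tensor iota b v.
Proof. by apply/eqP; rewrite eq_sym subr_eq -ind_tensorDl subrK. Qed.

Lemma ind_tensorR a c (v : N) :
  ind_tensor iota (a * iota c) v = ind_tensor iota a (c *: v).
Proof.
apply/ind_piE; apply/asboolP => S _ GS; apply: GS; exact: IndRelB.
Qed.

(* Since c n0 = z0 with c mapped to x, an element annihilating x = G z0
   annihilates the generator 1 (x) z0 of the induced module. *)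
Lemma induced_model (z0 n0 : N) (c : R) :
  (forall v, exists b, v = b *: z0) -> c *: n0 = z0 -> iota c = G z0 ->
  ideal_model (G z0) ind.
Proof.
move=> cyc cn cG; have [L [LL LT]] := induced_lift.
have gen y : exists a, y = ind_tensor iota a z0.
  elim/ind_tensor_ind: y => [|x y [a ->] [b ->]|a v].
  - by exists 0; rewrite ind_tensor0.
  - by exists (a - b); rewrite ind_tensorB.
  - by have [b ->] := cyc v; exists (a * iota b); rewrite ind_tensorR.
exists L; split=> //.
  move=> x y; have [a ->] := gen x; have [b ->] := gen y; rewrite !LT => E.
  apply/subr0_eq; rewrite -ind_tensorB -cn -ind_tensorR cG mulrBl E subrr.
  exact: ind_tensor0.
move=> h; split=> [[y <-]|[a ->]].
  by have [a ->] := gen y; exists a; rewrite LT.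
by exists (ind_tensor iota a z0); rewrite LT.
Qed.
End InducedModel.

(** * Block permutations *)

Section BlockComposition.
Local Open Scope nat_scope.

Lemma ribbon_descent_block (al : seq (seq nat)) (i z : nat) :
  proper al -> i < size al -> 0 < z < sumn (nth [::] al i) ->
  ribbon_descent al (sumn (take i (map sumn al)) + z) = (z \in Dset (nth [::] al i)).
Proof.
elim: al i => // a al IH [|i] /= /andP [/andP [a0 ap] pal] ial /andP [z0 zN].
  by rewrite add0n leqNgt zN orbF.
rewrite -addnA leq_addr addKn IH ?z0 //.
case: (boolP (_ \in Dset a)) => // /(Dset_bound ap) /andP [_].
by rewrite ltnNge leq_addr.
Qed.

Lemma block_notin_Dset (al : seq (seq nat)) (i z : nat) :
  i < size al -> 0 < z < sumn (nth [::] al i) ->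
  sumn (take i (map sumn al)) + z \notin Dset (map sumn al).
Proof.
elim: al i => // a al IH [|i] /= ial /andP [z0 zN]; rewrite mem_Dset_cons.
  by rewrite add0n ltn_eqF // leqNgt zN /= andbF.
rewrite -addnA leq_addr addKn (negbTE (IH _ _ _)) ?z0 // orbF.
rewrite -[X in (_ + _ == X)%N]addn0 eqn_add2l addn_eq0 (gtn_eqF z0) andbF.
by rewrite andbF.
Qed.
End BlockComposition.

Section Blocks.
Variables (n : nat) (al : seq (seq nat)).
Hypothesis g : is_gribbon n al.
Local Notation ns := (map sumn al).
Local Notation N i := (sumn (nth [::] al i)).
Local Notation off r := (sumn (take r ns)).
Local Notation I := (desc_set n al).
Local Notation K := (row_set n al).
Local Notation Di i := (descents (N i) (nth [::] al i)).
Implicit Types (i : 'I_(size al)) (l m : 'I_n.-1) (x y : 'I_n).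

Let pal : proper al. Proof. by case: (gribbon_proper g). Qed.
Let tal : total al = n. Proof. by case: (gribbon_proper g). Qed.

Lemma nth_sums i : nth 0%N ns i = N i.
Proof. by rewrite (nth_map [::]). Qed.

Lemma enc_subproof i (j : 'I_(N i)) : (flatten_index ns i j < n)%N.
Proof. by rewrite -[X in (_ < X)%N]tal flatten_indexP // nth_sums. Qed.

Definition enc i (j : 'I_(N i)) : 'I_n := Ordinal (enc_subproof j).

Lemma enc_surj x : exists i (j : 'I_(N i)), x = enc j.
Proof.
have xs : (x < sumn ns)%N by rewrite -/(total al) tal.
have ri := reshape_indexP xs; rewrite size_map in ri.
have ro := reshape_offsetP xs; rewrite (nth_sums (Ordinal ri)) in ro.
exists (Ordinal ri), (Ordinal ro); apply: val_inj.
by rewrite /= reshape_indexK.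
Qed.

Lemma enc_block i i' (j : 'I_(N i)) (j' : 'I_(N i')) : enc j = enc j' -> i = i'.
Proof.
move=> /(congr1 val) /= /(congr1 (reshape_index ns)).
by rewrite !flatten_indexKl ?nth_sums // => /val_inj.
Qed.

Lemma enc_inj i : injective (@enc i).
Proof.
by move=> j j' /(congr1 val) /= /eqP; rewrite eqn_add2l => /eqP /val_inj.
Qed.

Lemma offS i : off i.+1 = (off i + N i)%N.
Proof. by rewrite (take_nth 0%N) ?size_map // sumn_rcons nth_sums. Qed.

Lemma off_mono (r r' : nat) : (r <= r')%N -> (off r <= off r')%N.
Proof.
move=> rr; rewrite -(take_takel ns rr).
by rewrite -[X in (_ <= sumn X)%N](cat_take_drop r) sumn_cat leq_addr.
Qed.

Lemma enc_lt_off i (j : 'I_(N i)) (r : nat) : (enc j < off r)%N = (i < r)%N.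
Proof.
have jN := ltn_ord j; rewrite /= /flatten_index; case: (leqP r i) => ri.
  by have := off_mono ri; lia.
by have := off_mono ri; rewrite offS; lia.
Qed.

Lemma bgen_subproof i (j : 'I_(N i).-1) : (flatten_index ns i j < n.-1)%N.
Proof. by have := enc_subproof (hi j); rewrite /flatten_index /= addnS; lia. Qed.

Definition bgen i (j : 'I_(N i).-1) : 'I_n.-1 := Ordinal (bgen_subproof j).

Lemma lo_bgen i (j : 'I_(N i).-1) : lo (bgen j) = enc (lo j).
Proof. exact: val_inj. Qed.

Lemma hi_bgen i (j : 'I_(N i).-1) : hi (bgen j) = enc (hi j).
Proof. by apply: val_inj; rewrite /= /flatten_index addnS. Qed.

Lemma junctionP (z : nat) : reflect (exists2 r, (0 < r < size al)%N & z = off r)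
  (z \in Dset ns).
Proof.
rewrite /Dset size_map; apply: (iffP mapP) => [[r + ->]|[r /andP [r0 rs] ->]].
  by rewrite mem_iota add0n => rs; exists r.+1 => //; lia.
by exists r.-1; rewrite ?mem_iota ?prednK //; lia.
Qed.

Lemma bgen_surj l : l.+1 \notin Dset ns -> exists i (j : 'I_(N i).-1), l = bgen j.
Proof.
move=> lD; have [i [j lE]] := enc_surj (lo l).
have lj : l = (off i + j)%N :> nat by have := congr1 val lE.
have jN : (j < (N i).-1)%N.
  case: (ltngtP j (N i).-1) => //; first by have := ltn_ord j; lia.
  (* If j is the last position of its block then [l.+1] is a junction; the block cannot be the last
     one, since [l.+1] is below n. *)
  move=> jE; case/negP: lD; apply/junctionP; exists i.+1.
    rewrite /= ltn_neqAle ltn_ord andbT; apply/eqP => iS.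
    have := offS i; rewrite iS take_oversize ?size_map // -/(total al) tal.
    by have := ltn_ord l; have := ltn_ord j; lia.
  by rewrite offS lj; have := ltn_ord j; lia.
by exists i, (Ordinal jN); apply: val_inj; rewrite /= lj.
Qed.

Lemma bgen_bound i (j : 'I_(N i).-1) : (0 < j.+1 < N i)%N.
Proof. by have := ltn_ord j; lia. Qed.

Lemma bgen_notin i (j : 'I_(N i).-1) : (bgen j).+1 \notin Dset ns.
Proof. by rewrite /= -addnS block_notin_Dset // bgen_bound. Qed.

Lemma bgen_desc i (j : 'I_(N i).-1) : (bgen j \in I) = (j \in Di i).
Proof.
by rewrite in_desc_set // /= -addnS ribbon_descent_block ?bgen_bound // inE.
Qed.

Lemma bgen_row i (j : 'I_(N i).-1) : (bgen j \in K) = (j \in ~: Di i).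
Proof. by rewrite in_setD bgen_desc in_col_set // bgen_notin andbT in_setC. Qed.

Lemma adj_bgen i (j : 'I_(N i).-1) (j' : 'I_(N i)) :
  adj (bgen j) (enc j') = enc (adj j j').
Proof. by rewrite {1}/adj lo_bgen hi_bgen -inj_tperm //; exact: enc_inj. Qed.

Lemma adj_bgen_out i i' (j : 'I_(N i).-1) (j' : 'I_(N i')) : i != i' ->
  adj (bgen j) (enc j') = enc j'.
Proof.
move=> ii; rewrite /adj lo_bgen hi_bgen tpermD //.
  by apply: contraNneq ii => /enc_block ->.
by apply: contraNneq ii => /enc_block ->.
Qed.

Lemma dec_subproof x : exists p : {i : 'I_(size al) & 'I_(N i)},
  enc (tagged p) = x.
Proof.
have [i [j ->]] := enc_surj x.
by exists (Tagged (fun i : 'I_(size al) => 'I_(N i)) j).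
Qed.

Definition dec x := sval (cid (dec_subproof x)).

Lemma decK x : enc (tagged (dec x)) = x.
Proof. by rewrite /dec; case: cid. Qed.

Section BlockPerm.
Variable s : forall i, 'S_(N i).

Definition bfun x : 'I_n := enc (s (tag (dec x)) (tagged (dec x))).

Lemma bfunE i (j : 'I_(N i)) : bfun (enc j) = enc (s i j).
Proof.
rewrite /bfun; have := decK (enc j); case: (dec _) => i' j' /= E.
have ii := enc_block E; subst i'.
by rewrite (enc_inj E).
Qed.

Lemma bfun_inj : injective bfun.
Proof.
move=> x y; have [i [j ->]] := enc_surj x; have [i' [j' ->]] := enc_surj y.
rewrite !bfunE => E; have ii := enc_block E; subst i'.
by rewrite (perm_inj (enc_inj E)).
Qed.

Definition bperm : 'S_n := perm bfun_inj.

Lemma bpermE i (j : 'I_(N i)) : bperm (enc j) = enc (s i j).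
Proof. by rewrite permE bfunE. Qed.

Lemma bpermV i (j : 'I_(N i)) : (bperm^-1)%g (enc j) = enc ((s i)^-1%g j).
Proof. by apply: (@perm_inj _ bperm); rewrite permKV bpermE permKV. Qed.

Lemma enc_le i (j j' : 'I_(N i)) : (enc j < enc j')%N = (j < j')%N.
Proof. by rewrite /= ltn_add2l. Qed.

Lemma asc_bperm i (j : 'I_(N i).-1) : asc (bgen j) bperm = asc j (s i).
Proof. by rewrite /asc lo_bgen hi_bgen !bpermE enc_le. Qed.

Lemma asc_bpermV i (j : 'I_(N i).-1) : asc (bgen j) bperm^-1 = asc j (s i)^-1.
Proof. by rewrite /asc lo_bgen hi_bgen !bpermV enc_le. Qed.

Lemma bperm_stable : stable (col_set n al) bperm.
Proof.
move=> m x; rewrite in_col_set // negbK => /junctionP [r _ rE].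
rewrite -(ltnS (bperm x)) -(ltnS x) rE; have [i [j ->]] := enc_surj x.
by rewrite bpermE !enc_lt_off.
Qed.

Lemma bperm_row i (j k : 'I_(N i).-1) : (adj j * s i = s i * adj k)%g ->
  (adj (bgen j) * bperm = bperm * adj (bgen k))%g.
Proof.
move=> E; apply/permP => x; have [i' [j' ->]] := enc_surj x; rewrite !permM.
have [ii|ii] := eqVneq i i'; last by rewrite bpermE !adj_bgen_out // bpermE.
subst i'; rewrite bpermE !adj_bgen bpermE; congr enc.
by have := congr1 (fun p : 'S__ => p j') E; rewrite !permM.
Qed.

Lemma bperm_xset : (forall i, xset (Di i) (~: Di i) (s i)) -> xset I K bperm.
Proof.
move=> sx; have KJ l : l \in I \/ l \in K -> l.+1 \notin Dset ns.
  rewrite -in_col_set // => -[/desc_set_col ->|] //.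
  by rewrite in_setD => /andP [].
apply/xsetP; split=> l lS.
  have [|i [j lE]] := @bgen_surj l; first by apply: KJ; left.
  subst l; rewrite asc_bpermV; have /xsetP [H _] := sx i.
  by apply: H; rewrite -bgen_desc.
have [|i [j lE]] := @bgen_surj l; first by apply: KJ; right.
subst l; rewrite asc_bpermV; have /xsetP [_ H] := sx i.
by apply: H; rewrite -bgen_row.
Qed.

Lemma xset_bperm : xset I K bperm -> forall i, xset (Di i) (~: Di i) (s i).
Proof.
move=> /xsetP [xI xK] i; apply/xsetP; split=> j jS; rewrite -asc_bpermV.
  by apply: xI; rewrite bgen_desc.
by apply: xK; rewrite bgen_row.
Qed.

End BlockPerm.

Lemma bperm_inj (s s' : forall i, 'S_(N i)) : bperm s = bperm s' -> forall i, s i = s' i.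
Proof.
move=> E i; apply/permP => j; apply: enc_inj.
by rewrite -!bpermE E.
Qed.

Lemma bperm_adj (s s' : forall i, 'S_(N i)) i (j : 'I_(N i).-1) :
  s' i = (adj j * s i)%g -> (forall i', i != i' -> s' i' = s i') ->
  bperm s' = (adj (bgen j) * bperm s)%g.
Proof.
move=> E E'; apply/permP => x; have [i' [j' ->]] := enc_surj x; rewrite permM.
have [ii|ii] := eqVneq i i'; last by rewrite adj_bgen_out // !bpermE E'.
by subst i'; rewrite adj_bgen !bpermE E permM.
Qed.

Lemma stable_off w r x : stable (col_set n al) w -> (w x < off r)%N = (x < off r)%N.
Proof.
move=> st; have [->|r0] := posnP (off r); first by rewrite !ltn0.
have [rn|nr] := ltnP (off r) n; last by rewrite !(leq_trans (ltn_ord _)).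
have mn : ((off r).-1 < n.-1)%N by lia.
have := st (Ordinal mn) x; rewrite /= -(ltnS (w x)) -(ltnS x) prednK // => -> //.
rewrite in_col_set // negbK /= prednK //; apply/junctionP; exists r => //.
apply/andP; split; first by case: r r0 {rn mn} => //; rewrite take0.
rewrite ltnNge; apply/negP => sr; move: rn.
by rewrite take_oversize ?size_map // -/(total al) tal ltnn.
Qed.

(** A block is the difference of two initial segments ending at junctions, both preserved by w. *)
Lemma stable_bperm w : stable (col_set n al) w -> exists s, bperm s = w.
Proof.
move=> st; have ex i (j : 'I_(N i)) : exists j' : 'I_(N i), w (enc j) = enc j'.
  have [i' [j' E]] := enc_surj (w (enc j)).
  have H r : (i' < r)%N = (i < r)%N.
    by rewrite -(enc_lt_off j') -E stable_off // enc_lt_off.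
  have ii : i = i'.
    apply/val_inj/eqP; rewrite eqn_leq; apply/andP; split.
      by rewrite -(ltnS i) -H ltnSn.
    by rewrite -(ltnS i') H ltnSn.
  by subst i'; exists j'.
pose f i j := sval (cid (ex i j)).
have fE i j : w (enc j) = enc (f i j) by rewrite /f; case: cid.
have f_inj i : injective (f i).
  by move=> j j' E; apply/enc_inj/(@perm_inj _ w); rewrite !fE E.
exists (fun i => perm (@f_inj i)); apply/permP => x.
by have [i [j ->]] := enc_surj x; rewrite bpermE fE permE.
Qed.

End Blocks.

(** * The outer tensor product *)

Section OuterModel.
Variables (F : fieldType) (n : nat) (A : algType F) (D : heckeAlg n A).
Variables (al : seq (seq nat)) (g : is_gribbon n al).
Local Notation ns := (map sumn al).
Local Notation cmp i := (nth [::] al i).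
Local Notation N i := (sumn (cmp i)).
Local Notation I := (desc_set n al).
Local Notation K := (row_set n al).
Local Notation Di i := (descents (N i) (cmp i)).
Local Notation idx := {dffun forall i : 'I_(size al), SYT (N i) [:: cmp i]}.
Local Notation V i := (tab_space F (N i) [:: cmp i]).
Local Notation tup := {dffun forall i : 'I_(size al), V i}.
Local Notation out := (outer_space F al).
Local Notation z := (xI D I * yK D K).
Implicit Types (i : 'I_(size al)) (t : idx) (u : tup).

Lemma component_comp i : is_comp (N i) (cmp i).
Proof.
have [_ pal _] := gribbon_proper g.
by rewrite /is_comp eqxx andbT; have /andP [] := all_nthP [::] pal i (ltn_ord i).
Qed.

Local Notation stepsi i := (comp_steps (component_comp i)).

Let Di_disjoint i : {in ~: Di i, forall k, k \notin Di i}.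
Proof. by move=> k; rewrite inE. Qed.

Definition idx_perm t : 'S_n := bperm g (fun i => tabperm (stepsi i) (t i)).
Local Notation w := idx_perm.

Lemma idx_perm_inj : injective w.
Proof.
move=> t t' E; apply/ffunP => i; apply: (@tabperm_inj _ _ _ _ (stepsi i)).
exact: (bperm_inj E i).
Qed.

Lemma idx_perm_xset t : xset I K (w t).
Proof. by apply: bperm_xset => i; apply/tabperm_xset/Di_disjoint. Qed.

(** Since I is contained in J, the longest element of I is a block permutation. Thus x y is itself
    the image of a pure tensor of tableaux. *)
Lemma idx_perm_longest : exists t, w t = longest I.
Proof.
have [_ pal tal] := gribbon_proper g.
have st : stable (col_set n al) (longest I).
  move=> m x mJ; apply: (young_stable (longest_young I)).
  by apply: contraNN mJ; apply: desc_set_col.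
have [s sE] := stable_bperm g st.
have sx : xset I K (bperm g s).
  by rewrite sE; apply: longest_xset; apply: row_set_disjoint.
have ex i : exists q, tabperm (stepsi i) q = s i.
  by apply: tabperm_surj; exact: (xset_bperm sx i).
exists [ffun i => sval (cid (ex i))]; rewrite -sE; apply/permP => x.
have [i [j ->]] := enc_surj g x; rewrite !bpermE ffunE.
by case: cid => q /= ->.
Qed.

Definition idx_elt t : A := basis_w D (w t) * yK D K.
Local Notation e := idx_elt.

Lemma indep_idx_elt : indep e.
Proof.
apply: (@indep_basis_yK F n A D _ w idx_perm_inj I K).
exact: idx_perm_xset.
Qed.

Definition idx_set t i (s : SYT (N i) [:: cmp i]) : idx := [ffun i' => dfwith t s i'].

Lemma idx_set_eq t i (s : SYT (N i) [:: cmp i]) : idx_set t s i = s.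
Proof. by rewrite ffunE dfwith_in. Qed.

Lemma idx_set_neq t i i' (s : SYT (N i) [:: cmp i]) : i != i' -> idx_set t s i' = t i'.
Proof. by move=> ii; rewrite ffunE dfwith_out. Qed.

Lemma basis_idx_set t i (s : SYT (N i) [:: cmp i]) :
  tup_set (basis_tup F t) (tab_vec F s : V i) = basis_tup F (idx_set t s).
Proof.
apply/ffunP => i'; have [<-|ii] := eqVneq i i'.
  by rewrite tup_set_eq [RHS]ffunE idx_set_eq.
rewrite (tup_set_neq (S := fun i => SYT (N i) [:: cmp i])) //.
by rewrite [LHS]ffunE [RHS]ffunE idx_set_neq.
Qed.

Variable op : forall i, 'I_(N i).-1 -> V i -> V i.
Hypothesis op_lin : forall i (j : 'I_(N i).-1), linear (op j).
Hypothesis op_rule : forall i (j : 'I_(N i).-1) (t : SYT (N i) [:: cmp i]),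
  let r := row_of (val t) (lo j) in
  let r' := row_of (val t) (hi j) in
  [/\ (r' < r)%N -> op j (tab_vec F t) = 0,
      r = r' -> op j (tab_vec F t) = tab_vec F t
    & (r < r')%N -> exists2 s : SYT (N i) [:: cmp i], val s = swap j (val t) &
        op j (tab_vec F t) = tab_vec F t + tab_vec F s].

(** Both sides are multilinear, so basis tuples suffice; there the three cases of the rule for one
    component lift to the block permutation. *)
Lemma mlin_gen i (j : 'I_(N i).-1) u :
  gen D (bgen g j) * mlin e u = mlin e (tup_set u (op j (u i))).
Proof.
move: u; apply: multilinear_ext.
- move=> u i' c x y; rewrite mlin_multilinear mulrDr.
  by rewrite scalerAr.
- move=> u i' c x y; have [ii|ii] := eqVneq i' i.
    subst i'; rewrite !tup_set_eq !tup_set_set op_lin.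
    exact: mlin_multilinear.
  rewrite !(tup_set_neq _ _ ii) !(tup_setC _ _ _ ii).
  exact: mlin_multilinear.
move=> t; rewrite mlin_basis.
have -> : basis_tup F t i = tab_vec F (t i) by rewrite ffunE.
have [d r s] := op_rule j (t i).
case: (ltngtP (row_of (val (t i)) (lo j)) (row_of (val (t i)) (hi j))) => rr.
- have [s0 s0E ->] := s rr.
  have [a [s1 s1E pE]] := tabperm_swap (stepsi i) (@Di_disjoint i) rr.
  have ss : s0 = s1 by apply: val_inj; rewrite s0E s1E.
  subst s1; rewrite (multilinearD _ _ _ (mlin_multilinear e)) !basis_idx_set.
  rewrite !mlin_basis genE mulrDl mul1r; congr (_ + _).
    by congr e; apply/ffunP => i'; have [<-|ii] := eqVneq i i';
      rewrite ?idx_set_eq ?idx_set_neq.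
  rewrite /e mulrA basis_mul_asc ?asc_bperm //; congr (basis_w D _ * _).
  symmetry; apply: bperm_adj => [|i' ii]; last by rewrite idx_set_neq.
  by rewrite idx_set_eq.
- rewrite d // (multilinear0 _ _ (mlin_multilinear e)) genE mulrDl mul1r.
  have a := tabperm_desc (stepsi i) rr.
  by rewrite [genb _ _ * _]mulrA basis_mul_desc ?asc_bperm // mulNr subrr.
- rewrite r // basis_idx_set mlin_basis.
  have -> : idx_set t (t i) = t.
    by apply/ffunP => i'; have [<-|ii] := eqVneq i i';
      rewrite ?idx_set_eq ?idx_set_neq.
  have [a [k kD E]] := tabperm_row (stepsi i) (@Di_disjoint i) rr.
  have kK : bgen g k \in K by rewrite bgen_row.
  have a' : asc (bgen g j) (w t) by rewrite asc_bperm.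
  have -> : gen D (bgen g j) * e t = e t + genb D (bgen g j) * e t.
    by rewrite genE mulrDl mul1r.
  rewrite [genb _ _ * _](genb_basis_row D kK a') ?addr0 //.
  exact: bperm_row.
Qed.

Variables (R : algType F) (iota : {rmorphism R -> A}).
Hypothesis iotaZ : forall c r, iota (c *: r) = c *: iota r.
Hypothesis iota_sub : forall S : {pred A}, GRing.subalg_closed S ->
  (forall l : 'I_n.-1, l.+1 \notin Dset ns -> gen D l \in S) -> forall r, iota r \in S.
Hypothesis iota_gen : forall l : 'I_n.-1, l.+1 \notin Dset ns ->
  exists r, iota r = gen D l.

Lemma iota_closed r v :
  exists v' : {ffun idx -> F^o}, lincomb e v' = iota r * lincomb e v.
Proof.
(* The elements of A whose left multiplication preserves the span V; they form a subalgebra, so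
   generators are enough. *)
pose S : {pred A} := fun h => `[< forall v : {ffun idx -> F^o},
  exists v' : {ffun idx -> F^o}, lincomb e v' = h * lincomb e v >].
suff /asboolP : iota r \in S by [].
apply: iota_sub => [|l lD].
  split; first by apply/asboolP => u; exists u; rewrite mul1r.
    move=> c x y /asboolP Hx /asboolP Hy; apply/asboolP => u.
    have [a aE] := Hx u; have [b bE] := Hy u; exists (c *: a + b).
    by rewrite raddfD /= lincombZ aE bE mulrDl scalerAl.
  move=> x y /asboolP Hx /asboolP Hy; apply/asboolP => u.
  have [b bE] := Hy u; have [a aE] := Hx b; exists a.
  by rewrite aE bE mulrA.
apply/asboolP => u; have [i [j ->]] := bgen_surj g lD.
have ex t : exists v' : {ffun idx -> F^o}, lincomb e v' = gen D (bgen g j) * e t.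
  rewrite -(mlin_basis e t) mlin_gen.
  pose u' : tup := tup_set (basis_tup F t) (op j (basis_tup F t i)).
  pose b : {ffun idx -> F^o} := [ffun t' : idx => \prod_i0 (u' i0 (t' i0) : F)].
  exists b.
  by rewrite /lincomb /mlin; apply: eq_bigr => t' _; rewrite ffunE.
exists (\sum_t (u t : F) *: sval (cid (ex t))).
rewrite raddf_sum mulr_sumr; apply: eq_bigr => t _ /=.
by rewrite lincombZ -scalerAr; case: cid => b /= ->.
Qed.

Lemma iota_word (f : 'I_n.-1 -> A) (s : seq 'I_n.-1) :
  (forall l, l \in s -> exists r, iota r = f l) ->
  exists r, iota r = \prod_(l <- s) f l.
Proof.
elim: s => [|l s IH] H; first by exists 1; rewrite big_nil rmorph1.
have [l' l's|r rE] := IH; first by apply: H; rewrite inE l's orbT.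
have [r' r'E] := H l (mem_head _ _).
by exists (r' * r); rewrite big_cons rmorphM rE r'E.
Qed.

Let gen_iota l : l \in col_set n al -> exists r, iota r = gen D l.
Proof. by have [_ pal tal] := gribbon_proper g; rewrite in_col_set // => /iota_gen. Qed.

Let genb_iota l : l \in col_set n al -> exists r, iota r = genb D l.
Proof. by move=> /gen_iota [r rE]; exists (r - 1); rewrite rmorphB rmorph1 rE. Qed.

Lemma stable_iota v : stable (col_set n al) v -> exists r, iota r = basis_w D v.
Proof.
move=> st; apply: iota_word => l ls; apply: genb_iota.
by apply: stable_word ls; rewrite ?redword_reduced // redwordE.
Qed.

Lemma yK_iota : exists r, iota r = yK D K.
Proof.
apply: iota_word => l /redword_longest; rewrite in_setD => /andP [_].
exact: gen_iota.
Qed.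

Lemma idx_elt_iota t : exists r, iota r = e t.
Proof.
have [r rE] := stable_iota (bperm_stable g (fun i => tabperm (stepsi i) (t i))).
by have [r' r'E] := yK_iota; exists (r * r'); rewrite rmorphM rE r'E.
Qed.

(** The tensor product is embedded by [G] onto V, and its action is pulled back. It is generated by
    [z0], the preimage of z = x y, and since z also comes from R, [induced_model] applies once z is
    written as z v0 with v0 in V. *)
Lemma outer_model : exists act : R -> out -> out, [/\ module_action act,
  (forall i (j : 'I_(N i).-1) (l : 'I_n.-1) h u,
     l = (sumn (take i ns) + j)%N :> nat -> iota h = gen D l ->
     act h (pure_tensor u) = pure_tensor (tup_set u (op j (u i)))) &
  forall m : module_action act, ideal_model z (induced iota (act_mod m))].
Proof.
have [G [Gl GE]] := tensor_lift (mlin_multilinear e).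
have G_basis t : G (pure_tensor (basis_tup F t)) = e t by rewrite GE mlin_basis.
have G_sum v : G (lincomb (fun t => pure_tensor (basis_tup F t) : out) v) = lincomb e v.
  have G0 : G 0 = 0 by have := Gl (-1) 0 0; rewrite scaler0 addr0 scaleN1r addNr.
  rewrite /lincomb; elim/big_rec2: _ => [//|t x y _ <-].
  by rewrite Gl G_basis.
have G_inj : injective G.
  move=> x y; have [u ->] := tensor_span x; have [v ->] := tensor_span y.
  move=> /(etrans (esym (G_sum u))) E.
  by rewrite (indep_inj indep_idx_elt (etrans E (G_sum v))).
have G_im x : exists v, G x = lincomb e v.
  by have [v ->] := tensor_span x; exists v; apply: G_sum.
have G_closed r x : exists x', G x' = iota r * G x.
  have [v ->] := G_im x; have [v' <-] := iota_closed r v.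
  by exists (lincomb (fun t => pure_tensor (basis_tup F t) : out) v'); apply: G_sum.
have iota_lin : linear (iota : R -> A).
  by move=> c a b; rewrite rmorphD iotaZ.
have [act [mact actE]] := transport_action (V := out) iota_lin (rmorph1 iota)
  (rmorphM iota) Gl G_inj G_closed.
exists act; split=> // [i j l h u lE hE|m].
  apply: G_inj; rewrite actE !GE hE.
  have -> : l = bgen g j by apply: val_inj.
  exact: mlin_gen.
have [t0 t0E] := idx_perm_longest.
have et0 : e t0 = z by rewrite /e t0E.
pose z0 : out := pure_tensor (basis_tup F t0).
have Gz0 : G z0 = z by rewrite G_basis.
have [c cE] := idx_elt_iota t0; rewrite et0 in cE.
pose e' t := e t * z.
have e'_indep : indep e'.
  apply: (@indep_basis_mul F n A D _ w idx_perm_inj I K (fun=> K)).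
    exact: idx_perm_xset.
  by move=> t; have /xsetP [] := idx_perm_xset t.
have e'E v : lincomb e' v = lincomb e v * z.
  by rewrite /lincomb mulr_suml; apply: eq_bigr => t _; rewrite scalerAl.
(* Right multiplication by z maps V injectively into V, hence onto V; so some element v0 of V has v0
   z = z. *)
have [t|v vE] := indep_span e'_indep (f := e) _ (delta F t0).
  have [r rE] := idx_elt_iota t; have [v' v'E] := iota_closed r (delta F t0).
  by exists v'; rewrite v'E lincomb_delta rE et0.
rewrite e'E lincomb_delta et0 in vE.
(* From v0 z = z one gets (z v0) z = z z with z v0 and z both in V, and right multiplication by z is
   injective on V. *)
have zv : z * lincomb e v = z.
  have [u1 u1E] := iota_closed c v; rewrite cE in u1E.
  have : lincomb e' (u1 - delta F t0) = 0.
    by rewrite e'E raddfB /= u1E lincomb_delta et0 mulrBl -[z * _ * z]mulrA vE subrr.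
  move=> /e'_indep /subr0_eq u1E'.
  by rewrite -u1E u1E' lincomb_delta et0.
pose n0 := lincomb (fun t => pure_tensor (basis_tup F t) : out) v.
have E : ideal_model (G z0) (induced iota (act_mod m)).
  apply: (@induced_model A R iota (act_mod m) (G : act_mod m -> A) _ _ z0 n0 c).
  - by move=> x y; have := Gl 1 x y; rewrite !scale1r.
  - exact: actE.
  - move=> x; have [v1 v1E] := G_im x.
    have ex t := stable_iota (bperm_stable g (fun i => tabperm (stepsi i) (t i))).
    (* Each [e t] equals pib_{w t} z up to the sign [bsign], and pib_{w t} comes from R; so [z0]
       generates the tensor product over R. *)
    exists (\sum_t ((v1 t : F) * bsign F I) *: sval (cid (ex t))).
    apply: G_inj; rewrite [RHS]actE v1E Gz0 rmorph_sum mulr_suml /=.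
    apply: eq_bigr => t _; rewrite iotaZ; case: cid => r /= ->.
    rewrite {1}/e (basis_yK_ideal D (idx_perm_xset t)).
    by rewrite -!scalerAl scalerA.
  - by apply: G_inj; rewrite [LHS]actE cE G_sum zv Gz0.
  - by rewrite cE Gz0.
by rewrite Gz0 in E.
Qed.

End OuterModel.

(** * The theorem *)

Lemma module_action_sub1 (F : comNzRingType) (A : algType F) (V : lmodType F)
  (act : A -> V -> V) : module_action act -> forall a v, act a v = act (a - 1) v + v.
Proof.
move=> [_ linl act1 _] a v.
rewrite [a - 1]addrC; have := linl v (-1) 1 a; rewrite !scaleN1r act1 => ->.
by rewrite addrAC addNr add0r.
Qed.

Section HeckeAlgebra.
Variables (F : fieldType) (n : nat) (D : heckeAlg n (hecke F n)).
Hypothesis DE : gen D = @hpi F n.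

Lemma genb_hpibar i : genb D i = hpibar F i.
Proof. by rewrite /genb DE. Qed.

Lemma tab_actionE al (act : hecke F n -> tab_space F n al -> tab_space F n al) :
  tab_action act <-> module_action act /\ tab_rule D act.
Proof.
split=> -[m r]; split=> // i t; have := r i t.
  by rewrite genb_hpibar.
by rewrite genb_hpibar.
Qed.

Lemma ideal_genE (I K : {set 'I_n.-1}) :
  xI D I * yK D K = hpibar_w F (longest I) * hpi_w F (longest K).
Proof.
congr (_ * _); first by apply: eq_bigr => i _; apply: genb_hpibar.
by apply: eq_bigr => i _; rewrite DE.
Qed.

Lemma tab_action_unique al (I K : {set 'I_n.-1}) : cell_steps al I K ->
  {in K, forall k, k \notin I} ->
  exists! act, tab_action (F := F) (n := n) (al := al) act.
Proof.
move=> steps KI; have [act [m r]] := tab_rule_exists D steps KI.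
exists act; split=> [|act' /tab_actionE [m' r']]; first by apply/tab_actionE.
exact: tab_rule_unique steps KI _ _ m r m' r'.
Qed.

Lemma tabmod_model al (I K : {set 'I_n.-1}) (P : tabmod F n al) :
  cell_steps al I K -> {in K, forall k, k \notin I} ->
  ideal_model (xI D I * yK D K) P.
Proof.
move=> steps KI; apply: (tab_model steps KI).
by have /tab_actionE [] := tabmod_actP P.
Qed.

Lemma outer_induced_model al (g : is_gribbon n al)
    (Pcomp : forall i : 'I_(size al), tabmod F (sumn (nth [::] al i)) [:: nth [::] al i]) :
  exists N : outermod n Pcomp,
    ideal_model (xI D (desc_set n al) * yK D (row_set n al)) (outer_induced N).
Proof.
pose op i j := tabmod_act (Pcomp i) (hpi F j).
have op_lin i j : linear (op i j).
  by have [[lin _ _ _] _] := tabmod_actP (Pcomp i); apply: lin.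
have opE i j v : op i j v = tabmod_act (Pcomp i) (hpibar F j) v + v.
  exact: (module_action_sub1 (proj1 (tabmod_actP (Pcomp i)))).
have op_rule (i : 'I_(size al)) (j : 'I_(sumn (nth [::] al i)).-1)
    (t : SYT (sumn (nth [::] al i)) [:: nth [::] al i]) :
  let r := row_of (val t) (lo j) in
  let r' := row_of (val t) (hi j) in
  [/\ (r' < r)%N -> op i j (tab_vec F t) = 0,
      r = r' -> op i j (tab_vec F t) = tab_vec F t
    & (r < r')%N -> exists2 s : SYT (sumn (nth [::] al i)) [:: nth [::] al i],
        val s = swap j (val t) & op i j (tab_vec F t) = tab_vec F t + tab_vec F s].
  have [_ r] := tabmod_actP (Pcomp i); have [d e s] := r j t.
  split=> rr; rewrite opE.
  - by rewrite d // addNr.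
  - by rewrite e // add0r.
  - by have [u uE ->] := s rr; exists u => //; rewrite addrC.
pose R : algType F := parabolic F n (map sumn al).
pose iota : {rmorphism R -> hecke F n} := \val.
have iotaZ (c : F) (r : R) : iota (c *: r) = c *: iota r by [].
have iota_sub (S : {pred hecke F n}) : GRing.subalg_closed S ->
    (forall l : 'I_n.-1, l.+1 \notin Dset (map sumn al) -> gen D l \in S) ->
    forall r, iota r \in S.
  move=> cS gS r; have /asboolP := valP r; apply=> // h [l lD ->].
  by have := gS l lD; rewrite DE.
have iota_gen (l : 'I_n.-1) : l.+1 \notin Dset (map sumn al) ->
    exists r, iota r = gen D l.
  move=> lD; have lI : hpi F l \in subalg_gen (@parabolic_gen F n (map sumn al)).
    by apply/asboolP => S cS gS; apply: gS; exists l.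
  by exists (Sub (hpi F l) lI); rewrite /= DE.
have [act [m actE model]] := outer_model g op_lin op_rule iotaZ iota_sub iota_gen.
have actP : @outer_action F n al Pcomp act.
  split=> // i j l h u lE hE; apply: (actE _ _ _ _ _ lE).
  by rewrite DE; apply: hE.
by exists (Outermod actP); apply: model.
Qed.

End HeckeAlgebra.

Theorem theorem3p3 (F : fieldType) (n : nat) :
  (forall a : seq nat, is_comp n a ->
     (exists! act, tab_action (F := F) (n := n) (al := [:: a]) act) /\
     (forall P : tabmod F n [:: a], lmod_iso P (projI F (descents n a))))
  /\
  (forall al : seq (seq nat), is_gribbon n al ->
     let I := descents n (near_concats al) in
     let J := descents n (near_concats [seq nseq (sumn a) 1%N | a <- al]) in
     (exists! act, tab_action (F := F) (n := n) (al := al) act) /\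
     (forall (P : tabmod F n al)
             (Pcomp : forall i : 'I_(size al),
                tabmod F (sumn (nth [::] al i)) [:: nth [::] al i])
             (Pbr : forall b : seq_sub (brackets al), tabmod F n [:: \val b]),
        lmod_iso P (projIJ F I J) /\
        exists N : outermod n Pcomp,
          lmod_iso P (outer_induced N) /\
          lmod_iso (outer_induced N)
            (dsum (fun b : seq_sub (brackets al) => Pbr b)))).
Proof.
have [D DE] := hecke_heckeAlg F n; split=> [a ca | al g I J].
  have KI : {in ~: descents n a, forall k, k \notin descents n a}.
    by move=> k; rewrite inE.
  split=> [|P]; first exact: tab_action_unique DE _ _ _ (comp_steps ca) KI.
  rewrite /projI -(ideal_genE DE).
  exact: ideal_model_iso (tabmod_model DE P (comp_steps ca) KI) (lideal_model _).
have steps := gribbon_steps g; have KI := @row_set_disjoint n al.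
split=> [|P Pcomp Pbr]; first exact: tab_action_unique DE _ _ _ steps KI.
have mP := tabmod_model DE P steps KI.
split.
  rewrite /projIJ -(ideal_genE DE).
  exact: ideal_model_iso mP (lideal_model _).
have [N mN] := outer_induced_model DE g Pcomp.
exists N; split; first exact: ideal_model_iso mP mN.
apply: ideal_model_iso mN _.
apply: (@dsum_model F n _ D al g (fun b => tabmod_act (Pbr b))
  (fun b => proj1 (tabmod_actP (Pbr b)))) => b.
by have /(tab_actionE DE) [] := tabmod_actP (Pbr b).
Qed.
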